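(* Let $f:M\to N$ be a holomorphic map between Kähler manifolds $(M,g)$, $(N,h)$ with $\dim_{\mathbb C}M=m\le n=\dim_{\mathbb C}N$ and $M$ compact. Assume that $Ric^M\ge K>0$, and that the $m$-Ricci curvature of $N$ satisfies $Ric^N_m\le\kappa$ with $\kappa>0$. Then $$\max_{x\in M}D^{1/m}(x)\ge\frac K\kappa,$$ provided that $f$ is non-degenerate.
   Context: $D(x)=(f^*\omega_h)^m(x)/\omega_g^m(x)$ with $\omega_g,\omega_h$ the Kähler forms of $M,N$. $Ric^M\ge K$ means $Ric^M(X,\overline X)\ge K|X|^2$ for $X\in T'M$ (holomorphic tangent bundle), with $|X|^2=g(X,\overline X)$ and $Ric(X,\overline X)=\sum_\alpha R(E_\alpha,\overline E_\alpha,X,\overline X)$ for a unitary basis $\{E_\alpha\}$. $Ric^N_m\le\kappa$ means that for every $y\in N$, every $m$-dimensional complex subspace $\Sigma\subset T'_yN$ with unitary basis $\{E_i\}$, and every $v\in\Sigma$, $\sum_{i=1}^mR^N(E_i,\overline E_i,v,\bar v)\le\kappa|v|^2$. Curvature sign convention: $R_{\alpha\bar\beta\gamma\bar\delta}=-\partial^2g_{\alpha\bar\beta}/\partial z^\gamma\partial\bar z^\delta$ at the center of holomorphic normal coordinates. $f$ is degenerate if its image has dimension less than $m$, and non-degenerate otherwise (i.e. $\partial f$ has rank $m$ at some point). *)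

(* Defs.v *)
From HB Require Import structures.
From mathcomp Require Import all_boot all_order all_algebra all_fingroup.
From mathcomp Require Import all_classical all_reals all_analysis.
From mathcomp Require Import complex.

Set Implicit Arguments.
Unset Strict Implicit.
Unset Printing Implicit Defensive.

Import Order.TTheory GRing.Theory Num.Theory.
Import numFieldNormedType.Exports.

Local Open Scope classical_set_scope.
Local Open Scope ring_scope.

(* R[i] seen through the head of numClosedFieldType, so that the topology and
   the norm which numFieldNormedType puts on every numClosedFieldType are found
   by unification (R[i] itself carries no canonical topology). *)
Definition Cx (R : realType) : numClosedFieldType := (R[i])%C.

Section Calculus.
Variables (R : realType) (n : nat).
Local Notation C := (Cx R).
Local Notation V := ('rV[Cx R]_n).

Definition ofR (x : R) : C := real_complex R x.
Definition reC (z : C) : R := complex.Re z.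
Definition imC (z : C) : R := complex.Im z.

(* The restriction of F to the real line z + R v. *)
Definition rline (F : V -> R) (z v : V) : R -> R := fun t => F (z + ofR t *: v).

(* Real directional derivative: only real increments of the parameter. *)
Definition rderiv (v : V) (F : V -> R) : V -> R := fun z => derive1 (rline F z v) 0.

(* C^infinity in the real sense: all iterated directional derivatives exist and
   are continuous at the points of A (used with A open). *)
Definition smooth_on (A : set V) (F : V -> R) : Prop :=
  forall (s : seq V) (z : V), A z ->
    {for z, continuous (foldr rderiv F s)} /\
    forall v : V, derivable (rline (foldr rderiv F s) z v) 0 1.

Definition csmooth_on (A : set V) (F : V -> C) : Prop :=
  smooth_on A (reC \o F) /\ smooth_on A (imC \o F).

Definition cderiv (v : V) (F : V -> C) : V -> C :=
  fun z => ofR (rderiv v (reC \o F) z) + 'i * ofR (rderiv v (imC \o F) z).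

Definition vec_e (k : 'I_n) : V := delta_mx ord0 k.

(* With z^k = x^k + i y^k:
   d/dz^k = (d/dx^k - i d/dy^k) / 2, d/dzbar^k = (d/dx^k + i d/dy^k) / 2. *)
Definition ddz (k : 'I_n) (F : V -> C) : V -> C :=
  fun z => 2^-1 * (cderiv (vec_e k) F z - 'i * cderiv ('i *: vec_e k) F z).
Definition ddzbar (k : 'I_n) (F : V -> C) : V -> C :=
  fun z => 2^-1 * (cderiv (vec_e k) F z + 'i * cderiv ('i *: vec_e k) F z).

(* (d omega)(u, v, w) for a 2-form on an open set of R^(2n) = C^n, evaluated on
   constant vector fields (whose Lie brackets vanish). *)
Definition ext_deriv2 (omega : V -> V -> V -> R) (z u v w : V) : R :=
  rderiv u (fun y => omega y v w) z
  - rderiv v (fun y => omega y u w) z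
  + rderiv w (fun y => omega y u v) z.

(* (w /\ ... /\ w) (m factors) evaluated on 2m vectors indexed by 'I_m * bool,
   taken in the order (0,false), (0,true), (1,false), (1,true), ... *)
Definition wedge_pow (m : nat) (w : V -> V -> R) (u : 'I_m * bool -> V) : R :=
  2 ^- m * \sum_(s : {perm ('I_m * bool)})
    (-1) ^+ s * \prod_(k < m) w (u (s (k, false))) (u (s (k, true))).

(* The real frame d/dx^1, d/dy^1, ..., d/dx^n, d/dy^n. *)
Definition real_frame (p : 'I_n * bool) : V :=
  if p.2 then 'i *: vec_e p.1 else vec_e p.1.

(* g(u, vbar) for the Hermitian matrix G = (g_{a bbar}). *)
Definition herm (G : 'M[C]_n) (u v : V) : C :=
  \sum_a \sum_b G a b * u ord0 a * (v ord0 b)^*.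

(* omega = i g_{a bbar} dz^a /\ dzbar^b on real tangent vectors u, v, which are
   identified with their (1,0)-parts:
   omega(u, v) = i (g(u, vbar) - g(v, ubar)) = - 2 Im g(u, vbar). *)
Definition kform (G : 'M[C]_n) (u v : V) : R := - (2 * imC (herm G u v)).

(* R_{a bbar c dbar} = - d_c d_dbar g_{a bbar}
                       + g^{q pbar} d_c g_{a qbar} d_dbar g_{p bbar};
   the second term vanishes at the center of holomorphic normal coordinates. *)
Definition curv_coef (G : V -> 'M[C]_n) (z : V) (a b c d : 'I_n) : C :=
  - ddz c (ddzbar d (fun y => G y a b)) z
  + \sum_p \sum_q ddz c (fun y => G y a q) z * invmx (G z) q p
                  * ddzbar d (fun y => G y p b) z.

(* R(X, Ybar, Z, Wbar) *)
Definition curv (G : V -> 'M[C]_n) (z : V) (X Y Z W : V) : C :=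
  \sum_a \sum_b \sum_c \sum_d curv_coef G z a b c d
    * X ord0 a * (Y ord0 b)^* * Z ord0 c * (W ord0 d)^*.

Definition unitary_frame (k : nat) (G : 'M[C]_n) (E : k.-tuple V) : Prop :=
  forall i j : 'I_k, herm G (tnth E i) (tnth E j) = (i == j)%:R.

Definition ricci_trace (k : nat) (G : V -> 'M[C]_n) (z : V) (E : k.-tuple V)
    (v : V) : C :=
  \sum_(i < k) curv G z (tnth E i) (tnth E i) v v.

End Calculus.

(* A complex manifold of complex dimension n with a chosen holomorphic atlas.
   Connectedness is not required. *)
Record complex_manifold (R : realType) (n : nat) := ComplexManifold {
  carrier :> topologicalType;
  carrier_hausdorff : hausdorff_space carrier;
  carrier_second_countable : @second_countable carrier;
  chart_index : Type;
  chart_dom : chart_index -> set carrier;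
  chart : chart_index -> carrier -> 'rV[Cx R]_n;
  param : chart_index -> 'rV[Cx R]_n -> carrier;
  chart_at : carrier -> chart_index;
  dom_chart_at : forall x, chart_dom (chart_at x) x;
  dom_open : forall i, open (chart_dom i);
  image_open : forall i, open (chart i @` chart_dom i);
  coordK : forall i x, chart_dom i x -> param i (chart i x) = x;
  coord_continuous : forall i x, chart_dom i x -> {for x, continuous (chart i)};
  param_continuous : forall i z, (chart i @` chart_dom i) z ->
    {for z, continuous (param i)};
  transition_holomorphic : forall i j x, chart_dom i x -> chart_dom j x ->
    differentiable (chart j \o param i) (chart i x)
}.

Definition chart_image (R : realType) (n : nat) (M : complex_manifold R n)
    (i : chart_index M) : set 'rV[Cx R]_n :=
  chart i @` chart_dom i.

(* metric_mx i z is the matrix (g_{a bbar}) in the chart i at the coordinates z.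
   A tangent vector in T'M is a row vector of components in a chart, on which a
   change of chart acts on the right by the holomorphic Jacobian 'J. *)
Record kahler_manifold (R : realType) (n : nat) := KahlerManifold {
  kahler_base :> complex_manifold R n;
  metric_mx : chart_index kahler_base -> 'rV[Cx R]_n -> 'M[Cx R]_n;
  metric_smooth : forall i a b,
    csmooth_on (@chart_image _ _ kahler_base i) (fun z => metric_mx i z a b);
  metric_hermitian : forall i z, @chart_image _ _ kahler_base i z -> forall a b,
    metric_mx i z b a = (metric_mx i z a b)^*;
  metric_positive : forall i z, @chart_image _ _ kahler_base i z -> forall u,
    u != 0 -> 0 < herm (metric_mx i z) u u;
  metric_change : forall i j (x : kahler_base), chart_dom i x -> chart_dom j x ->
    let J := jacobian (chart j \o param i) (chart i x) in
    forall u v, herm (metric_mx i (chart i x)) u v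
                = herm (metric_mx j (chart j x)) (u *m J) (v *m J);
  kahler_form_closed : forall i z, @chart_image _ _ kahler_base i z -> forall u v w,
    ext_deriv2 (fun y => kform (metric_mx i y)) z u v w = 0
}.

Definition holomorphic_map (R : realType) (m n : nat)
    (M : complex_manifold R m) (N : complex_manifold R n) (f : M -> N) : Prop :=
  continuous f /\
  forall (i : chart_index M) (j : chart_index N) (x : M),
    chart_dom i x -> chart_dom j (f x) ->
    differentiable (chart j \o f \o param i) (chart i x).

(* df at x, in the distinguished charts at x and f x. *)
Definition dmap (R : realType) (m n : nat)
    (M : complex_manifold R m) (N : complex_manifold R n) (f : M -> N) (x : M) :
    'M[Cx R]_(m, n) :=
  jacobian (chart (chart_at (f x)) \o f \o param (chart_at x))
           (chart (chart_at x) x).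

Definition nondegenerate_map (R : realType) (m n : nat)
    (M : complex_manifold R m) (N : complex_manifold R n) (f : M -> N) : Prop :=
  exists x : M, \rank (dmap f x) = m.

Definition metric_at (R : realType) (n : nat) (M : kahler_manifold R n) (x : M) :
    'M[Cx R]_n :=
  metric_mx (chart_at x) (chart (chart_at x) x).

Definition pullback_kform (R : realType) (m n : nat)
    (M : kahler_manifold R m) (N : kahler_manifold R n) (f : M -> N) (x : M)
    (u v : 'rV[Cx R]_m) : R :=
  kform (metric_at (f x)) (u *m dmap f x) (v *m dmap f x).

(* D(x) = (f^* omega_h)^m / omega_g^m, as a quotient of forms of top degree. *)
Definition vol_ratio (R : realType) (m n : nat)
    (M : kahler_manifold R m) (N : kahler_manifold R n) (f : M -> N) (x : M) : R :=
  wedge_pow (pullback_kform f x) (@real_frame R m)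
  / wedge_pow (kform (metric_at x)) (@real_frame R m).

Definition ricci_ge (R : realType) (n : nat) (M : kahler_manifold R n) (K : R) :
    Prop :=
  forall (i : chart_index M) (z : 'rV[Cx R]_n), chart_image i z ->
  forall E : n.-tuple 'rV[Cx R]_n,
    basis_of fullv E -> unitary_frame (metric_mx i z) E ->
  forall X : 'rV[Cx R]_n,
    ofR K * herm (metric_mx i z) X X <= ricci_trace (metric_mx i) z E X.

Definition mricci_le (R : realType) (n : nat) (N : kahler_manifold R n) (m : nat)
    (kappa : R) : Prop :=
  forall (i : chart_index N) (z : 'rV[Cx R]_n), chart_image i z ->
  forall S : {vspace 'rV[Cx R]_n}, \dim S = m ->
  forall E : m.-tuple 'rV[Cx R]_n,
    basis_of S E -> unitary_frame (metric_mx i z) E ->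
  forall v : 'rV[Cx R]_n, v \in S ->
    ricci_trace (metric_mx i) z E v <= ofR kappa * herm (metric_mx i z) v v.

(* Main.v *)
From HB Require Import structures.
Require Import Defs.
From mathcomp Require Import all_boot all_order all_algebra all_fingroup.
From mathcomp Require Import all_classical all_reals all_analysis.
From mathcomp Require Import complex spectral ring lra.

Set Implicit Arguments.
Unset Strict Implicit.
Unset Printing Implicit Defensive.

Import Order.TTheory GRing.Theory Num.Theory.
Import numFieldNormedType.Exports.

Local Open Scope classical_set_scope.
Local Open Scope ring_scope.

(** At a maximum point x of D the form f^*h is positive definite.  Along a complex
line z + t v through x the log determinants of f^*h and of g have the same
first-order terms, and maximality compares the coefficients of |t|^2.  For g
this coefficient is minus Ric(v, v); for f^*h it is minus the trace of R^N over
the image of df in the direction df v, plus the squared norm of the second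
fundamental form of f.  The curvature hypotheses then give K g <= kappa f^*h at
x, and taking determinants D(x) >= (K / kappa)^m.  The coefficient of |t|^2 is
read off by adding the second-order expansions along the real lines t v and
t (i v), in which the terms in t^2 and tbar^2 cancel. *)

(** * Complex numbers *)

(** Holomorphy is given only as complex differentiability at each point, while the comparison at x
    expands df itself to second order along a line and so involves three derivatives of f. This
    regularity is obtained without circles or power series: Goursat's lemma on rectangles, in the
    coordinate log(w - c), bounds F' by the supremum of |F|; applied to F(z + h) - F(z), that bound
    controls the second-order remainder; such remainders survive uniform limits, and derivatives are
    uniform limits of difference quotients. No normal coordinates are chosen. First derivatives of h
    enter the second-order coefficient both through the curvature and through the Jacobian, and
    [trace_identity] completes the square: what exceeds the curvature is the trace of a positive
    semidefinite form. No logarithm is taken either. Constant matrices normalize both determinants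
    to 1 at x, after which the coefficients of the log determinant are polynomials in those of the
    determinant. *)

Section ComplexNumbers.
Variable R : realType.
Local Notation C := (Cx R).
Implicit Types (z w : C) (x y : R).

HB.instance Definition _ := GRing.RMorphism.copy (@ofR R) (real_complex R : R -> R[i]).

(** The norm of [Cx R] takes its values in [Cx R]; estimates are carried out in [R], where the order
    is total and minima of radii exist. *)
Definition cabs z : R := reC `|z|.

Lemma complex_ext z w : reC z = reC w -> imC z = imC w -> z = w.
Proof. by case: z w => a b [c d]; rewrite /reC /imC /= => -> ->. Qed.

Lemma reCD z w : reC (z + w) = reC z + reC w. Proof. by case: z w => a b []. Qed.
Lemma imCD z w : imC (z + w) = imC z + imC w. Proof. by case: z w => a b []. Qed.
Lemma reCN z : reC (- z) = - reC z. Proof. by case: z. Qed.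
Lemma imCN z : imC (- z) = - imC z. Proof. by case: z. Qed.
Lemma reCB z w : reC (z - w) = reC z - reC w. Proof. by rewrite reCD reCN. Qed.
Lemma imCB z w : imC (z - w) = imC z - imC w. Proof. by rewrite imCD imCN. Qed.
Lemma reCM z w : reC (z * w) = reC z * reC w - imC z * imC w.
Proof. by case: z w => a b []. Qed.
Lemma imCM z w : imC (z * w) = reC z * imC w + imC z * reC w.
Proof. by case: z w => a b []. Qed.
Lemma reC_ofR x : reC (ofR x) = x. Proof. by []. Qed.
Lemma imC_ofR x : imC (ofR x) = 0. Proof. by []. Qed.
Lemma reC_i : reC ('i : C) = 0. Proof. by []. Qed.
Lemma imC_i : imC ('i : C) = 1. Proof. by []. Qed.
Lemma reCJ z : reC z^* = reC z. Proof. by case: z. Qed.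
Lemma imCJ z : imC z^* = - imC z. Proof. by case: z. Qed.

Lemma CxE z : z = ofR (reC z) + 'i * ofR (imC z).
Proof.
by apply: complex_ext; rewrite ?(reCD, imCD, reCM, imCM) /= ?(reC_ofR, imC_ofR, reC_i, imC_i); lra.
Qed.

Lemma conj_ofR x : (ofR x)^* = ofR x.
Proof. by apply: complex_ext; rewrite ?reCJ ?imCJ ?imC_ofR ?oppr0. Qed.

Lemma ofR_cabs z : ofR (cabs z) = `|z|.
Proof. by rewrite /cabs; case: z => a b; rewrite normc_def. Qed.

Lemma cabsE z : cabs z = Num.sqrt (reC z ^+ 2 + imC z ^+ 2).
Proof. by rewrite /cabs /reC normc_def. Qed.

Lemma ler_ofR x y : (ofR x <= ofR y) = (x <= y). Proof. exact: lecR. Qed.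
Lemma ltr_ofR x y : (ofR x < ofR y) = (x < y). Proof. exact: ltcR. Qed.
Lemma reC_le z w : z <= w -> reC z <= reC w. Proof. by rewrite lecE => /andP[]. Qed.
Lemma ofR_inj : injective (@ofR R). Proof. exact: complexI. Qed.

Lemma cabs_ge0 z : 0 <= cabs z. Proof. by rewrite cabsE sqrtr_ge0. Qed.
Lemma cabsM z w : cabs (z * w) = cabs z * cabs w.
Proof. by apply: ofR_inj; rewrite rmorphM /= !ofR_cabs normrM. Qed.
Lemma cabsD z w : cabs (z + w) <= cabs z + cabs w.
Proof. by rewrite -ler_ofR rmorphD /= !ofR_cabs ler_normD. Qed.
Lemma cabsN z : cabs (- z) = cabs z.
Proof. by rewrite /cabs normrN. Qed.
Lemma cabsC z w : cabs (z - w) = cabs (w - z).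
Proof. by rewrite -cabsN opprB. Qed.
Lemma cabsB z w : cabs (z - w) <= cabs z + cabs w.
Proof. by rewrite -(cabsN w) cabsD. Qed.
Lemma cabs_ofR x : cabs (ofR x) = `|x|.
Proof. by rewrite cabsE reC_ofR imC_ofR expr0n addr0 sqrtr_sqr. Qed.
Lemma cabs0 : cabs 0 = 0. Proof. by rewrite /cabs normr0. Qed.
Lemma cabs1 : cabs 1 = 1. Proof. by rewrite /cabs normr1. Qed.
Lemma cabs_i : cabs 'i = 1. Proof. by rewrite /cabs normCi. Qed.
Lemma cabsJ z : cabs z^* = cabs z. Proof. by rewrite /cabs norm_conjC. Qed.
Lemma cabs_eq0 z : (cabs z == 0) = (z == 0).
Proof. by rewrite -(inj_eq ofR_inj) ofR_cabs normr_eq0. Qed.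
Lemma cabs_gt0 z : (0 < cabs z) = (z != 0).
Proof. by rewrite -ltr_ofR ofR_cabs normr_gt0. Qed.
Lemma cabsV z : cabs z^-1 = (cabs z)^-1.
Proof. by apply: ofR_inj; rewrite fmorphV /= !ofR_cabs normfV. Qed.
Lemma cabsX z k : cabs (z ^+ k) = cabs z ^+ k.
Proof. by apply: ofR_inj; rewrite rmorphXn /= !ofR_cabs normrX. Qed.
Lemma abs_reC z : `|reC z| <= cabs z.
Proof. by rewrite cabsE -sqrtr_sqr ler_wsqrtr// lerDl sqr_ge0. Qed.
Lemma abs_imC z : `|imC z| <= cabs z.
Proof. by rewrite cabsE -sqrtr_sqr ler_wsqrtr// lerDr sqr_ge0. Qed.
Lemma cabs_le z : cabs z <= `|reC z| + `|imC z|.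
Proof.
by rewrite {1}(CxE z) (le_trans (cabsD _ _))// cabsM cabs_i mul1r !cabs_ofR.
Qed.
Lemma cabs_sum (I : Type) (r : seq I) (P : pred I) (F : I -> C) :
  cabs (\sum_(i <- r | P i) F i) <= \sum_(i <- r | P i) cabs (F i).
Proof.
apply: (big_ind2 (fun (x : C) (y : R) => cabs x <= y)) => // [|x a y b xa yb].
  by rewrite cabs0.
exact: le_trans (cabsD _ _) (lerD xa yb).
Qed.

Lemma reCZ x z : reC (ofR x * z) = x * reC z.
Proof. by rewrite reCM reC_ofR imC_ofR; lra. Qed.
Lemma imCZ x z : imC (ofR x * z) = x * imC z.
Proof. by rewrite imCM reC_ofR imC_ofR; lra. Qed.

End ComplexNumbers.

(** * Top exterior powers of a Kähler form *)

Section LeibnizReindex.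
Variables (T : finType) (N : nat) (e : T -> 'I_N) (d : 'I_N -> T).
Hypotheses (eK : cancel e d) (dK : cancel d e).

Lemma perm_conj_inj (s : {perm T}) : injective (fun i => e (s (d i))).
Proof. by move=> i j /(can_inj eK) /perm_inj /(can_inj dK). Qed.

Definition perm_conj (s : {perm T}) : {perm 'I_N} := perm (@perm_conj_inj s).

Lemma perm_conjE s i : perm_conj s i = e (s (d i)).
Proof. by rewrite permE. Qed.

(** Conjugation by a bijection is a morphism sending transpositions to transpositions, so a
    factorization of [s] is carried to one of the same length. *)
Lemma odd_perm_conj (s : {perm T}) : odd_perm (perm_conj s) = odd_perm s.
Proof.
have conj1 : perm_conj 1%g = 1%g.
  by apply/permP => i; rewrite perm_conjE !perm1 dK.
have conjM (u v : {perm T}) : perm_conj (u * v)%g = (perm_conj u * perm_conj v)%g.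
  by apply/permP => i; rewrite perm_conjE !permM !perm_conjE eK.
have conjT x y : perm_conj (tperm x y) = tperm (e x) (e y).
  apply/permP => i; rewrite perm_conjE; case: tpermP => [<-|<-|h1 h2].
  - by rewrite dK tpermL.
  - by rewrite dK tpermR.
  rewrite tpermD ?dK //; apply/eqP => h; first by apply: h1; rewrite -h eK.
  by apply: h2; rewrite -h eK.
have [ts -> tsP] := prod_tpermP s.
elim: ts tsP => [|[x y] ts IH] /=; first by rewrite !big_nil conj1 !odd_perm1.
case/andP => xy /IH {}IH; rewrite !big_cons conjM conjT !odd_mul_tperm IH /=.
by rewrite (can_eq eK).
Qed.

(** [wedge_pow] sums over permutations of ['I_m * bool]; this turns such sums into determinants over
    ordinals. *)
Lemma det_leibniz_reindex (K : comNzRingType) (L : T -> T -> K) :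
  \sum_(s : {perm T}) (-1) ^+ s * \prod_p L (s p) p
  = \det (\matrix_(i, j) L (d i) (d j)).
Proof.
rewrite -det_tr /determinant [RHS](reindex perm_conj) /=; last first.
  have inj' : injective (fun t : {perm 'I_N} => fun p => d (t (e p))).
    by move=> t u tu; apply/permP => i; have := congr1 (@^~ (d i)) tu; rewrite dK => /(can_inj dK).
  have hinj (t : {perm 'I_N}) : injective (fun p => d (t (e p))).
    by move=> p q /(can_inj dK) /perm_inj /(can_inj eK).
  exists (fun t => perm (hinj t)) => s _.
    by apply/permP => p; rewrite permE perm_conjE !eK.
  by apply/permP => p; rewrite perm_conjE permE !dK.
apply: eq_bigr => s _; rewrite odd_perm_conj; congr (_ * _).
rewrite (reindex d) /=; last by exists e => x _.
by apply: eq_bigr => i _; rewrite !mxE perm_conjE eK.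
Qed.

End LeibnizReindex.

Lemma big_pair_bool (S : Type) (idx : S) (op : Monoid.com_law idx) (I : finType)
    (f : I * bool -> S) :
  \big[op/idx]_p f p = \big[op/idx]_i op (f (i, false)) (f (i, true)).
Proof.
rewrite (eq_bigr (fun p => f (p.1, p.2))); last by case.
rewrite -(pair_bigA _ (fun i b => f (i, b))) /=.
by apply: eq_bigr => i _; rewrite big_bool Monoid.mulmC.
Qed.

(** * The Pfaffian of a pull-back of the standard symplectic form *)

Section Pairing.
Variables (K : numFieldType) (m : nat).
Local Notation T := ('I_m * bool)%type.

(** Block order, all [false] indices before all [true] ones, so that block matrices apply. The sign
    of a permutation does not depend on the order chosen. *)
Definition ord_of_pair (p : T) : 'I_(m + m) :=
  if p.2 then rshift m p.1 else lshift m p.1.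
Definition pair_of_ord (i : 'I_(m + m)) : T :=
  match fintype.split i with inl k => (k, false) | inr k => (k, true) end.

Lemma pair_of_lshift k : pair_of_ord (lshift m k) = (k, false).
Proof. by rewrite /pair_of_ord (_ : lshift m k = unsplit (inl k)) ?unsplitK. Qed.
Lemma pair_of_rshift k : pair_of_ord (rshift m k) = (k, true).
Proof. by rewrite /pair_of_ord (_ : rshift m k = unsplit (inr k)) ?unsplitK. Qed.

Lemma ord_of_pairK : cancel ord_of_pair pair_of_ord.
Proof. by case=> k []; rewrite /ord_of_pair /= ?pair_of_lshift ?pair_of_rshift. Qed.
Lemma pair_of_ordK : cancel pair_of_ord ord_of_pair.
Proof. by move=> i; rewrite /pair_of_ord -{2}(splitK i); case: fintype.split. Qed.

Definition flip (p : T) : T := (p.1, ~~ p.2).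
(** When the m-th wedge power is expanded, [r] selects a term of each factor; the two slots of the
    k-th factor then carry the coordinate [r k] and its symplectic partner. *)
Definition pairing_ext (r : {ffun 'I_m -> T}) (p : T) : T :=
  if p.2 then flip (r p.1) else r p.1.

Definition pairing_mx (r : {ffun 'I_m -> T}) : 'M[K]_(m + m) :=
  \matrix_(i, j) (pair_of_ord i == pairing_ext r (pair_of_ord j))%:R.

Definition select_mx (r : {ffun 'I_m -> T}) : 'M[K]_m :=
  \matrix_(i, j) (i == (r j).1)%:R.

(** [pairing_mx r] is two diagonal copies of [select_mx r] followed by the exchange of the columns
    (k, false) and (k, true) for each k with [(r k).2]. The signs of these exchanges cancel the
    prefactor and leave a square. *)
Lemma det_pairing_mx (r : {ffun 'I_m -> T}) :
  (\prod_k (-1) ^+ (r k).2) * \det (pairing_mx r) = \det (select_mx r) ^+ 2.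
Proof.
set b : 'rV[K]_m := \row_k ((r k).2)%:R.
set P := select_mx r.
have eqQ : pairing_mx r = block_mx P 0 0 P *m
    block_mx (1%:M - diag_mx b) (diag_mx b) (diag_mx b) (1%:M - diag_mx b).
  rewrite mulmx_block !mul0mx !addr0 !add0r.
  apply/matrixP => i j; rewrite -(splitK i) -(splitK j).
  case: (fintype.split i) (fintype.split j) => k [] l /=;
  rewrite ?(block_mxEul, block_mxEur, block_mxEdl, block_mxEdr) mxE
    ?(pair_of_lshift, pair_of_rshift) /pairing_ext /= ?mulmxBr ?mulmx1 mul_mx_diag ?mxE;
  rewrite -?(surjective_pairing) /flip -pair_eqE /pair_eq /=; rewrite ?mxE;
  by case: (r l) => c [] /=; case: eqP => _; rewrite /= ?mulr0 ?mulr1 ?subr0 ?subrr.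
(* Conjugating [Y] by the unipotent [X] makes it block upper triangular, with diagonal blocks 1 and
   1 - 2b. *)
pose X : 'M[K]_(m + m) := block_mx 1%:M 0 1%:M 1%:M.
have detX : \det X = 1 by rewrite det_lblock !det1 mulr1.
pose Y : 'M[K]_(m + m) := block_mx (1%:M - diag_mx b) (diag_mx b) (diag_mx b) (1%:M - diag_mx b).
have YX : Y *m X = X *m block_mx 1%:M (diag_mx b) 0 (1%:M - diag_mx (b *+ 2)).
  rewrite !mulmx_block !(mulmx1, mul1mx, mulmx0, mul0mx, addr0, add0r).
  by congr block_mx; apply/matrixP => i j; rewrite !(mxE, mulrnDl) ?mulr2n; ring.
have detY : \det Y = \prod_k (-1) ^+ (r k).2.
  have : \det (Y *m X) = \det Y by rewrite det_mulmx detX mulr1.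
  rewrite YX det_mulmx detX mul1r det_ublock det1 mul1r => <-.
  rewrite (_ : 1%:M - _ = diag_mx (const_mx 1 - b *+ 2)); last first.
    by rewrite -[1%:M]diag_const_mx -raddfB.
  rewrite det_diag; apply: eq_bigr => k _; rewrite mulr2n !mxE.
  by case: (r k).2 => /=; rewrite ?expr1 ?expr0; ring.
rewrite eqQ det_mulmx det_ublock -/Y detY mulrCA -expr2 -[RHS]mulr1; congr (_ * _).
rewrite -big_split /= big1 // => k _.
by rewrite -exprD addnn -muln2 mulnC exprM sqrrN !expr1n.
Qed.

(** Every term is the square of a real determinant, and the choice [r k = (k, false)] contributes
    1. *)
Lemma pairing_sum_gt0 :
  0 < \sum_(r : {ffun 'I_m -> T}) (\prod_k (-1) ^+ (r k).2) * \det (pairing_mx r).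
Proof.
have real_det r : \det (select_mx r) \is Num.real.
  apply: rpred_sum => s _; apply: rpredM; first by rewrite rpredX ?rpredN ?rpred1.
  by apply: rpred_prod => k _; rewrite mxE; exact: realn.
rewrite (bigD1 [ffun k => (k, false)]) //= ltr_pwDl //; last first.
  by apply: sumr_ge0 => r _; rewrite det_pairing_mx real_exprn_even_ge0.
rewrite det_pairing_mx (_ : select_mx _ = 1%:M) ?det1 ?expr1n //.
by apply/matrixP => i j; rewrite !mxE ffunE.
Qed.

(* The form p, q |-> i (h(p, q) - h(q, p)) is the pull-back by L of the standard
   symplectic form, so that its Pfaffian is a multiple of det L. *)
Lemma pfaffian_pullback (a : K) (L : T -> T -> K) (W : T -> T -> K) :
  (forall p q, W p q = a * \sum_(r : T) (-1) ^+ r.2 * L p r * L q (flip r)) ->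
  \sum_(s : {perm T}) (-1) ^+ s * \prod_(k < m) W (s (k, false)) (s (k, true))
  = a ^+ m * (\sum_(r : {ffun 'I_m -> T}) (\prod_k (-1) ^+ (r k).2) * \det (pairing_mx r))
    * \det (\matrix_(i, j) L (pair_of_ord i) (pair_of_ord j)).
Proof.
move=> WE; set A := \matrix_(i, j) _.
transitivity (\sum_(s : {perm T}) \sum_(r : {ffun 'I_m -> T}) (-1) ^+ s * (a ^+ m *
   ((\prod_k (-1) ^+ (r k).2) * \prod_p L (s p) (pairing_ext r p)))).
  apply: eq_bigr => s _; rewrite -!mulr_sumr; congr (_ * _).
  under eq_bigr do rewrite WE.
  rewrite big_split /= prodr_const card_ord; congr (_ * _).
  rewrite (bigA_distr_bigA (fun k (r : T) => (-1) ^+ r.2 * L (s (k, false)) r * L (s (k, true)) (flip r))) /=.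
  apply: eq_bigr => r _; under eq_bigr do rewrite -mulrA.
  rewrite big_split /=; congr (_ * _).
  by rewrite big_pair_bool.
rewrite exchange_big /= -mulrA mulr_suml mulr_sumr; apply: eq_bigr => r _.
under eq_bigr do rewrite mulrCA [_ * (\prod__ _ * _)]mulrCA.
rewrite -!mulr_sumr; congr (_ * _); rewrite -mulrA; congr (_ * _).
(* For fixed [r] the sum over permutations is a single determinant, that of [A] times
   [pairing_mx r]. *)
rewrite (det_leibniz_reindex ord_of_pairK pair_of_ordK (fun p q => L p (pairing_ext r q))).
rewrite mulrC -det_mulmx; congr (\det _); apply/matrixP => i j; rewrite !mxE.
rewrite (bigD1 (ord_of_pair (pairing_ext r (pair_of_ord j)))) //= !mxE ord_of_pairK eqxx mulr1.
rewrite big1 ?addr0 // => l; rewrite !mxE -(can_eq pair_of_ordK) ord_of_pairK => /negPf ->.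
by rewrite mulr0.
Qed.

End Pairing.

Section Wedge.
Variables (R : realType) (m : nat).
Local Notation C := (Cx R).

(** The constant is left unevaluated: it does not depend on [G], so it cancels in the quotient
    defining D. *)
Lemma wedge_pow_kform : exists2 c : C, c != 0 & forall G : 'M[C]_m,
  (forall a b, G b a = (G a b)^*) ->
  ofR (wedge_pow (kform G) (@real_frame R m)) = c * \det G.
Proof.
pose k0 := \sum_(r : {ffun 'I_m -> 'I_m * bool}) (\prod_k (-1) ^+ (r k).2) * \det (pairing_mx C r).
(* [F] holds the values of dz and dzbar on the real frame; its inverse is exhibited below to see
   that its determinant is nonzero. *)
pose F : 'M[C]_(m + m) := block_mx 1%:M 1%:M ('i)%:M (- 'i)%:M.
exists (2 ^- m * ('i ^+ m * k0) * \det F) => [|G hG].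
  rewrite !mulf_neq0 ?invr_neq0 ?expf_neq0 ?neq0Ci ?pnatr_eq0 //.
    by rewrite gt_eqF // pairing_sum_gt0.
  have : F *m block_mx (2^-1)%:M (- 'i / 2)%:M (2^-1)%:M ('i / 2)%:M = 1%:M.
    rewrite mulmx_block -!scalar_mxM scalar_mx_block.
    have ii : ('i : C) * 'i = -1 by rewrite -expr2 sqrCi.
    congr block_mx; rewrite -raddfD /= -?(raddf0 (@scalar_mx C m)); congr (_%:M).
    - by field.
    - by field.
    - by field.
    by rewrite !mulNr !mulrN !mulrA ii; field.
  by move/mulmx1_unit => [+ _]; rewrite unitmxE unitfE.
have fE p a : real_frame R p ord0 a = (if p.2 then 'i else 1) * (p.1 == a)%:R.
  rewrite /real_frame /vec_e; case: p => k [] /=; rewrite !mxE eqxx eq_sym ?mul1r //.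
have frameE p q : herm G (real_frame R p) (real_frame R q)
   = (if p.2 then 'i else 1) * G p.1 q.1 * (if q.2 then - 'i else 1).
  rewrite /herm (bigD1 p.1) //= (bigD1 q.1) //= !big1 ?addr0.
  - rewrite !fE !eqxx !mulr1 [G _ _ * _]mulrC; congr (_ * _).
    by case: q.2; rewrite ?conjCi ?rmorph1.
  - move=> a ap; apply: big1 => b _.
    by rewrite fE eq_sym (negPf ap) !(mulr0, mul0r).
  move=> b bq; by rewrite !fE [_ == b]eq_sym (negPf bq) mulr0 rmorph0 mulr0.
(* Coordinates in which the Kähler form is standard: [G] is absorbed into the dz half and the dzbar
   half is left alone, whence the factor [\det G]. *)
pose L (p r : 'I_m * bool) : C := if r.2 then (if p.2 then - 'i else 1) * (p.1 == r.1)%:R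
  else (if p.2 then 'i else 1) * G p.1 r.1.
have WE p q : ofR (kform G (real_frame R p) (real_frame R q)) =
   'i * \sum_(r : 'I_m * bool) (-1) ^+ r.2 * L p r * L q (flip r).
  have hJ u v : herm G v u = (herm G u v)^*.
    rewrite /herm rmorph_sum exchange_big /=; apply: eq_bigr => a _.
    rewrite rmorph_sum; apply: eq_bigr => b _; rewrite !rmorphM /= -hG conjCK; ring.
  have -> : ofR (kform G (real_frame R p) (real_frame R q)) =
      'i * (herm G (real_frame R p) (real_frame R q) - herm G (real_frame R q) (real_frame R p)).
    rewrite [herm G (real_frame R q) _]hJ /kform; apply: complex_ext;
    rewrite ?(reCM, imCM, reCB, imCB, reCJ, imCJ, reC_i, imC_i, reC_ofR, imC_ofR) //; lra.
  congr (_ * _).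
  rewrite big_pair_bool /=; under eq_bigr do rewrite expr1 expr0 /L /flip /=.
  rewrite big_split /= (bigD1 q.1) //= big1 ?addr0; last first.
    by move=> a /negPf; rewrite eq_sym => ->; rewrite !(mulr0, mul0r).
  rewrite [X in _ = _ + X](bigD1 p.1) //= big1 ?addr0; last first.
    by move=> a /negPf; rewrite eq_sym => ->; rewrite !(mulr0, mul0r).
  rewrite !frameE !eqxx /=; ring.
rewrite /wedge_pow rmorphM /= rmorph_sum /=.
under eq_bigr do rewrite rmorphM rmorph_prod /= rmorphXn rmorphN1.
rewrite (pfaffian_pullback WE) fmorphV rmorphXn /= rmorph_nat -!mulrA; congr (_ * (_ * (_ * _))).
have -> : \matrix_(i, j) L (pair_of_ord i) (pair_of_ord j) = F *m block_mx G 0 0 1%:M.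
  rewrite mulmx_block !mulmx0 !mulmx1 !addr0 !add0r !mul_scalar_mx !scale1r.
  apply/matrixP => i j; rewrite -(splitK i) -(splitK j).
  case: (fintype.split i) (fintype.split j) => k [] l /=;
  rewrite ?(block_mxEul, block_mxEur, block_mxEdl, block_mxEdr) mxE
    ?(pair_of_lshift, pair_of_rshift) /L /= ?mxE ?mul1r //.
  by rewrite mulr_natr.
by rewrite det_mulmx det_ublock det1 mulr1.
Qed.

End Wedge.

(** * Real functions of one variable *)

Section RealDerivative.
Variable R : realType.
Implicit Types (f F : R -> R).

(** A Fréchet form that allows [h = 0], so that estimates are chained without division or punctured
    neighborhoods. *)
Definition has_rder f (x l : R) := forall e, 0 < e ->
  exists2 d, 0 < d & forall h, `|h| < d -> `|f (x + h) - f x - l * h| <= e * `|h|.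

Lemma has_rderP f x l : has_rder f x l <-> is_derive x 1 f l.
Proof.
have eqfun : (fun h => h^-1 *: (f (h *: 1 + x) - f x)) = (fun h => h^-1 * (f (x + h) - f x)).
  apply/funext => h; rewrite [_ + x]addrC; congr (_ * (f (_ + _) - _)); exact: mulr1.
split => [H|[dfx <- {l}]].
  have lim : h^-1 *: (f (h *: 1 + x) - f x) @[h --> 0^'] --> l.
    rewrite eqfun; apply/cvgrPdist_le => e e0; have [d d0 Hd] := H _ e0.
    exists d => //= h /=; rewrite sub0r normrN => hd h0.
    rewrite distrC -(ler_pM2r (_ : 0 < `|h|)) ?normr_gt0 // -normrM mulrBl.
    by rewrite mulrAC mulVf // mul1r Hd.
  by split; [apply/cvg_ex; exists l|exact: (cvg_lim (@Rhausdorff R) lim)].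
move=> e e0; move: (dfx) => /cvg_ex [l lim]; rewrite /derive.
have := lim; rewrite (cvg_lim (@Rhausdorff R) lim) eqfun => /cvgrPdist_le /(_ _ e0) [d /= d0 Hd].
exists d => // h hd; have [->|h0] := eqVneq h 0.
  by rewrite addr0 !subrr mulr0 subrr !normr0 mulr0.
have := Hd h; rewrite /= sub0r normrN => /(_ hd h0).
rewrite distrC -(ler_pM2r (_ : 0 < `|h|)) ?normr_gt0 // -normrM mulrBl.
by rewrite mulrAC mulVf // mul1r.
Qed.

Lemma has_rder_uniq f x l l' : has_rder f x l -> has_rder f x l' -> l = l'.
Proof. by move=> /has_rderP [_ <-] /has_rderP [_ <-]. Qed.

Lemma has_rderB f g x a b : has_rder f x a -> has_rder g x b ->
  has_rder (fun t => f t - g t) x (a - b).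
Proof. by move=> /has_rderP fa /has_rderP gb; apply/has_rderP; exact: is_deriveB. Qed.

Lemma has_rderMn k x : has_rder (fun t => k * t) x k.
Proof.
move=> e e0; exists 1 => // h _; rewrite (_ : _ - _ = 0) ?normr0; last by ring.
by rewrite mulr_ge0 // ltW.
Qed.

Lemma rder_mvt F f a b : a <= b ->
  (forall x, a <= x <= b -> has_rder F x (f x)) ->
  exists2 c, a <= c <= b & F b - F a = f c * (b - a).
Proof.
move=> ab H.
have [x|c|c] := @MVT_segment R F f a b ab.
- by rewrite in_itv /= => /andP[ax xb]; apply/has_rderP/H; rewrite !ltW.
- apply: derivable_within_continuous => x; rewrite in_itv /= => /H /has_rderP [].
  by [].
by rewrite in_itv /= => cab E; exists c.
Qed.

Lemma eps_continuous f :
  (forall x e, 0 < e -> exists2 d, 0 < d & forall y, `|y - x| < d -> `|f y - f x| <= e) ->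
  continuous f.
Proof.
move=> H x; apply/cvgrPdist_le => e e0; have [d d0 Hd] := H x e e0.
by exists d => //= y /=; rewrite distrC [X in _ -> X <= _]distrC; exact: Hd.
Qed.

Lemma continuous_primitive f (L : R) : continuous f ->
  exists F, forall x, L < x -> has_rder F x (f x).
Proof.
move=> fc; exists (fun x => \int[lebesgue_measure]_(t in `[L, x]) f t)%R => x Lx.
have x1 : x < x + 1 by rewrite ltrDl.
have fi : lebesgue_measure.-integrable `[L, x + 1] (EFin \o f).
  by apply: continuous_compact_integrable; [exact: segment_compact|exact: continuous_subspaceT].
have [df dfE] := continuous_FTC1_closed x1 fi Lx (fc x).
apply/has_rderP; split; first exact: df.
by rewrite -derive1E dfE.
Qed.

End RealDerivative.

(** * Integrals of closed forms over rectangles *)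

Section Goursat.
Variable R : realType.
Implicit Types (p q : R -> R -> R).

Let near_diff (p : R -> R -> R) (x y a b c d e al be de : R) :=
  forall x' y', a <= x' <= b -> c <= y' <= d -> `|x' - x| <= de -> `|y' - y| <= de ->
  `|p x' y' - p x y - al * (x' - x) - be * (y' - y)| <= e * (`|x' - x| + `|y' - y|).

(** Closedness of p dx + q dy at a single point: p and q are differentiable there, relative to the
    rectangle, and [be] is both the y-derivative of p and the x-derivative of q. Nothing is asked
    about continuity of the derivatives. *)
Definition closed_at p q (a b c d x y : R) := exists al be ga, forall e, 0 < e ->
  exists2 de, 0 < de & near_diff p x y a b c d e al be de /\ near_diff q x y a b c d e be ga de.

(** The retraction of the line onto the segment extends a function continuous on the segment to one
    continuous everywhere, as [continuous_primitive] asks. *)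
Definition clamp (a b x : R) := Num.max a (Num.min b x).

Lemma clamp_in a b x : a <= b -> a <= clamp a b x <= b.
Proof. by move=> ab; rewrite /clamp le_max lexx ge_max ab ge_min lexx. Qed.

Lemma clamp_id a b x : a <= x <= b -> clamp a b x = x.
Proof. by case/andP => ax xb; rewrite /clamp (min_idPr xb) (max_idPr ax). Qed.

Lemma clamp_lip a b x y : `|clamp a b x - clamp a b y| <= `|x - y|.
Proof.
rewrite /clamp; case: (lerP b x) => h1; case: (lerP b y) => h2;
repeat (match goal with |- context [Order.max ?u ?v] => case: (lerP u v) => ? end);
rewrite ?subrr ?normr0 ?normr_ge0 //; do 2 case: ler0P => ?; lra.
Qed.

Let affine_bound (al e x y w : R) : `|w - al * x| <= `|x| -> `|x| <= `|y| ->
  `|y| < e / (1 + `|al|) -> `|w| <= e.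
Proof.
have k0 : 0 < 1 + `|al| by rewrite ltr_pwDl.
move=> h xy ye; rewrite -(subrK (al * x) w); apply: le_trans (ler_normD _ _) _; rewrite normrM.
apply: le_trans (lerD h (lexx _)) _; rewrite -{1}[`|x|]mul1r -mulrDl.
by apply: le_trans (ler_wpM2l (ltW k0) xy) _; rewrite mulrC -ler_pdivlMr // ltW.
Qed.

Lemma near_diff_continuous p (a b c d : R) : a <= b -> c <= d ->
  (forall x y, a <= x <= b -> c <= y <= d -> exists al be, forall e, 0 < e ->
    exists2 de, 0 < de & near_diff p x y a b c d e al be de) ->
  (forall y, c <= y <= d -> continuous (fun x => p (clamp a b x) y)) /\
  (forall x, a <= x <= b -> continuous (fun y => p x (clamp c d y))).
Proof.
move=> ab cd H; split => [y yr|x xr]; apply: eps_continuous => t e e0.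
  have [al [be /(_ 1 ltr01)[de de0 Hd]]] := H _ y (clamp_in t ab) yr.
  exists (Num.min de (e / (1 + `|al|))); first by rewrite lt_min de0 divr_gt0 // ltr_pwDl.
  move=> u; rewrite lt_min => /andP[ud ue]; have lip := clamp_lip a b u t.
  have := Hd (clamp a b u) y (clamp_in u ab) yr; rewrite subrr normr0 mulr0 subr0 addr0 mul1r.
  by move=> /(_ (le_trans lip (ltW ud)) (ltW de0)) h; exact: affine_bound h lip ue.
have [al [be /(_ 1 ltr01)[de de0 Hd]]] := H x _ xr (clamp_in t cd).
exists (Num.min de (e / (1 + `|be|))); first by rewrite lt_min de0 divr_gt0 // ltr_pwDl.
move=> u; rewrite lt_min => /andP[ud ue]; have lip := clamp_lip c d u t.
have := Hd x (clamp c d u) xr (clamp_in u cd); rewrite subrr normr0 mulr0 subr0 add0r mul1r.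
by move=> /(_ (ltW de0) (le_trans lip (ltW ud))) h; exact: affine_bound h lip ue.
Qed.

(** The mean value theorem for F - G - k t. *)
Lemma primitive_diff_bound (F G f g : R -> R) (u v k e : R) : u <= v ->
  (forall t, u <= t <= v -> has_rder F t (f t)) ->
  (forall t, u <= t <= v -> has_rder G t (g t)) ->
  (forall t, u <= t <= v -> `|f t - g t - k| <= e) ->
  `|(F v - F u) - (G v - G u) - k * (v - u)| <= e * (v - u).
Proof.
move=> uv FF GG fg.
have [c cuv E] := @rder_mvt R (fun t => F t - G t - k * t) (fun t => f t - g t - k) u v uv
  (fun t tuv => has_rderB (has_rderB (FF t tuv) (GG t tuv)) (has_rderMn k t)).
rewrite (_ : _ - _ = (f c - g c - k) * (v - u)); last by rewrite -E; ring.
by rewrite normrM (ger0_norm (_ : 0 <= v - u)) ?subr_ge0 // ler_wpM2r ?subr_ge0 ?fg.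
Qed.

Let itv_dist (u x v z : R) : v <= u <= v + z -> v <= x <= v + z -> `|u - x| <= z.
Proof. by move=> /andP[? ?] /andP[? ?]; case: ler0P => ?; lra. Qed.

Let itv_sub (t v z x y : R) : x <= v -> v + z <= y -> v <= t <= v + z -> x <= t <= y.
Proof. by move=> xv vy /andP[vt tv]; rewrite (le_trans xv vt) (le_trans tv vy). Qed.

Let itv_ends (v z : R) : 0 <= z -> v <= v <= v + z /\ v <= v + z <= v + z.
Proof. by move=> z0; rewrite !lexx lerDl z0. Qed.

(* The two integrals over opposite sides are combined before they are estimated,
   so that the affine part of p (of q) contributes a constant integrand. *)
Lemma goursat_rectangle p q (P Q : R -> R -> R) (a b c d : R) : a <= b -> c <= d ->
  (forall x y, a <= x <= b -> c <= y <= d -> closed_at p q a b c d x y) ->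
  (forall x y, a <= x <= b -> c <= y <= d -> has_rder (P^~ y) x (p x y)) ->
  (forall x y, a <= x <= b -> c <= y <= d -> has_rder (Q x) y (q x y)) ->
  (P b d - P a d) - (P b c - P a c) = (Q b d - Q b c) - (Q a d - Q a c).
Proof.
move=> ab cd cl HP HQ.
(* Up to sign, the integral of p dx + q dy around the boundary of a subrectangle. *)
pose Phi x1 x2 y1 y2 := (P x2 y2 - P x1 y2) - (P x2 y1 - P x1 y1)
  - ((Q x2 y2 - Q x2 y1) - (Q x1 y2 - Q x1 y1)).
apply/eqP; rewrite -subr_eq0 -/(Phi a b c d) -normr_eq0; apply/eqP.
set eta := `|Phi a b c d|; apply/eqP; rewrite eq_le normr_ge0 andbT leNgt; apply/negP => eta0.
pose w k : R := (b - a) / 2 ^+ k; pose h k : R := (d - c) / 2 ^+ k.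
have w2 k : w k.+1 = w k / 2 by rewrite /w exprSr invfM mulrA.
have h2 k : h k.+1 = h k / 2 by rewrite /h exprSr invfM mulrA.
have wge k : 0 <= w k by rewrite divr_ge0 ?subr_ge0 ?exprn_ge0.
have hge k : 0 <= h k by rewrite divr_ge0 ?subr_ge0 ?exprn_ge0.
(* [s] is the lower left corner of a rectangle of the k-th subdivision that keeps its share of the
   boundary integral. *)
pose good k (s : R * R) := [/\ a <= s.1, s.1 + w k <= b, c <= s.2, s.2 + h k <= d &
  eta / 4 ^+ k <= `|Phi s.1 (s.1 + w k) s.2 (s.2 + h k)|].
(* [Phi] is additive over the four quarters, so one of them keeps a quarter of its size. The sigma
   type lets the choice be iterated; a corner that is not [good] is returned unchanged. *)
have step k s : {s' | good k s -> [/\ good k.+1 s', s.1 <= s'.1, s'.1 + w k.+1 <= s.1 + w k,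
     s.2 <= s'.2 & s'.2 + h k.+1 <= s.2 + h k]}.
  apply: cid; case: (pselect (good k s)) => [[ax xb cy yd big]|]; last by exists s.
  have wk := wge k.+1; have hk := hge k.+1; have e1 := w2 k; have e2 := h2 k.
  set W := w k.+1 in wk e1 *; set H := h k.+1 in hk e2 *.
  have wE : w k = W + W by lra. have hE : h k = H + H by lra.
  pose X := s.1; pose Y := s.2.
  have split4 : Phi X (X + w k) Y (Y + h k) =
      Phi X (X + W) Y (Y + H) + Phi (X + W) (X + W + W) Y (Y + H) +
      Phi X (X + W) (Y + H) (Y + H + H) + Phi (X + W) (X + W + W) (Y + H) (Y + H + H).
    by rewrite wE hE !addrA /Phi; ring.
  have eE : eta / 4 ^+ k = 4 * (eta / 4 ^+ k.+1) by rewrite exprSr; field; rewrite expf_neq0.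
  case: (lerP (eta / 4 ^+ k.+1) `|Phi X (X + W) Y (Y + H)|) => [c1|c1].
    by clear split4 eE big e1 e2; exists (X, Y) => _; split; rewrite /good /= -?/W -?/H /X /Y; try split; lra.
  case: (lerP (eta / 4 ^+ k.+1) `|Phi (X + W) (X + W + W) Y (Y + H)|) => [c2|c2].
    by clear split4 eE big e1 e2; exists (X + W, Y) => _; split; rewrite /good /= -?/W -?/H /X /Y; try split; lra.
  case: (lerP (eta / 4 ^+ k.+1) `|Phi X (X + W) (Y + H) (Y + H + H)|) => [c3|c3].
    by clear split4 eE big e1 e2; exists (X, Y + H) => _; split; rewrite /good /= -?/W -?/H /X /Y; try split; lra.
  exists (X + W, Y + H) => _; split; rewrite /good /= -?/W -?/H /X /Y; try split; try (clear split4 eE big e1 e2; lra).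
  rewrite leNgt; apply/negP => c4; move: big; rewrite split4 eE leNgt => /negP; apply.
  apply: le_lt_trans (ler_normD _ _) _.
  have := ler_normD (Phi X (X + W) Y (Y + H) + Phi (X + W) (X + W + W) Y (Y + H)) (Phi X (X + W) (Y + H) (Y + H + H)).
  have := ler_normD (Phi X (X + W) Y (Y + H)) (Phi (X + W) (X + W + W) Y (Y + H)).
  rewrite -/X -/Y in c4; lra.
pose s := fix s k := if k is k'.+1 then sval (step k' (s k')) else (a, c).
have w0 : w 0%N = b - a by rewrite /w expr0 divr1.
have h0 : h 0%N = d - c by rewrite /h expr0 divr1.
have sgood k : good k (s k).
  elim: k => [|k IH] /=; last by case: (svalP (step k (s k)) IH).
  split; rewrite /= ?w0 ?h0 ?expr0 ?divr1; try lra.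
  by rewrite !(addrC _ (_ - _)) !subrK lexx.
have snest k l : [/\ (s k).1 <= (s (k + l)%N).1, (s (k + l)%N).1 + w (k + l)%N <= (s k).1 + w k,
     (s k).2 <= (s (k + l)%N).2 & (s (k + l)%N).2 + h (k + l)%N <= (s k).2 + h k].
  elim: l => [|l [i1 i2 i3 i4]]; first by rewrite addn0.
  rewrite addnS /=; have [_ j1 j2 j3 j4] := svalP (step (k + l)%N (s (k + l)%N)) (sgood _).
  by split; [exact: le_trans i1 j1|exact: le_trans j2 i2|exact: le_trans i3 j3|exact: le_trans j4 i4].
have cross k l : [/\ (s k).1 <= (s l).1 + w l & (s k).2 <= (s l).2 + h l].
  case: (leqP k l) => kl.
    have [i1 _ i3 _] := snest k (l - k)%N; rewrite subnKC // in i1 i3.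
    by split; rewrite ler_wpDr.
  have [_ i2 _ i4] := snest l (k - l)%N; rewrite subnKC ?(ltnW kl) // in i2 i4.
  by split; [apply: le_trans i2|apply: le_trans i4]; rewrite lerDl.
pose A := [set (s k).1 | k in [set: nat]]; pose B := [set (s k).2 | k in [set: nat]].
have supA : has_sup A by split; [exists a; exists 0%N|exists ((s 0%N).1 + w 0%N) => _ [k _ <-]; case: (cross k 0%N)].
have supB : has_sup B by split; [exists c; exists 0%N|exists ((s 0%N).2 + h 0%N) => _ [k _ <-]; case: (cross k 0%N)].
(* The common point of the nested rectangles, where closedness is applied. *)
pose x := sup A; pose y := sup B.
have xk k : (s k).1 <= x <= (s k).1 + w k.
  apply/andP; split; first by apply: ub_le_sup; [case: supA|exists k].
  by apply: ge_sup; [case: supA|move=> _ [l _ <-]; case: (cross l k)].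
have yk k : (s k).2 <= y <= (s k).2 + h k.
  apply/andP; split; first by apply: ub_le_sup; [case: supB|exists k].
  by apply: ge_sup; [case: supB|move=> _ [l _ <-]; case: (cross l k)].
have xab : a <= x <= b by have := xk 0%N; rewrite /= w0; lra.
have ycd : c <= y <= d by have := yk 0%N; rewrite /= h0; lra.
have [al [be [ga Hcl]]] := cl x y xab ycd.
(* The summand 1 keeps [S] positive for a degenerate rectangle. *)
pose S := (b - a) + (d - c) + 1.
have S0 : 0 < S by rewrite /S; lra.
(* The final bound is e * 4 * T^2 with T = S / 2^k. This [e] makes it half of eta / 4^k, which
   contradicts [good]. *)
have e0 : 0 < eta / (8 * S ^+ 2) by rewrite divr_gt0 // mulr_gt0 // exprn_gt0.
have [de de0 [Hp Hq]] := Hcl _ e0.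
have [k Hk] : exists k, S / 2 ^+ k <= de.
  exists (Num.trunc (S / de)).+1; rewrite ler_pdivrMr ?exprn_gt0 // mulrC -ler_pdivrMr //.
  apply: le_trans (ltW (truncnS_gt _)) _.
  rewrite -natrX ler_nat; exact: ltnW (ltn_expl _ _).
have k2 : 0 < (2 : R) ^+ k by rewrite exprn_gt0.
have wS : w k <= S / 2 ^+ k by rewrite ler_pM2r ?invr_gt0 // /S; lra.
have hS : h k <= S / 2 ^+ k by rewrite ler_pM2r ?invr_gt0 // /S; lra.
have [ax xb cy yd big] := sgood k.
set X := (s k).1 in ax xb big *; set Y := (s k).2 in cy yd big *.
have xX := xk k; have yY := yk k; rewrite -/X in xX; rewrite -/Y in yY.
set T := S / 2 ^+ k in Hk wS hS *.
set e := eta / (8 * S ^+ 2) in e0 Hp Hq *.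
have wk := wge k; have hk := hge k.
have inR t := @itv_sub t X (w k) a b ax xb.
have inS t := @itv_sub t Y (h k) c d cy yd.
have [X1 X2] := itv_ends X wk; have [Y1 Y2] := itv_ends Y hk.
(* Each of the two points lies within [T] of (x, y) in both coordinates, so each contributes an
   error 2 e T. *)
have key (f : R -> R -> R) (u v : R) x1 y1 x2 y2 : near_diff f x y a b c d e u v de ->
   X <= x1 <= X + w k -> Y <= y1 <= Y + h k -> X <= x2 <= X + w k -> Y <= y2 <= Y + h k ->
   `|f x2 y2 - f x1 y1 - (u * (x2 - x1) + v * (y2 - y1))| <= e * (4 * T).
  move=> Hf x1r y1r x2r y2r.
  have a1 := itv_dist x1r xX; have a2 := itv_dist x2r xX.
  have b1 := itv_dist y1r yY; have b2 := itv_dist y2r yY.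
  have j x' y' : X <= x' <= X + w k -> Y <= y' <= Y + h k ->
      `|x' - x| <= w k -> `|y' - y| <= h k ->
      `|f x' y' - f x y - u * (x' - x) - v * (y' - y)| <= e * (T + T).
    move=> xr yr xw yh; apply: le_trans (Hf x' y' (inR _ xr) (inS _ yr) _ _) _.
    - exact: le_trans xw (le_trans wS Hk).
    - exact: le_trans yh (le_trans hS Hk).
    by rewrite ler_pM2l // lerD // ?(le_trans xw) ?(le_trans yh).
  have j1 := j _ _ x1r y1r a1 b1; have j2 := j _ _ x2r y2r a2 b2.
  rewrite (_ : _ - _ = (f x2 y2 - f x y - u * (x2 - x) - v * (y2 - y))
     - (f x1 y1 - f x y - u * (x1 - x) - v * (y1 - y))); last by ring.
  apply: le_trans (ler_normB _ _) _; apply: le_trans (lerD j2 j1) _.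
  by rewrite -mulrDr (_ : 4 * T = T + T + (T + T)) //; ring.
have B1 := @primitive_diff_bound (P^~ (Y + h k)) (P^~ Y) (p^~ (Y + h k)) (p^~ Y)
   X (X + w k) (be * h k) (e * (4 * T)).
have B2 := @primitive_diff_bound (Q (X + w k)) (Q X) (q (X + w k)) (q X)
   Y (Y + h k) (be * w k) (e * (4 * T)).
have {}B1 : `|(P (X + w k) (Y + h k) - P X (Y + h k)) - (P (X + w k) Y - P X Y) - be * h k * w k|
    <= e * (4 * T) * w k.
  rewrite (_ : X + w k - X = w k) in B1; last by ring.
  apply: B1; first by rewrite lerDl.
  - by move=> t /inR tr; apply: HP => //; exact: inS.
  - by move=> t /inR tr; apply: HP => //; exact: inS.
  move=> t tr; have := key _ _ _ t Y t (Y + h k) Hp tr _ tr; rewrite subrr mulr0 add0r.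
  by rewrite [Y + h k - Y]addrC addKr; apply.
have {}B2 : `|(Q (X + w k) (Y + h k) - Q (X + w k) Y) - (Q X (Y + h k) - Q X Y) - be * w k * h k|
    <= e * (4 * T) * h k.
  rewrite (_ : Y + h k - Y = h k) in B2; last by ring.
  apply: B2; first by rewrite lerDl.
  - by move=> t /inS tr; apply: HQ => //; exact: inR.
  - by move=> t /inS tr; apply: HQ => //; exact: inR.
  move=> t tr; have := key _ _ _ X t (X + w k) t Hq _ tr _ tr; rewrite subrr mulr0 addr0.
  by rewrite [X + w k - X]addrC addKr; apply.
(* The main terms [be * h k * w k] from the horizontal and from the vertical sides cancel, because
   the cross derivatives agree. *)
have bound : `|Phi X (X + w k) Y (Y + h k)| <= e * (4 * T) * (w k + h k).
  rewrite /Phi.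
  rewrite (_ : _ - _ = ((P (X + w k) (Y + h k) - P X (Y + h k)) - (P (X + w k) Y - P X Y) - be * h k * w k)
    - ((Q (X + w k) (Y + h k) - Q (X + w k) Y) - (Q X (Y + h k) - Q X Y) - be * w k * h k)); last by ring.
  by apply: le_trans (ler_normB _ _) _; rewrite mulrDr lerD.
have whT : w k + h k <= T.
  by rewrite /w /h /T -mulrDl ler_pM2r ?invr_gt0 // /S lerDl.
have T0 : 0 < T by rewrite /T divr_gt0.
have : eta / 4 ^+ k <= e * (4 * T) * T.
  apply: le_trans big _; apply: le_trans bound _.
  have eT : 0 <= e * (4 * T) by apply: mulr_ge0; [exact: ltW|apply: mulr_ge0 => //; exact: ltW].
  exact: ler_wpM2l.
have -> : e * (4 * T) * T = eta / 4 ^+ k / 2.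
  have k4 : (4 : R) ^+ k = 2 ^+ k * 2 ^+ k by rewrite -exprMn; congr (_ ^+ _); ring.
  by rewrite /e /T k4; field; rewrite !gt_eqF.
rewrite leNgt => /negP; apply.
by rewrite ltr_pdivrMr // mulr_natr mulr2n ltrDl divr_gt0 // exprn_gt0.
Qed.

End Goursat.

(** * Closed forms on a periodic strip *)

Section Flux.
Variable R : realType.

Lemma clamp_primitive (p : R -> R -> R) (a b : R) (D : R -> Prop) :
  (forall y, D y -> continuous (fun x => p (clamp a b x) y)) ->
  {P : R -> R -> R & forall x y, a <= x <= b -> D y -> has_rder (P^~ y) x (p x y)}.
Proof.
(* The base point [a - 1] lies strictly to the left of [a], because [continuous_primitive]
   differentiates only to the right of its base point. *)
move=> pc; have [P HP] : {P : R -> R -> R & forall y, D y -> forall x, a - 1 < x -> has_rder (P y) x (p (clamp a b x) y)}.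
  apply: (@choice _ _ (fun y F => D y -> forall x, a - 1 < x -> has_rder F x (p (clamp a b x) y))) => y.
  by case: (pselect (D y)) => [/pc /(@continuous_primitive _ _ (a - 1))[F HF]|N]; [exists F|exists id].
exists (fun x y => P y x) => x y xr Dy; rewrite -(clamp_id xr) {1}(clamp_id xr); apply: HP => //.
by case/andP: xr => ax _; apply: lt_le_trans ax; rewrite ltrBlDr ltrDl.
Qed.

(** By periodicity the horizontal sides cancel in Goursat's identity, so q has the same integral
    over both vertical sides. By the mean value theorem q then takes a common value on the two: it
    is at most [B] in size on the right and within [e] of [k] on the left. *)
Lemma closed_form_flux (p q : R -> R -> R) (a b c d B e k : R) : a <= b -> c < d ->
  (forall x y, a <= x <= b -> c <= y <= d -> closed_at p q a b c d x y) ->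
  (forall x, a <= x <= b -> p x c = p x d) ->
  (forall y, c <= y <= d -> `|q b y| <= B) ->
  (forall y, c <= y <= d -> `|q a y - k| <= e) -> `|k| <= B + e.
Proof.
move=> ab cd cl per qB qe; have cd' := ltW cd.
have [|pc _] := @near_diff_continuous R p a b c d ab cd'.
  move=> x y xr yr; have [al [be [ga H]]] := cl x y xr yr.
  by exists al, be => e' /H [de de0 []]; exists de.
have [|_ qc] := @near_diff_continuous R q a b c d ab cd'.
  move=> x y xr yr; have [al [be [ga H]]] := cl x y xr yr.
  by exists be, ga => e' /H [de de0 []]; exists de.
have [P HP] := clamp_primitive pc.
have [Q HQ] := @clamp_primitive (fun y x => q x y) c d (fun x => a <= x <= b) qc.
have {}HQ x y : a <= x <= b -> c <= y <= d -> has_rder (Q^~ x) y (q x y) by move=> xr yr; exact: HQ.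
have cc : c <= c <= d by rewrite lexx.
have dd : c <= d <= d by rewrite lexx cd'.
have aa : a <= a <= b by rewrite lexx.
have bb : a <= b <= b by rewrite lexx ab.
have := goursat_rectangle ab cd' cl HP (Q := fun x y => Q y x) HQ.
(* The primitives on the two horizontal sides are unrelated, but their derivatives agree: the bound
   is used with constant and error both zero. *)
have -> : P b d - P a d - (P b c - P a c) = 0.
  have := @primitive_diff_bound R (P^~ d) (P^~ c) (p^~ d) (p^~ c) a b 0 0 ab
    (fun x xr => HP x d xr dd) (fun x xr => HP x c xr cc).
  rewrite !mul0r subr0 => H; apply/eqP; rewrite -normr_le0; apply: H => x xr.
  by rewrite per // subrr subr0 normr0.
move=> /esym /eqP; rewrite subr_eq0 => /eqP E.
have [t tr Et] := rder_mvt cd' (fun y yr => HQ b y bb yr).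
have [u ur Eu] := rder_mvt cd' (fun y yr => HQ a y aa yr).
move: E; rewrite Et Eu => /(mulIf _) E.
have {}E : q b t = q a u by apply: E; rewrite subr_eq0 gt_eqF.
rewrite -(subKr (q a u) k) opprB addrC -{1}E.
have h1 := qB t tr; have h2 := qe u ur.
by rewrite -E in h2 *; rewrite distrC in h2; apply: le_trans (ler_normD _ _) _; rewrite addrC lerD // addrC.
Qed.

End Flux.

(** * Holomorphic functions of one variable *)

Section ComplexDerivative.
Variable R : realType.
Local Notation C := (Cx R).
Implicit Types (F G : C -> C) (w z h l : C).

Definition cdiff F w l := forall e : R, 0 < e -> exists2 d : R, 0 < d &
  forall h, cabs h < d -> cabs (F (w + h) - F w - l * h) <= e * cabs h.

Lemma cdiff_cst (k : C) w : cdiff (fun=> k) w 0.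
Proof.
by move=> e e0; exists 1 => // h _; rewrite subrr mul0r subrr cabs0 mulr_ge0 ?cabs_ge0 ?ltW.
Qed.

Lemma cdiff_id w : cdiff id w 1.
Proof.
move=> e e0; exists 1 => // h _; rewrite /= mul1r (_ : _ - _ = 0) ?cabs0; last by ring.
by rewrite mulr_ge0 ?cabs_ge0 ?ltW.
Qed.

Lemma cdiffD F G w l l' : cdiff F w l -> cdiff G w l' -> cdiff (fun z => F z + G z) w (l + l').
Proof.
move=> HF HG e e0; have e2 : 0 < e / 2 by rewrite divr_gt0.
have [d d0 Hd] := HF _ e2; have [d' d0' Hd'] := HG _ e2.
exists (Num.min d d'); first by rewrite lt_min d0.
move=> h; rewrite lt_min => /andP[/Hd h1 /Hd' h2].
rewrite (_ : _ - _ = F (w + h) - F w - l * h + (G (w + h) - G w - l' * h)); last by ring.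
by apply: le_trans (cabsD _ _) _; rewrite (splitr e) mulrDl lerD.
Qed.

Lemma cdiff_continuous F w l : cdiff F w l -> forall e, 0 < e ->
  exists2 d, 0 < d & forall h, cabs h < d -> cabs (F (w + h) - F w) <= e.
Proof.
move=> HF e e0; have [d d0 Hd] := HF 1 ltr01.
have k0 : 0 < 1 + cabs l by rewrite ltr_pwDl ?cabs_ge0.
exists (Num.min d (e / (1 + cabs l))); first by rewrite lt_min d0 divr_gt0.
move=> h; rewrite lt_min => /andP[/Hd h1 h2].
rewrite -(subrK (l * h) (F _ - _)); apply: le_trans (cabsD _ _) _.
apply: le_trans (lerD h1 (lexx _)) _; rewrite cabsM -mulrDl mulrC.
by rewrite -ler_pdivlMr // ltW.
Qed.

Lemma cdiffM F G w l l' : cdiff F w l -> cdiff G w l' ->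
  cdiff (fun z => F z * G z) w (l * G w + F w * l').
Proof.
move=> HF HG e e0.
have Gc := cdiff_continuous HG.
pose k := cabs (F w) + cabs (G w) + cabs l + 1.
have := cabs_ge0 (F w); have := cabs_ge0 (G w); have := cabs_ge0 l => l0 g0 f0.
have k0 : 0 < k by rewrite /k; lra.
(* The cap 1 keeps [G (w + h)] below [k] in modulus; [e / (3 * k)] makes each of the three error
   terms at most a third of the total. *)
have e3 : 0 < Num.min 1 (e / (3 * k)) by rewrite lt_min ltr01 divr_gt0 // mulr_gt0.
set e' := Num.min _ _ in e3.
have [d d0 Hd] := HF _ e3; have [d' d0' Hd'] := HG _ e3; have [d'' d0'' Hd''] := Gc _ e3.
exists (Num.min d (Num.min d' d'')); first by rewrite !lt_min d0 d0'.
move=> h; rewrite !lt_min => /and3P[/Hd h1 /Hd' h2 /Hd'' h3].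
rewrite (_ : _ - _ = (F (w + h) - F w - l * h) * G (w + h)
   + F w * (G (w + h) - G w - l' * h) + l * h * (G (w + h) - G w)); last by ring.
apply: le_trans (cabsD _ _) _; apply: le_trans (lerD (cabsD _ _) (lexx _)) _.
rewrite !cabsM; have hh := cabs_ge0 h.
have gk : cabs (G (w + h)) <= k.
  rewrite -(subrK (G w) (G (w + h))); apply: le_trans (cabsD _ _) _.
  have : e' <= 1 by rewrite /e' ge_min lexx.
  by rewrite /k; lra.
have ek : e' * k <= e / 3.
  apply: le_trans (ler_wpM2r (ltW k0) (_ : e' <= e / (3 * k))) _; first by rewrite /e' ge_min lexx orbT.
  by rewrite invfM mulrA divfK // gt_eqF.
have t1 : cabs (F (w + h) - F w - l * h) * cabs (G (w + h)) <= e / 3 * cabs h.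
  apply: le_trans (ler_pM (cabs_ge0 _) (cabs_ge0 _) h1 gk) _.
  by rewrite mulrAC ler_wpM2r.
have t2 : cabs (F w) * cabs (G (w + h) - G w - l' * h) <= e / 3 * cabs h.
  apply: le_trans (ler_wpM2l f0 h2) _; rewrite mulrA mulrC [cabs (F w) * _]mulrC mulrC ler_wpM2r //.
  apply: le_trans ek; rewrite ler_wpM2l ?(ltW e3) // /k; lra.
have t3 : cabs l * cabs h * cabs (G (w + h) - G w) <= e / 3 * cabs h.
  apply: le_trans (ler_wpM2l (mulr_ge0 l0 hh) h3) _; rewrite mulrAC ler_wpM2r // mulrC.
  apply: le_trans ek; rewrite ler_wpM2l ?(ltW e3) // /k; lra.
by apply: le_trans (lerD (lerD t1 t2) t3) _; rewrite -!mulrDl ler_wpM2r //; lra.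
Qed.

Lemma cdiffZ (k : C) F w l : cdiff F w l -> cdiff (fun z => k * F z) w (k * l).
Proof. by move=> HF; have := cdiffM (cdiff_cst k w) HF; rewrite mul0r add0r. Qed.

Lemma cdiffB F G w l l' : cdiff F w l -> cdiff G w l' -> cdiff (fun z => F z - G z) w (l - l').
Proof.
move=> HF /(cdiffZ (-1)) HG; have := cdiffD HF HG; rewrite mulN1r.
by under eq_fun do rewrite mulN1r.
Qed.

Let half_frac (e k : R) : 0 < e -> 0 <= k ->
  e / (2 * (k + 1)) * (k + 1) = e / 2 /\ k * (e / (2 * (k + 1))) <= e / 2.
Proof.
move=> e0 k0; have k1 : 0 < k + 1 by rewrite ltr_wpDl.
have E : e / (2 * (k + 1)) * (k + 1) = e / 2 by field; rewrite gt_eqF.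
by split => //; rewrite -E mulrC ler_wpM2l ?lerDl // divr_ge0 ?ltW // mulr_gt0.
Qed.

Lemma cdiff_comp F G w l l' : cdiff F w l -> cdiff G (F w) l' ->
  cdiff (fun z => G (F z)) w (l' * l).
Proof.
move=> HF HG e e0.
have := cabs_ge0 l'; have := cabs_ge0 l => l0 l0'.
have a0 : 0 < e / (2 * (cabs l + 1)) by rewrite divr_gt0 // mulr_gt0 // ltr_wpDl.
have b0 : 0 < Num.min 1 (e / (2 * (cabs l' + 1))) by rewrite lt_min ltr01 divr_gt0 // mulr_gt0 // ltr_wpDl.
have [d d0 Hd] := HG _ a0; have [d' d0' Hd'] := HF _ b0.
have dd : 0 < d / 2 by rewrite divr_gt0.
have [d'' d0'' Hd''] := cdiff_continuous HF dd.
exists (Num.min d' d''); first by rewrite lt_min d0'.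
move=> h; rewrite lt_min => /andP[/Hd' h1 /Hd'' h2]; have hh := cabs_ge0 h.
set k := F (w + h) - F w in h1 h2.
have /Hd : cabs k < d by apply: le_lt_trans h2 _; rewrite ltr_pdivrMr // mulr_natr mulr2n ltrDl.
rewrite [F w + _]addrC subrK => h3.
rewrite (_ : _ - _ = (G (F (w + h)) - G (F w) - l' * k) + l' * (k - l * h)); last by ring.
apply: le_trans (cabsD _ _) _; rewrite cabsM (splitr e) mulrDl; apply: lerD.
  apply: le_trans h3 _.
  have hk : cabs k <= (cabs l + 1) * cabs h.
    rewrite -(subrK (l * h) k); apply: le_trans (cabsD _ _) _; rewrite cabsM mulrDl mul1r addrC lerD2l.
    apply: le_trans h1 _; rewrite -{2}[cabs h]mul1r ler_wpM2r // ge_min lexx //.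
  apply: le_trans (ler_wpM2l (ltW a0) hk) _.
  by rewrite mulrA (half_frac e0 l0).1.
apply: le_trans (ler_wpM2l l0' h1) _; rewrite mulrA ler_wpM2r //.
apply: le_trans (ler_wpM2l l0' (_ : _ <= e / (2 * (cabs l' + 1)))) _.
  by rewrite ge_min lexx orbT.
exact: (half_frac e0 l0').2.
Qed.

Lemma cdiff_uniq F w l l' : cdiff F w l -> cdiff F w l' -> l = l'.
Proof.
move=> HF HG; apply/eqP; rewrite -subr_eq0 -cabs_eq0 eq_le cabs_ge0 andbT leNgt; apply/negP => p.
have e0 : 0 < cabs (l - l') / 4 by rewrite divr_gt0.
have [d d0 Hd] := HF _ e0; have [d' d0' Hd'] := HG _ e0.
pose t := Num.min d d' / 2; have t0 : 0 < t by rewrite divr_gt0 // lt_min d0.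
have td : t < Num.min d d' by rewrite ltr_pdivrMr // mulr_natr mulr2n ltrDl lt_min d0.
move: td; rewrite lt_min => /andP[td td'].
have tt : cabs (ofR t) = t by rewrite cabs_ofR gtr0_norm.
have := Hd (ofR t); rewrite tt => /(_ td) h1.
have := Hd' (ofR t); rewrite tt => /(_ td') h2.
have : cabs ((l - l') * ofR t) <= cabs (l - l') / 2 * t.
  rewrite (_ : _ * _ = (F (w + ofR t) - F w - l' * ofR t) - (F (w + ofR t) - F w - l * ofR t)); last by ring.
  apply: le_trans (cabsB _ _) _; apply: le_trans (lerD h2 h1) _; rewrite -mulrDl ler_pM2r //; lra.
rewrite cabsM tt ler_pM2r // ; lra.
Qed.

Definition cexp w : C := ofR (expR (reC w)) * (ofR (cos (imC w)) + 'i * ofR (sin (imC w))).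

Lemma cexpD w z : cexp (w + z) = cexp w * cexp z.
Proof.
rewrite /cexp reCD imCD expRD sinD cosD; apply: complex_ext;
by rewrite ?(reCD, imCD, reCM, imCM, reC_ofR, imC_ofR, reC_i, imC_i); ring.
Qed.

Lemma cabs_cexp w : cabs (cexp w) = expR (reC w).
Proof.
rewrite /cexp cabsM cabs_ofR ger0_norm ?expR_ge0 // cabsE.
rewrite ?(reCD, imCD, reCM, imCM, reC_ofR, imC_ofR, reC_i, imC_i).
rewrite (_ : _ + _ = 1) ?sqrtr1 ?mulr1 //.
by rewrite !(mul0r, mul1r, mulr0, addr0, subr0, add0r) cos2Dsin2.
Qed.

Lemma cexp0 : cexp 0 = 1.
Proof. by rewrite /cexp /reC /imC /= expR0 cos0 sin0 rmorph0 mulr0 addr0 !rmorph1 mulr1. Qed.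

Lemma cexp_2pi w : cexp (w + 'i * ofR (pi *+ 2)) = cexp w.
Proof.
rewrite cexpD [X in _ * X](_ : _ = 1) ?mulr1 // /cexp.
rewrite ?(reCM, imCM, reC_ofR, imC_ofR, reC_i, imC_i) !(mul0r, mul1r, mulr0, subr0, add0r, addr0).
have -> : cos (pi *+ 2 : R) = 1 by rewrite mulr2n cosDpi cospi opprK.
have -> : sin (pi *+ 2 : R) = 0 by rewrite mulr2n sinDpi sinpi oppr0.
by rewrite expR0 rmorph0 mulr0 addr0 !rmorph1 mulr1.
Qed.

Let has_rder0 (f : R -> R) (l : R) : is_derive (0 : R) 1 f l -> forall e : R, 0 < e ->
  exists2 d : R, 0 < d & forall h : R, `|h| < d -> `|f h - f 0 - l * h| <= e * `|h|.
Proof. by move=> /has_rderP H e /H [d d0 Hd]; exists d => // h /Hd; rewrite add0r. Qed.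

Let seven_le (E X : R) : 0 <= E -> E <= X / 8 -> E + E * 2 + (E + E + E * 2) <= X.
Proof. lra. Qed.

Let cdiff_cexp0 : cdiff cexp 0 1.
Proof.
(* The real and imaginary remainders split into five pieces, bounded by 1, 2, 1, 1 and 2 times
   [e' * cabs h]; that is seven in all, and 8 suffices. *)
move=> e e0; have [e' e0' [e1 e8]] : exists2 e' : R, 0 < e' & e' <= 1 /\ e' <= e / 8.
  exists (Num.min 1 (e / 8)); first by rewrite lt_min ltr01 divr_gt0.
  by rewrite !ge_min !lexx orbT.
have [d d0 Hd] := has_rder0 (is_derive_expR (0 : R)) e0'.
have [d1 d10 Hd1] := has_rder0 (is_derive_cos (0 : R)) e0'.
have [d2 d20 Hd2] := has_rder0 (is_derive_sin (0 : R)) e0'.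
exists (Num.min (Num.min d d1) (Num.min d2 e')); first by rewrite !lt_min d0 d10 d20 e0'.
move=> h; rewrite !lt_min => /andP[/andP[hd hd1] /andP[hd2 he]].
have hr := abs_reC h; have hi := abs_imC h.
have := Hd (reC h) (le_lt_trans hr hd); have := Hd1 (imC h) (le_lt_trans hi hd1).
have := Hd2 (imC h) (le_lt_trans hi hd2).
rewrite [0 + h]add0r cexp0 expR0 cos0 sin0 !mul1r oppr0 mul0r ?subr0 ?addr0.
set x := reC h in hr *; set y := imC h in hi *; set c := cos y; set s := sin y.
move=> hs hc hx; have hh := cabs_ge0 h.
have x1 : `|x| <= 1 by apply: le_trans hr _; apply: ltW; apply: lt_le_trans he e1.
have xe : `|x| <= e' by apply: le_trans hr _; exact: ltW.
have c1 : `|c| <= 1 by rewrite ler_norml cos_geN1 cos_le1.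
have s1 : `|s| <= 1 by rewrite ler_norml sin_geN1 sin_le1.
have b12 k : `|k| <= 1 -> `|(expR x - 1 - x) * k| <= e' * cabs h.
  move=> k1; rewrite normrM -[leRHS]mulr1; apply: ler_pM => //; apply: le_trans hx _; by rewrite ler_pM2l.
have b3 : `|(1 + x) * (c - 1)| <= e' * cabs h * 2.
  rewrite normrM [`|1 + x| * _]mulrC; apply: ler_pM => //; first by apply: le_trans hc _; rewrite ler_pM2l.
  by apply: le_trans (ler_normD _ _) _; rewrite normr1; lra.
have b4 : `|s - y| <= e' * cabs h by apply: le_trans hs _; rewrite ler_pM2l.
have b5 : `|x * s| <= e' * cabs h * 2.
  have sy : `|s| <= 2 * `|y|.
    rewrite -(subrK y s); apply: le_trans (ler_normD _ _) _.
    rewrite [2 * _]mulr_natl mulr2n lerD2r; apply: le_trans hs _.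
    by rewrite -[leRHS]mul1r ler_wpM2r.
  rewrite normrM -mulrA; apply: ler_pM => //; apply: le_trans sy _; rewrite mulrC ler_wpM2r //.
have bb : e' * cabs h <= e / 8 * cabs h by rewrite ler_wpM2r.
apply: le_trans (cabs_le _) _.
have -> : reC (cexp h - 1 - h) = (expR x - 1 - x) * c + (1 + x) * (c - 1).
  rewrite /cexp ?(reCB, reCD, imCD, reCM, imCM, reC_ofR, imC_ofR, reC_i, imC_i) -/x -/y -/s -/c.
  by rewrite (_ : reC (-1) = -1) //; ring.
have -> : imC (cexp h - 1 - h) = (expR x - 1 - x) * s + (s - y) + x * s.
  rewrite imCB imCB /cexp ?(reCD, imCD, reCM, imCM, reC_ofR, imC_ofR, reC_i, imC_i) -/x -/y -/s -/c.
  ring.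
have n1 := ler_normD ((expR x - 1 - x) * c) ((1 + x) * (c - 1)).
have n2 := ler_normD ((expR x - 1 - x) * s + (s - y)) (x * s).
have n3 := ler_normD ((expR x - 1 - x) * s) (s - y).
apply: le_trans (lerD n1 (le_trans n2 (lerD n3 (lexx _)))) _.
apply: le_trans (lerD (lerD (b12 _ c1) b3) (lerD (lerD (b12 _ s1) b4) b5)) _.
by apply: seven_le; rewrite ?mulr_ge0 ?(ltW e0') // mulrAC.
Qed.

Lemma cdiff_cexp w : cdiff cexp w (cexp w).
Proof.
move=> e e0; have k0 : 0 < cabs (cexp w) by rewrite cabs_cexp expR_gt0.
have [d d0 Hd] := cdiff_cexp0 (divr_gt0 e0 k0); exists d => // h /Hd.
rewrite add0r cexp0 mul1r cexpD => H.
rewrite (_ : _ - _ = cexp w * (cexp h - 1 - h)); last by ring.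
by rewrite cabsM mulrC -ler_pdivlMr // mulrAC.
Qed.

End ComplexDerivative.

(** * Cauchy estimates for first and second-order remainders *)

Section GradientEstimate.
Variable R : realType.
Local Notation C := (Cx R).
Implicit Types (F G : C -> C) (w z h l c : C).

Let mk (x y : R) : C := ofR x + 'i * ofR y.

Let re_mk x y : reC (mk x y) = x.
Proof. by rewrite /mk reCD reCM reC_i imC_i !reC_ofR imC_ofR; ring. Qed.
Let im_mk x y : imC (mk x y) = y.
Proof. by rewrite /mk imCD imCM reC_i imC_i !reC_ofR !imC_ofR; ring. Qed.

(* The form is closed by the Cauchy-Riemann equations. *)
Lemma cdiff_closed_at (H : C -> C) (a b c d x y : R) (D : C) : cdiff H (mk x y) D ->
  closed_at (fun x y => imC (H (mk x y))) (fun x y => reC (H (mk x y))) a b c d x y.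
Proof.
(* The form is the imaginary part of H dw, and both of its cross derivatives are Re D. *)
move=> HD; exists (imC D), (reC D), (- imC D) => e e0.
have [de de0 Hd] := HD e e0; exists (de / 3); first by rewrite divr_gt0.
have key x' y' : `|x' - x| <= de / 3 -> `|y' - y| <= de / 3 ->
   cabs (H (mk x' y') - H (mk x y) - D * mk (x' - x) (y' - y)) <= e * (`|x' - x| + `|y' - y|).
  move=> hx hy; have hh : cabs (mk (x' - x) (y' - y)) <= `|x' - x| + `|y' - y|.
    by apply: le_trans (cabs_le _) _; rewrite re_mk im_mk.
  have /Hd : cabs (mk (x' - x) (y' - y)) < de by apply: le_lt_trans hh _; lra.
  rewrite (_ : mk x y + _ = mk x' y'); last first.
    by apply: complex_ext; rewrite !(re_mk, im_mk, reCD, imCD); ring.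
  by move=> Hk; apply: le_trans Hk _; rewrite ler_pM2l.
split=> x' y' _ _ hx hy; apply: le_trans (key x' y' hx hy).
  apply: le_trans (abs_imC _); rewrite imCB imCB imCM !(re_mk, im_mk).
  by rewrite le_eqVlt; apply/orP; left; apply/eqP; congr (`|_|); ring.
apply: le_trans (abs_reC _); rewrite reCB reCB reCM !(re_mk, im_mk).
by rewrite le_eqVlt; apply/orP; left; apply/eqP; congr (`|_|); ring.
Qed.

(* In the logarithmic coordinate w the function (F(c + e^w) - F(c)) e^-w is
   holomorphic and 2 pi i periodic, hence its mean over a vertical period does
   not depend on Re w, and it tends to F'(c) as Re w -> -oo. *)
Lemma cdiff_re_bound F c (r B : R) l : 0 < r ->
  (forall w, cabs (w - c) <= r -> exists l, cdiff F w l) ->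
  (forall w, cabs (w - c) <= r -> cabs (F w) <= B) ->
  cdiff F c l -> `|reC l| <= 2 * B / r.
Proof.
move=> r0 Fh FB Fl; apply/ler_addgt0Pr => e e0.
have [d d0 Hd] := Fl e e0.
pose H w := (F (c + cexp w) - F c) * cexp (- w).
(* The side Re w = b covers the circle of radius r about c, where |F(c + e^w) - F(c)| e^-b <= 2 B /
   r. The side Re w = a covers a circle so small that the quotient is within [e] of l. *)
pose b := ln r; have eb : expR b = r by rewrite lnK // posrE.
pose a := Num.min b (ln (d / 2)).
have ea : expR a < d.
  apply: le_lt_trans (_ : expR (ln (d / 2)) < d); first by rewrite ler_expR ge_min lexx orbT.
  by rewrite lnK ?posrE ?divr_gt0 // ltr_pdivrMr // mulr_natr mulr2n ltrDl.
have small w : reC w <= b -> cabs (c + cexp w - c) <= r.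
  by move=> wb; rewrite addrAC subrr add0r cabs_cexp -eb ler_expR.
have FcB : cabs (F c) <= B by apply: FB; rewrite subrr cabs0 ltW.
have Hdiff w : reC w <= b -> exists D, cdiff H w D.
  move=> wb; have [l' Fl'] := Fh _ (small w wb).
  have h1 : cdiff (fun w => c + cexp w) w (0 + cexp w) := cdiffD (cdiff_cst c w) (cdiff_cexp w).
  have h2 := cdiffB (cdiff_comp h1 Fl') (cdiff_cst (F c) w).
  have h3 := cdiff_comp (cdiffZ (-1) (cdiff_id w)) (cdiff_cexp _).
  have -> : H = (fun z => (F (c + cexp z) - F c) * cexp (-1 * id z)).
    by apply/funext => z; rewrite /H mulN1r.
  by eexists; exact: (cdiffM h2 h3).
have Hper w : H (w + 'i * ofR (pi *+ 2)) = H w.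
  rewrite /H cexp_2pi; congr (_ * _).
  by rewrite -[LHS]cexp_2pi; congr cexp; ring.
have ab : a <= b by rewrite ge_min lexx.
have p0 : (0 : R) < pi *+ 2 by rewrite pmulrn_lgt0 // pi_gt0.
apply: (@closed_form_flux R (fun x y => imC (H (mk x y))) (fun x y => reC (H (mk x y)))
   a b 0 (pi *+ 2) (2 * B / r) e (reC l) ab p0).
- move=> x y /andP[_ xb] _; have [|D HD] := Hdiff (mk x y); first by rewrite re_mk.
  exact: cdiff_closed_at HD.
- move=> x _; rewrite -[in LHS]Hper; congr (imC (H _)).
  by rewrite /mk rmorph0 mulr0 addr0.
- move=> y _; apply: le_trans (abs_reC _) _; rewrite /H cabsM cabs_cexp reCN re_mk expRN eb.
  rewrite ler_pM2r ?invr_gt0 //; apply: le_trans (cabsB _ _) _.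
  by rewrite mulr_natl mulr2n lerD // FB // small // re_mk.
move=> y _; rewrite -reCB; apply: le_trans (abs_reC _) _.
have /Hd : cabs (cexp (mk a y)) < d by rewrite cabs_cexp re_mk.
have ee : cexp (mk a y) * cexp (- mk a y) = 1 by rewrite -cexpD subrr cexp0.
rewrite /H (_ : _ - l = (F (c + cexp (mk a y)) - F c - l * cexp (mk a y)) * cexp (- mk a y)); last first.
  by rewrite [RHS]mulrBl -[l * _ * _]mulrA ee mulr1.
move=> h1; rewrite cabsM; apply: le_trans (ler_wpM2r (cabs_ge0 _) h1) _.
by rewrite -mulrA -cabsM ee cabs1 mulr1.
Qed.

(** The bound on the real part, applied to F and to -i F, whose derivative has real part Im l. *)
Lemma cdiff_bound F c (r B : R) l : 0 < r ->
  (forall w, cabs (w - c) <= r -> exists l, cdiff F w l) ->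
  (forall w, cabs (w - c) <= r -> cabs (F w) <= B) ->
  cdiff F c l -> cabs l <= 4 * B / r.
Proof.
move=> r0 Fh FB Fl; apply: le_trans (cabs_le _) _.
have h1 := cdiff_re_bound r0 Fh FB Fl.
have : `|reC (- 'i * l)| <= 2 * B / r.
  apply: (@cdiff_re_bound (fun w => - 'i * F w) c) => //; last exact: cdiffZ.
    by move=> w /Fh [l' Hl']; exists (- 'i * l'); exact: cdiffZ.
  by move=> w /FB; rewrite cabsM cabsN cabs_i mul1r.
rewrite reCM reCN imCN reC_i imC_i oppr0 mul0r mulN1r opprK add0r => h2.
apply: le_trans (lerD h1 h2) _; rewrite -mulrDl -mulrDl.
by rewrite (_ : 2 + 2 = 4) //; ring.
Qed.

(** The mean value theorem holds for Re(u F) along the segment. Taking u = 1 and u = -i controls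
    real and imaginary parts, which costs the factor 2. *)
Lemma cdiff_lip F w h (M : R) :
  (forall t : R, 0 <= t <= 1 -> exists2 l, cdiff F (w + ofR t * h) l & cabs l <= M) ->
  cabs (F (w + h) - F w) <= 2 * M * cabs h.
Proof.
move=> HF.
have key (u : C) : cabs u <= 1 -> `|reC (u * (F (w + h) - F w))| <= M * cabs h.
  move=> u1.
  have [g Hg] : {g : R -> C & forall t, 0 <= t <= 1 -> cdiff F (w + ofR t * h) (g t) /\ cabs (g t) <= M}.
    apply: (@choice _ _ (fun t l => 0 <= t <= 1 -> cdiff F (w + ofR t * h) l /\ cabs l <= M)) => t.
    case: (pselect (0 <= t <= 1)) => [/HF [l ? ?]|?]; last by exists 0.
    by exists l.
  have der t : 0 <= t <= 1 -> has_rder (fun t => reC (u * F (w + ofR t * h))) t (reC (u * (g t * h))).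
    move=> tr e e0; have k0 : 0 < cabs h + 1 by rewrite ltr_wpDl ?cabs_ge0.
    have [d d0 Hd] := (Hg _ tr).1 _ (divr_gt0 e0 k0).
    exists (d / (cabs h + 1)); first by rewrite divr_gt0.
    move=> s; rewrite ltr_pdivlMr // => sd.
    have sh : cabs (ofR s * h) <= `|s| * (cabs h + 1).
      by rewrite cabsM cabs_ofR ler_wpM2l // lerDl.
    have := Hd _ (le_lt_trans sh sd).
    rewrite (_ : w + ofR t * h + ofR s * h = w + ofR (t + s) * h) => [H|]; last by rewrite rmorphD /= mulrDl addrA.
    rewrite -reCB (_ : reC _ * s = reC (u * (g t * h) * ofR s)); last first.
      by rewrite mulrC -reCZ mulrC.
    rewrite -reCB; apply: le_trans (abs_reC _) _.
    rewrite (_ : _ - _ = u * (F (w + ofR (t + s) * h) - F (w + ofR t * h) - g t * (ofR s * h))); last by ring.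
    rewrite cabsM; apply: le_trans (ler_pM (cabs_ge0 _) (cabs_ge0 _) u1 H) _.
    rewrite mul1r; apply: le_trans (ler_wpM2l _ sh) _; first by rewrite divr_ge0 ?ltW.
    by rewrite mulrCA divfK ?gt_eqF // mulrC.
  have [t tr] := rder_mvt ler01 der.
  rewrite rmorph1 rmorph0 mul0r mul1r addr0 subr0 mulr1 -reCB -mulrBr => ->.
  apply: le_trans (abs_reC _) _; rewrite !cabsM.
  rewrite -[leRHS]mul1r; apply: ler_pM; rewrite ?mulr_ge0 ?cabs_ge0 //.
  by rewrite ler_wpM2r ?cabs_ge0 // (Hg t tr).2.
have i1 : cabs (- 'i : C) <= 1 by rewrite cabsN cabs_i.
apply: le_trans (cabs_le _) _; rewrite -mulrA mulr_natl mulr2n.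
have h1 := key 1; rewrite mul1r cabs1 in h1; have h2 := key _ i1.
rewrite reCM reCN imCN reC_i imC_i oppr0 mul0r mulN1r opprK add0r in h2.
by apply: lerD => //; exact: h1.
Qed.

Definition hol_on F c (r : R) := forall w, cabs (w - c) < r -> exists l, cdiff F w l.

Lemma cder_bound F c (r B : R) w l : hol_on F c r ->
  (forall w, cabs (w - c) < r -> cabs (F w) <= B) -> 0 < r -> cabs (w - c) < r / 2 ->
  cdiff F w l -> cabs l <= 16 * B / r.
Proof.
move=> Fh FB r0 wr Fl.
have sub z : cabs (z - w) <= r / 4 -> cabs (z - c) < r.
  move=> zw; rewrite -(subrK w z) -addrA; apply: le_lt_trans (cabsD _ _) _; lra.
(* The closed disc of radius r / 4 about w stays inside the open disc about c, since w is within r /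
   2 of c. *)
have := @cdiff_bound F w (r / 4) B l; rewrite (_ : 4 * B / (r / 4) = 16 * B / r); last first.
  by field; rewrite gt_eqF.
apply => //; first by rewrite divr_gt0.
  by move=> z /sub /Fh.
by move=> z /sub /FB.
Qed.

(** F' is not yet known to be holomorphic, so the derivative bound is applied to F(z + h) - F(z)
    instead. On the disc of radius r / 4 this is at most 2 (16 B / r) |h|, and 16 * 32 * 4 =
    2048. *)
Lemma cder_lipschitz F c (r B : R) h l l' : hol_on F c r ->
  (forall w, cabs (w - c) < r -> cabs (F w) <= B) -> 0 < r -> cabs h < r / 4 ->
  cdiff F c l -> cdiff F (c + h) l' -> cabs (l' - l) <= 2048 * B / r ^+ 2 * cabs h.
Proof.
move=> Fh FB r0 hr Fl Fl'.
have B0 : 0 <= B by apply: le_trans (cabs_ge0 (F c)) _; apply: FB; rewrite subrr cabs0.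
have hh := cabs_ge0 h.
pose G z := F (z + h) - F z.
have shift z m : cdiff F (z + h) m -> cdiff (fun z => F (z + h)) z m.
  move=> Fm; have := cdiff_comp (cdiffD (cdiff_id z) (cdiff_cst h z)) Fm.
  by rewrite addr0 mulr1.
have tri z : cabs (z - c) < r / 4 -> cabs (z + h - c) < r / 2.
  move=> zr; rewrite addrAC; apply: le_lt_trans (cabsD _ _) _; lra.
have Gh : hol_on G c (r / 4).
  move=> z zr; have [m Fm] : exists m, cdiff F z m by apply: Fh; lra.
  have [m' Fm'] : exists m, cdiff F (z + h) m by apply: Fh; have := tri z zr; lra.
  by exists (m' - m); apply: cdiffB => //; exact: shift.
have GB z : cabs (z - c) < r / 4 -> cabs (G z) <= 2 * (16 * B / r) * cabs h.
  move=> zr; apply: cdiff_lip => t /andP[t0 t1].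
  have tz : cabs (z + ofR t * h - c) < r / 2.
    rewrite addrAC; apply: le_lt_trans (cabsD _ _) _; rewrite cabsM cabs_ofR ger0_norm //.
    have : t * cabs h <= cabs h by rewrite -[leRHS]mul1r ler_wpM2r.
    lra.
  have [m Fm] : exists m, cdiff F (z + ofR t * h) m by apply: Fh; lra.
  by exists m => //; exact: (cder_bound Fh FB r0 tz Fm).
have := @cder_bound G c (r / 4) _ c (l' - l) Gh GB; rewrite subrr cabs0.
rewrite (_ : _ / (r / 4) = 2048 * B / r ^+ 2 * cabs h); last by field; rewrite gt_eqF.
apply; rewrite ?divr_gt0 //; apply: cdiffB => //; exact: shift.
Qed.

(** [cdiff_lip] for F(z) - l z, whose derivative is bounded by [cder_lipschitz]. The constant
    depends on F only through [B], so the estimate is stable under uniform limits. *)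
Lemma cdiff_quadratic F c (r B : R) h l : hol_on F c r ->
  (forall w, cabs (w - c) < r -> cabs (F w) <= B) -> 0 < r -> cabs h < r / 4 ->
  cdiff F c l -> cabs (F (c + h) - F c - l * h) <= 4096 * B / r ^+ 2 * cabs h ^+ 2.
Proof.
move=> Fh FB r0 hr Fl; have hh := cabs_ge0 h.
have B0 : 0 <= B by apply: le_trans (cabs_ge0 (F c)) _; apply: FB; rewrite subrr cabs0.
have := @cdiff_lip (fun z => F z - l * z) c h (2048 * B / r ^+ 2 * cabs h).
rewrite (_ : F (c + h) - l * (c + h) - (F c - l * c) = F (c + h) - F c - l * h); last by ring.
rewrite (_ : 2 * (_ * cabs h) * cabs h = 4096 * B / r ^+ 2 * cabs h ^+ 2); last by ring.
apply => t /andP[t0 t1].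
have th : cabs (ofR t * h) <= cabs h.
  by rewrite cabsM cabs_ofR ger0_norm // -[leRHS]mul1r ler_wpM2r.
have [m Fm] : exists m, cdiff F (c + ofR t * h) m.
  by apply: Fh; rewrite addrAC subrr add0r; lra.
exists (m - l); first by have := cdiffB Fm (cdiffZ l (cdiff_id (c + ofR t * h))); rewrite mulr1.
apply: le_trans (cder_lipschitz Fh FB r0 (le_lt_trans th hr) Fl Fm) _.
have k0 : 0 <= 2048 * B / r ^+ 2.
  by apply: divr_ge0; [apply: mulr_ge0; [exact: ler0n|exact: B0]|apply: exprn_ge0; exact: ltW].
exact: ler_wpM2l th.
Qed.

End GradientEstimate.

(** * Uniform limits, and holomorphy of derivatives *)

Section UniformLimits.
Variable R : realType.
Local Notation C := (Cx R).
Implicit Types (F G : C -> C) (w z h l c : C).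

(** The intervals [x k - a k, x k + a k] meet pairwise, so the supremum of their left ends lies in
    all of them. This is completeness for an arbitrary index set. *)
Lemma approx_limit (I : Type) (i0 : I) (x a : I -> R) :
  (forall k j, `|x k - x j| <= a k + a j) -> exists L, forall k, `|x k - L| <= a k.
Proof.
move=> H; pose A := [set x k - a k | k in [set: I]].
have up k j : x k - a k <= x j + a j by have := H k j; case: ler0P => ?; lra.
have sA : has_sup A.
  by split; [exists (x i0 - a i0); exists i0|exists (x i0 + a i0) => _ [k _ <-]].
exists (sup A) => k.
have h1 : x k - a k <= sup A by apply: ub_le_sup; [case: sA|exists k].
have h2 : sup A <= x k + a k by apply: ge_sup; [case: sA|move=> _ [j _ <-]].
by case: ler0P => ?; lra.
Qed.

Lemma capprox_limit (I : Type) (i0 : I) (x : I -> C) (a : I -> R) :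
  (forall k j, cabs (x k - x j) <= a k + a j) -> exists L, forall k, cabs (x k - L) <= 2 * a k.
Proof.
move=> H.
have [|u Hu] := @approx_limit I i0 (fun i => reC (x i)) a.
  by move=> k j; rewrite -reCB (le_trans (abs_reC _)).
have [|v Hv] := @approx_limit I i0 (fun i => imC (x i)) a.
  by move=> k j; rewrite -imCB (le_trans (abs_imC _)).
exists (ofR u + 'i * ofR v) => k; apply: le_trans (cabs_le _) _.
rewrite reCB imCB reCD imCD reCM imCM reC_i imC_i !reC_ofR !imC_ofR.
rewrite !(mul0r, mul1r, mulr0, subr0, addr0, add0r) mulr_natl mulr2n.
by apply: lerD; [exact: Hu|exact: Hv].
Qed.

Lemma quadratic_cdiff F c l (r K : R) : 0 < r -> 0 <= K ->
  (forall h, cabs h < r -> cabs (F (c + h) - F c - l * h) <= K * cabs h ^+ 2) -> cdiff F c l.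
Proof.
move=> r0 K0 H e e0; have K1 : 0 < K + 1 by rewrite ltr_wpDl.
exists (Num.min r (e / (K + 1))); first by rewrite lt_min r0 divr_gt0.
move=> h; rewrite lt_min => /andP[hr]; rewrite ltr_pdivlMr // => he.
apply: le_trans (H h hr) _; rewrite expr2 mulrA ler_wpM2r ?cabs_ge0 //.
apply: le_trans (ltW he); rewrite mulrC ler_wpM2l ?cabs_ge0 // lerDl //.
Qed.

(** Weierstrass: the derivatives of the approximants at c are Cauchy by [cder_bound], and their
    quadratic remainders have a common constant, so the expansion passes to the limit. *)
Lemma uniform_limit_cdiff F c (r B : R) : 0 < r ->
  (forall w, cabs (w - c) < r -> cabs (F w) <= B) ->
  (forall e, 0 < e -> exists2 G, hol_on G c r & forall w, cabs (w - c) < r -> cabs (F w - G w) <= e) ->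
  exists l, cdiff F c l.
Proof.
move=> r0 FB HG.
have cc : cabs (c - c) < r by rewrite subrr cabs0.
have B0 : 0 <= B by apply: le_trans (cabs_ge0 (F c)) (FB _ cc).
(* Approximants are indexed by their error; the cap 1 bounds them all by B + 1. *)
pose I := {e : R | 0 < e <= 1}.
have i0 : I by exists 1; rewrite ltr01 lexx.
have epos (i : I) : 0 < sval i by case/andP: (svalP i).
have [g Hg] : {g : I -> (C -> C) * C & forall i, [/\ hol_on (g i).1 c r,
    forall w, cabs (w - c) < r -> cabs (F w - (g i).1 w) <= sval i & cdiff (g i).1 c (g i).2]}.
  apply: (@choice _ _ (fun i (g : (C -> C) * C) => [/\ hol_on g.1 c r,
    forall w, cabs (w - c) < r -> cabs (F w - g.1 w) <= sval i & cdiff g.1 c g.2])) => i.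
  have [G Gh GF] := HG _ (epos i); have [l Hl] := Gh c cc.
  by exists (G, l).
pose a (i : I) := 16 * sval i / r.
have [|L HL] := @capprox_limit I i0 (fun i => (g i).2) a.
  move=> i j; have [hi Gi di] := Hg i; have [hj Gj dj] := Hg j.
  rewrite /a -mulrDl -mulrDr.
  apply: (@cder_bound _ (fun z => (g i).1 z - (g j).1 z) c r (sval i + sval j) c) => //.
  - move=> w wr; have [l Hl] := hi w wr; have [l' Hl'] := hj w wr.
    by exists (l - l'); exact: cdiffB.
  - move=> w wr; rewrite -[(g i).1 w](subKr (F w)) -addrA opprB addrC.
    rewrite (_ : _ + _ = F w - (g j).1 w - (F w - (g i).1 w)); last by ring.
    by apply: le_trans (cabsB _ _) _; rewrite addrC lerD ?Gi ?Gj.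
  - by rewrite subrr cabs0 divr_gt0.
  exact: cdiffB.
have q0 : 0 <= 4096 * (B + 1) / r ^+ 2.
  apply: divr_ge0; last by rewrite exprn_ge0 ?ltW.
  by apply: mulr_ge0; [exact: ler0n|rewrite addr_ge0].
exists L; apply: (@quadratic_cdiff F c L (r / 4) _ _ q0); first by rewrite divr_gt0.
move=> h hr; apply/ler_addgt0Pr => e e0.
(* The values of F contribute 2 e' and the derivative contributes 2 (16 e' / r) (r / 2) = 16 e'. *)
pose e' := Num.min 1 (e / 18).
have e1 : 0 < e' <= 1 by rewrite lt_min ltr01 divr_gt0 //= ge_min lexx.
have e'e : e' <= e / 18 by rewrite ge_min lexx orbT.
pose i : I := exist _ e' e1; have [Gh GF Gd] := Hg i; have := HL i.
rewrite /a (_ : sval i = e') // => HLi; rewrite (_ : sval i = e') // in GF.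
set G := (g i).1 in Gh GF Gd *; set l := (g i).2 in Gd HLi *.
have GB w : cabs (w - c) < r -> cabs (G w) <= B + 1.
  move=> wr; rewrite -(subKr (F w) (G w)); apply: le_trans (cabsB _ _) _.
  by apply: lerD; [exact: FB|apply: le_trans (GF w wr) _; have /andP[] := e1].
have Q := cdiff_quadratic Gh GB r0 hr Gd.
have chr : cabs (c + h - c) < r by rewrite addrAC subrr add0r; have := cabs_ge0 h; lra.
rewrite (_ : _ - _ = (G (c + h) - G c - l * h) + ((F (c + h) - G (c + h)) - (F c - G c) + (l - L) * h)); last by ring.
apply: le_trans (cabsD _ _) _; apply: lerD; first exact: Q.
apply: le_trans (cabsD _ _) _; rewrite cabsM.
have b1 : cabs (F (c + h) - G (c + h) - (F c - G c)) <= e' + e'.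
  by apply: le_trans (cabsB _ _) _; apply: lerD; exact: GF.
have b2 : cabs (l - L) * cabs h <= 2 * (16 * e' / r) * (r / 2).
  by apply: ler_pM; rewrite ?cabs_ge0 //; have := cabs_ge0 h; lra.
have E : 2 * (16 * e' / r) * (r / 2) = 16 * e' by field; rewrite gt_eqF.
by rewrite E in b2; apply: le_trans (lerD b1 b2) _; lra.
Qed.

(** The difference quotients of Phi(t, .) at 0 are holomorphic in t, and by [cdiff_quadratic] they
    converge to [a] uniformly in t. Separate holomorphy and boundedness are enough for this. *)
Lemma hol_partial (Phi : C -> C -> C) (a : C -> C) (r B : R) : 0 < r ->
  (forall t, cabs t < r -> hol_on (Phi t) 0 r) ->
  (forall s, cabs s < r -> hol_on (Phi^~ s) 0 r) ->
  (forall t s, cabs t < r -> cabs s < r -> cabs (Phi t s) <= B) ->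
  (forall t, cabs t < r -> cdiff (Phi t) 0 (a t)) -> hol_on a 0 r.
Proof.
move=> r0 h1 h2 PB Pa t0; rewrite subr0 => t0r.
have inr t : cabs (t - t0) < r - cabs t0 -> cabs t < r.
  by move=> tt; rewrite -(subrK t0 t); apply: le_lt_trans (cabsD _ _) _; rewrite -ltrBrDr.
have B0 : 0 <= B by apply: le_trans (cabs_ge0 (Phi 0 0)) (PB _ _ _ _); rewrite cabs0.
have PB0 t : cabs t < r -> forall s, cabs (s - 0) < r -> cabs (Phi t s) <= B.
  by move=> tr s; rewrite subr0; exact: PB.
apply: (@uniform_limit_cdiff a t0 (r - cabs t0) (16 * B / r)); first by rewrite subr_gt0.
  move=> t /inr tr; apply: (cder_bound (h1 _ tr) (PB0 _ tr) r0 _ (Pa t tr)).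
  by rewrite subrr cabs0 divr_gt0.
move=> e e0; pose K := 4096 * B / r ^+ 2.
have K0 : 0 <= K.
  apply: divr_ge0; last by rewrite exprn_ge0 ?ltW.
  by apply: mulr_ge0; [exact: ler0n|].
have K1 : 0 < K + 1 by rewrite ltr_wpDl.
(* [r / 8] keeps the increment in the range r / 4 of [cdiff_quadratic]; the quotient is then off by
   at most K * eta <= e. *)
pose eta := Num.min (r / 8) (e / (K + 1)).
have eta0 : 0 < eta by rewrite lt_min !divr_gt0.
have eta_r : eta < r / 4 by apply: le_lt_trans (_ : r / 8 < _); [rewrite ge_min lexx|lra].
have eta_e : K * eta <= e.
  apply: le_trans (_ : (K + 1) * eta <= e); first by rewrite ler_wpM2r ?(ltW eta0) // lerDl.
  by rewrite mulrC -ler_pdivlMr // ge_min lexx orbT.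
have ce : cabs (ofR eta : C) = eta by rewrite cabs_ofR gtr0_norm.
have en0 : (ofR eta : C) != 0 by rewrite -cabs_gt0 ce.
exists (fun t => (ofR eta)^-1 * (Phi t (ofR eta) - Phi t 0)).
  move=> t /inr tr.
  have er : cabs (ofR eta : C) < r by rewrite ce; lra.
  have zr : cabs (0 : C) < r by rewrite cabs0.
  have tr0 : cabs (t - 0) < r by rewrite subr0.
  have [m Hm] := h2 _ er _ tr0; have [m' Hm'] := h2 _ zr _ tr0.
  by exists ((ofR eta)^-1 * (m - m')); apply: cdiffZ; exact: cdiffB.
move=> t /inr tr; have er : cabs (ofR eta : C) < r / 4 by rewrite ce.
have := cdiff_quadratic (h1 _ tr) (PB0 _ tr) r0 er (Pa t tr).
rewrite add0r ce -/K => H; rewrite cabsC.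
rewrite (_ : _ - a t = (ofR eta)^-1 * (Phi t (ofR eta) - Phi t 0 - a t * ofR eta)); last first.
  by rewrite [RHS]mulrBr mulrCA mulVf // mulr1.
rewrite cabsM cabsV ce mulrC ler_pdivrMr //; apply: le_trans H _.
by rewrite expr2 mulrA ler_pM2r.
Qed.

Lemma hol_jet2 F (r B : R) : 0 < r -> hol_on F 0 r ->
  (forall t, cabs t < r -> cabs (F t) <= B) ->
  exists a1 a2, cdiff F 0 a1 /\ forall e, 0 < e -> exists2 d, 0 < d & forall t, cabs t < d ->
    cabs (F t - F 0 - a1 * t - a2 * t ^+ 2) <= e * cabs t ^+ 2.
Proof.
move=> r0 Fh FB.
have r20 : 0 < r / 2 by rewrite divr_gt0.
have [a Ha] : {a : C -> C & forall t, cabs t < r -> cdiff F t (a t)}.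
  apply: (@choice _ _ (fun t l => cabs t < r -> cdiff F t l)) => t.
  case: (pselect (cabs t < r)) => [tr|?]; last by exists 0.
  by have [|l Hl] := Fh t; [rewrite subr0|exists l].
have half t s : cabs t < r / 2 -> cabs s < r / 2 -> cabs (t + s) < r.
  by move=> tr sr; apply: le_lt_trans (cabsD _ _) _; rewrite (splitr r) ltrD.
have shift t s l : cdiff F (t + s) l -> cdiff (fun s => F (t + s)) s l.
  move=> Fl; have := cdiff_comp (cdiffD (cdiff_cst t s) (cdiff_id s)) Fl.
  by rewrite add0r mulr1.
(* F'(t) is the s-derivative of F(t + s) at s = 0, so holomorphy of F' is an instance of
   [hol_partial]. *)
have ah : hol_on a 0 (r / 2).
  apply: (@hol_partial (fun t s => F (t + s)) a (r / 2) B r20).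
  - move=> t tr s; rewrite subr0 => sr; exists (a (t + s)).
    by apply: shift; apply: Ha; exact: half.
  - move=> s sr t; rewrite subr0 => tr; exists (a (t + s)).
    rewrite (_ : (fun t => F (t + s)) = (fun t => F (s + t))); last by apply/funext => ?; rewrite addrC.
    by apply: shift; rewrite [s + t]addrC; apply: Ha; exact: half.
  - by move=> t s tr sr; apply: FB; exact: half.
  move=> t tr; apply: shift; rewrite addr0; apply: Ha; lra.
have [|l Hl] := ah 0; first by rewrite subrr cabs0.
exists (a 0), (l / 2); split; first by apply: Ha; rewrite cabs0.
move=> e e0; have e20 : 0 < e / 2 by rewrite divr_gt0.
have [d d0 Hd] := Hl _ e20.
exists (Num.min d r); first by rewrite lt_min d0.
move=> t; rewrite lt_min => /andP[td tr]; have tt := cabs_ge0 t.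
(* The derivative of this function is F'(z) - F'(0) - l z, which is o(|z|) because F' is
   differentiable at 0. *)
have := @cdiff_lip _ (fun z => F z - a 0 * z - l / 2 * (z * z)) 0 t (e / 2 * cabs t).
rewrite add0r (_ : _ - _ = F t - F 0 - a 0 * t - l / 2 * t ^+ 2); last by ring.
rewrite (_ : 2 * (e / 2 * _) * cabs t = e * cabs t ^+ 2); last by field.
apply => s /andP[s0 s1]; rewrite add0r.
have st : cabs (ofR s * t) <= cabs t.
  by rewrite cabsM cabs_ofR ger0_norm // -[leRHS]mul1r ler_wpM2r.
have := cdiffB (cdiffB (Ha _ (le_lt_trans st tr)) (cdiffZ (a 0) (cdiff_id _)))
  (cdiffZ (l / 2) (cdiffM (cdiff_id (ofR s * t)) (cdiff_id _))).
rewrite /= => H; eexists; first exact: H.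
rewrite (_ : _ - _ = a (0 + ofR s * t) - a 0 - l * (ofR s * t)); last by rewrite add0r; field.
apply: le_trans (Hd _ (le_lt_trans st td)) _; rewrite ler_wpM2l // divr_ge0 //; exact: ltW.
Qed.

End UniformLimits.

(** * Holomorphic maps in several variables *)

Section CoordinateNorm.
Variable R : realType.
Local Notation C := (Cx R).

(** A real-valued l^1 norm; [nbhs_nrmP] ties it to the topology, whose own norm is a supremum with
    values in [C]. *)
Definition nrm (n : nat) (v : 'rV[C]_n) : R := \sum_j cabs (v ord0 j).

Section Nrm.
Variable n : nat.
Implicit Types (u v : 'rV[C]_n).

Lemma nrm_ge0 v : 0 <= nrm v. Proof. by apply: sumr_ge0 => j _; exact: cabs_ge0. Qed.

Lemma coord_nrm v j : cabs (v ord0 j) <= nrm v.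
Proof. by rewrite /nrm (bigD1 j) //= lerDl sumr_ge0 // => k _; exact: cabs_ge0. Qed.

Lemma nrmD u v : nrm (u + v) <= nrm u + nrm v.
Proof. by rewrite /nrm -big_split; apply: ler_sum => j _; rewrite mxE cabsD. Qed.

Lemma nrmZ (a : C) v : nrm (a *: v) = cabs a * nrm v.
Proof. by rewrite /nrm mulr_sumr; apply: eq_bigr => j _; rewrite mxE cabsM. Qed.

Lemma nrmN v : nrm (- v) = nrm v.
Proof. by apply: eq_bigr => j _; rewrite mxE cabsN. Qed.

Lemma nrmB u v : nrm (u - v) <= nrm u + nrm v.
Proof. by rewrite -(nrmN v) nrmD. Qed.

Lemma nrm0 : nrm (0 : 'rV[C]_n) = 0.
Proof. by rewrite /nrm big1 // => j _; rewrite mxE cabs0. Qed.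

Lemma nrm_eq0 v : nrm v = 0 -> v = 0.
Proof.
move=> v0; apply/rowP => j; rewrite mxE; apply/eqP; rewrite -cabs_eq0.
by rewrite eq_le cabs_ge0 andbT -v0 coord_nrm.
Qed.

Lemma nrm_vec_e (k : 'I_n) : nrm (vec_e R k) = 1.
Proof.
rewrite /nrm (bigD1 k) //= /vec_e mxE !eqxx cabs1 big1 ?addr0 // => j jk.
by rewrite mxE (negPf jk) andbF cabs0.
Qed.

Lemma nbhs_nrmP (z : 'rV[C]_n) (A : set 'rV[C]_n) :
  nbhs z A <-> exists2 d : R, 0 < d & forall v, nrm v < d -> A (z + v).
Proof.
split => [/nbhs_ballP [e /= e0 eA]|[d d0 dA]].
  have eE : e = ofR (reC e) := esym (RRe_real (gtr0_real e0)).
  exists (reC e); first by rewrite -ltr_ofR -eE rmorph0.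
  move=> v ve; apply: eA; split => // i j; rewrite !ord1 /ball /= mxE opprD addNKr normrN.
  by rewrite -ofR_cabs eE ltr_ofR; apply: le_lt_trans ve; exact: coord_nrm.
(* [n.+1] rather than [n]: the sum of n coordinates stays strictly below d, and n may be 0. *)
apply/nbhs_ballP; exists (ofR (d / n.+1%:R)) => /=.
  by rewrite -(rmorph0 (@ofR R)) ltr_ofR divr_gt0.
move=> y [_ yb]; rewrite -(subrK z y) addrC; apply: dA.
have yj j : cabs ((y - z) ord0 j) <= d / n.+1%:R.
  have := yb ord0 j; rewrite /ball /= -ofR_cabs ltr_ofR cabsC !mxE; exact: ltW.
apply: le_lt_trans (ler_sum _ (fun j _ => yj j)) _.
rewrite sumr_const card_ord -[_ *+ _]mulr_natr mulrAC ltr_pdivrMr // ltr_pM2l // ltr_nat //.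
Qed.

Lemma mx_norm_le_nrm v : `|v| <= ofR (nrm v).
Proof.
have [->|v0] := eqVneq v 0; first by rewrite normr0 nrm0 rmorph0.
have /mx_norm_neq0 [[i j] /= E] : mx_norm v != 0.
  by apply: contra v0 => /eqP /mx_norm_eq0 ->.
rewrite -[`|v|]/(mx_norm v) E -ofR_cabs ler_ofR ord1; exact: coord_nrm.
Qed.

Lemma nrm_le_mx_norm v : ofR (nrm v) <= n%:R * `|v|.
Proof.
rewrite /nrm rmorph_sum /= -[n%:R * _](_ : \sum_(i < n) `|v| = _); last first.
  by rewrite sumr_const card_ord mulr_natl.
apply: ler_sum => j _; rewrite ofR_cabs -[`|v|]/(mx_norm v) mx_normE.
exact: (le_bigmax _ (fun i : 'I_1 * 'I_n => `|v i.1 i.2|%:nng) (ord0, j)).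
Qed.

Lemma rcontinuous_nrm (F : 'rV[C]_n -> R) z : {for z, continuous F} <->
  forall e : R, 0 < e -> exists2 d : R, 0 < d & forall v, nrm v < d -> `|F (z + v) - F z| < e.
Proof.
split => [Fc e e0|H].
  have /nbhs_nrmP [d d0 Hd] := Fc _ (nbhsx_ballx (F z) e e0).
  by exists d => // v /Hd; rewrite /ball /= distrC.
move=> A /nbhs_ballP [e /= e0 eA]; have [d d0 Hd] := H e e0.
by apply/nbhs_nrmP; exists d => // v /Hd h; apply: eA; rewrite /ball /= distrC.
Qed.

End Nrm.

Lemma nrm_mulmx m n (A : 'M[C]_(m, n)) : exists2 k : R, 0 <= k &
  forall v, nrm (v *m A) <= k * nrm v.
Proof.
exists (\sum_i \sum_j cabs (A i j)).
  by apply: sumr_ge0 => i _; apply: sumr_ge0 => j _; exact: cabs_ge0.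
move=> v; apply: le_trans (_ : \sum_j \sum_i cabs (A i j) * nrm v <= _); last first.
  by rewrite exchange_big mulr_suml; apply: ler_sum => i _; rewrite mulr_suml.
apply: ler_sum => j _; rewrite mxE; apply: le_trans (cabs_sum _ _ _) _.
by apply: ler_sum => i _; rewrite cabsM mulrC ler_wpM2l ?cabs_ge0 ?coord_nrm.
Qed.

Definition mdiff m n (F : 'rV[C]_m -> 'rV[C]_n) (a : 'rV[C]_m) (J : 'M[C]_(m, n)) :=
  forall e : R, 0 < e -> exists2 d : R, 0 < d & forall v, nrm v < d ->
    nrm (F (a + v) - F a - v *m J) <= e * nrm v.

Lemma differentiable_mdiff m n (F : 'rV[C]_m -> 'rV[C]_n) a :
  differentiable F a -> mdiff F a (jacobian F a).
Proof.
move=> /diff_locallyP [_ /eqaddoP H] e e0.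
have n0 : 0 < (n.+1%:R : R) by [].
have e0' : 0 < ofR (e / n.+1%:R) by rewrite -(rmorph0 (@ofR R)) ltr_ofR divr_gt0.
have /nbhs_nrmP [d d0 Hd] := H _ e0'; exists d => // v /Hd; rewrite add0r /= => {}Hd.
rewrite -ler_ofR; apply: le_trans (nrm_le_mx_norm _) _.
have -> : F (a + v) - F a - v *m jacobian F a = F (v + a) - (F a + 'd F a v).
  by rewrite /jacobian mul_rV_lin1 opprD addrA [v + a]addrC.
apply: le_trans (_ : n.+1%:R * `|F (v + a) - (F a + 'd F a v)| <= _).
  by rewrite ler_wpM2r // ler_nat.
apply: le_trans (ler_wpM2l (ler0n _ _) Hd) _.
apply: le_trans (ler_wpM2l (ler0n _ _) (ler_wpM2l (ltW e0') (mx_norm_le_nrm v))) _.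
rewrite -(rmorph_nat (@ofR R)) -!rmorphM /= ler_ofR mulrA [_ * (e / _)]mulrC divfK ?gt_eqF //.
Qed.

Section Mdiff.
Variables (m n p : nat).
Implicit Types (F : 'rV[C]_m -> 'rV[C]_n) (G : 'rV[C]_n -> 'rV[C]_p).

Lemma mdiff_lip F a J : mdiff F a J -> exists k d : R, [/\ 0 < k, 0 < d &
  forall v, nrm v < d -> nrm (F (a + v) - F a) <= k * nrm v].
Proof.
move=> /(_ 1 ltr01) [d d0 Hd]; have [k k0 Hk] := nrm_mulmx J.
exists (1 + k), d; split=> // [|v /Hd H]; first by rewrite ltr_pwDl.
rewrite -(subrK (v *m J) (F _ - _)); apply: le_trans (nrmD _ _) _.
by rewrite mulrDl; apply: lerD.
Qed.

Lemma mdiff_continuous F a J : mdiff F a J -> forall e, 0 < e -> exists2 d : R, 0 < d &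
  forall v, nrm v < d -> nrm (F (a + v) - F a) <= e.
Proof.
move=> /mdiff_lip [k [d [k0 d0 H]]] e e0.
exists (Num.min d (e / k)); first by rewrite lt_min d0 divr_gt0.
move=> v; rewrite lt_min => /andP[/H h]; rewrite ltr_pdivlMr // mulrC => /ltW.
exact: le_trans.
Qed.

Lemma mdiff_comp F G a J K : mdiff F a J -> mdiff G (F a) K -> mdiff (fun z => G (F z)) a (J *m K).
Proof.
move=> HF HG e e0; have [k [d [k0 d0 Hk]]] := mdiff_lip HF; have [l l0 Hl] := nrm_mulmx K.
have e1 : 0 < e / (2 * k) by rewrite divr_gt0 // mulr_gt0.
have l1 : 0 < l + 1 by rewrite ltr_wpDl.
have e2 : 0 < e / (2 * (l + 1)) by rewrite divr_gt0 // mulr_gt0.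
have [d1 d10 H1] := HG _ e1; have [d2 d20 H2] := HF _ e2.
exists (Num.min d (Num.min d2 (d1 / k))); first by rewrite !lt_min d0 d20 divr_gt0.
move=> v; rewrite !lt_min => /and3P[/Hk h1 /H2 h2]; rewrite ltr_pdivlMr // mulrC => h3.
have := H1 _ (le_lt_trans h1 h3); rewrite [F a + _]addrC subrK => h4.
rewrite (_ : _ - _ = G (F (a + v)) - G (F a) - (F (a + v) - F a) *m K
  + (F (a + v) - F a - v *m J) *m K); last first.
  by move: (F (a + v) - F a) => D; rewrite mulmxBl mulmxA addrA subrK.
apply: le_trans (nrmD _ _) _; rewrite (splitr e) mulrDl; apply: lerD.
  apply: le_trans h4 _; apply: le_trans (ler_wpM2l (ltW e1) h1) _.
  by rewrite mulrA invfM mulrA divfK ?gt_eqF.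
apply: le_trans (Hl _) _; apply: le_trans (ler_wpM2l l0 h2) _; rewrite mulrA ler_wpM2r ?nrm_ge0 //.
apply: le_trans (_ : (l + 1) * (e / (2 * (l + 1))) <= _).
  by rewrite ler_wpM2r ?(ltW e2) // lerDl.
by rewrite mulrC invfM mulrA divfK ?gt_eqF.
Qed.

Lemma mdiff_near F F' a J : mdiff F a J ->
  (exists2 d : R, 0 < d & forall v, nrm v < d -> F (a + v) = F' (a + v)) -> mdiff F' a J.
Proof.
move=> HF [d d0 FF'] e e0; have [d' d'0 H] := HF e e0.
exists (Num.min d d'); first by rewrite lt_min d0.
have E0 : F a = F' a by have := FF' 0; rewrite nrm0 addr0; apply.
by move=> v; rewrite lt_min -E0 => /andP[/FF' <- /H].
Qed.

Lemma mdiff_line F a v (t : C) J j : mdiff F (a + t *: v) J ->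
  cdiff (fun s => F (a + s *: v) ord0 j) t ((v *m J) ord0 j).
Proof.
move=> HF e e0; have k0 : 0 < nrm v + 1 by rewrite ltr_wpDl ?nrm_ge0.
have [d d0 H] := HF _ (divr_gt0 e0 k0); exists (d / (nrm v + 1)); first by rewrite divr_gt0.
move=> h; rewrite ltr_pdivlMr // => hd.
have hv : cabs h * nrm v <= cabs h * (nrm v + 1) by rewrite ler_wpM2l ?cabs_ge0 // lerDl.
have := H (h *: v); rewrite nrmZ => /(_ (le_lt_trans hv hd)) {}H.
have := le_trans (coord_nrm _ j) H.
rewrite (_ : a + t *: v + h *: v = a + (t + h) *: v) => [{}H|]; last by rewrite scalerDl addrA.
rewrite -scalemxAl in H; move: (v *m J) H => X; rewrite !mxE [h * _]mulrC => H.
apply: le_trans H _; apply: le_trans (ler_wpM2l (ltW (divr_gt0 e0 k0)) hv) _.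
by rewrite mulrCA divfK ?gt_eqF // mulrC.
Qed.

Lemma mdiff_uniq F a J K : mdiff F a J -> mdiff F a K -> J = K.
Proof.
move=> HJ HK; apply/matrixP => k j.
have h (L : 'M[C]_(m, n)) : mdiff F a L -> cdiff (fun s => F (a + s *: vec_e R k) ord0 j) 0 (L k j).
  move=> HL; have := @mdiff_line F a (vec_e R k) 0 L j; rewrite scale0r addr0 => /(_ HL).
  by rewrite -rowE mxE.
exact: cdiff_uniq (h _ HJ) (h _ HK).
Qed.

End Mdiff.

End CoordinateNorm.

Section SeveralVariables.
Variables (R : realType) (m n : nat).
Local Notation C := (Cx R).
Variables (F : 'rV[C]_m -> 'rV[C]_n) (J : 'rV[C]_m -> 'M[C]_(m, n)).
Variables (z0 : 'rV[C]_m) (rho : R).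
Hypothesis rho0 : 0 < rho.
Hypothesis FJ : forall v, nrm v < rho -> mdiff F (z0 + v) (J (z0 + v)).

Let z0J : mdiff F z0 (J z0).
Proof. by have := FJ (v := 0); rewrite nrm0 addr0; apply. Qed.

Lemma hol_bounded : exists2 d : R, 0 < d <= rho & exists B : R,
  forall v j, nrm v < d -> cabs (F (z0 + v) ord0 j) <= B.
Proof.
have [d d0 Hd] := mdiff_continuous z0J ltr01.
exists (Num.min d rho); first by rewrite lt_min d0 rho0 ge_min lexx orbT.
exists (1 + nrm (F z0)) => v j; rewrite lt_min => /andP[/Hd h _].
apply: le_trans (coord_nrm _ j) _; rewrite -(subrK (F z0) (F _)).
by apply: le_trans (nrmD _ _) _; apply: lerD.
Qed.

(** The (k, j) entry of J is the s-derivative at 0 of the j-th component of F(z0 + t u + s e_k), so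
    [hol_partial] makes it holomorphic in t. Radius and bound are uniform over directions of norm at
    most [k0], which [jacobian_continuous] relies on. *)
Lemma hol_line_entry (k0 : R) : 0 <= k0 -> exists2 r : R, 0 < r & exists A : R,
  forall u, nrm u <= k0 ->
  (forall k j, hol_on (fun t => J (z0 + t *: u) k j) 0 r /\
     forall t, cabs t < r -> cabs (J (z0 + t *: u) k j) <= A) /\
  (forall j, hol_on (fun t => F (z0 + t *: u) ord0 j) 0 r /\
     forall t, cabs t < r -> cabs (F (z0 + t *: u) ord0 j) <= A).
Proof.
move=> k00; have [d /andP[d0 drho] [B HB]] := hol_bounded.
have k1 : 0 < 2 * (k0 + 1) by rewrite mulr_gt0 // ltr_wpDl.
(* With [k0 + 1] both t u and s e_k have norm below d / 2, as [e_k] has norm 1. *)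
pose r := d / (2 * (k0 + 1)); have r0 : 0 < r by rewrite divr_gt0.
have rE : r * (k0 + 1) = d / 2 by rewrite /r; field; rewrite gt_eqF // ltr_wpDl.
exists r => //; exists (Num.max B (16 * B / r)) => u uk.
have in1 t : cabs t < r -> nrm (t *: u) < d / 2.
  move=> tr; rewrite nrmZ -rE; apply: le_lt_trans (_ : r * nrm u < _).
    by rewrite ler_wpM2r ?nrm_ge0 // ltW.
  by rewrite ltr_pM2l // (le_lt_trans uk) // ltrDl.
have in2 t s k : cabs t < r -> cabs s < r -> nrm (t *: u + s *: vec_e R k) < d.
  move=> tr sr; apply: le_lt_trans (nrmD _ _) _; rewrite [d]splitr ltrD ?in1 //.
  rewrite nrmZ nrm_vec_e mulr1 -rE (lt_le_trans sr) // -[leLHS]mulr1 ler_pM2l //.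
  by rewrite lerDr.
have d2 x : x < d / 2 -> x < rho by move=> xd; apply: lt_le_trans drho; lra.
split => [k j|j]; last first.
  split => [t|t tr]; last by rewrite le_max HB // (lt_trans (in1 t tr)) // ltr_pdivrMr // mulr_natr mulr2n ltrDl.
  rewrite subr0 => /in1/d2/FJ Ft; exists ((u *m J (z0 + t *: u)) ord0 j).
  exact: mdiff_line.
have cd t : cabs t < r -> cdiff (fun s => F (z0 + t *: u + s *: vec_e R k) ord0 j) 0 (J (z0 + t *: u) k j).
  move=> /in1/d2/FJ Ft; have := @mdiff_line _ _ _ F (z0 + t *: u) (vec_e R k) 0 (J (z0 + t *: u)) j.
  rewrite scale0r addr0 => /(_ Ft); by rewrite -rowE mxE.
have hs t : cabs t < r -> hol_on (fun s => F (z0 + t *: u + s *: vec_e R k) ord0 j) 0 r.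
  move=> tr s; rewrite subr0 => sr.
  have := FJ (lt_le_trans (in2 t s k tr sr) drho); rewrite addrA => /mdiff_line H.
  by exists ((vec_e R k *m J (z0 + t *: u + s *: vec_e R k)) ord0 j).
have bd t s : cabs t < r -> cabs s < r -> cabs (F (z0 + t *: u + s *: vec_e R k) ord0 j) <= B.
  by move=> tr sr; rewrite -addrA HB // in2.
split.
  apply: (@hol_partial R (fun t s => F (z0 + t *: u + s *: vec_e R k) ord0 j)
    (fun t => J (z0 + t *: u) k j) r B r0) => //.
  move=> s sr t; rewrite subr0 => tr.
  have := FJ (lt_le_trans (in2 t s k tr sr) drho).
  rewrite [t *: u + _]addrC addrA => /mdiff_line H.
  exists ((u *m J (z0 + s *: vec_e R k + t *: u)) ord0 j).
  rewrite (_ : (fun t => F (z0 + t *: u + s *: vec_e R k) ord0 j) =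
    (fun t => F (z0 + s *: vec_e R k + t *: u) ord0 j)) //.
  by apply/funext => x; rewrite addrAC.
move=> t tr; rewrite le_max; apply/orP; right.
apply: (cder_bound (hs t tr) _ r0 _ (cd t tr)); last by rewrite subrr cabs0 divr_gt0.
by move=> s; rewrite subr0; exact: bd.
Qed.

Lemma hol_line_jacobian_jet v k j : exists a1 a2 : C, forall e : R, 0 < e -> exists2 d : R, 0 < d &
  forall t : C, cabs t < d ->
  cabs (J (z0 + t *: v) k j - J z0 k j - a1 * t - a2 * t ^+ 2) <= e * cabs t ^+ 2.
Proof.
have [r r0 [A /(_ v (lexx _)) [/(_ k j) [h1 h2] _]]] := hol_line_entry (nrm_ge0 v).
have [a1 [a2 [_ H]]] := hol_jet2 r0 h1 h2; exists a1, a2 => e /H.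
by rewrite scale0r addr0.
Qed.

Lemma hol_line_jet v j : exists a2 : C, forall e : R, 0 < e -> exists2 d : R, 0 < d &
  forall t : C, cabs t < d ->
  cabs (F (z0 + t *: v) ord0 j - F z0 ord0 j - (v *m J z0) ord0 j * t - a2 * t ^+ 2) <= e * cabs t ^+ 2.
Proof.
have [r r0 [A /(_ v (lexx _)) [_ /(_ j) [h1 h2]]]] := hol_line_entry (nrm_ge0 v).
have [a1 [a2 [h H]]] := hol_jet2 r0 h1 h2; exists a2 => e /H.
have -> : a1 = (v *m J z0) ord0 j.
  by apply: cdiff_uniq h _; apply: mdiff_line; rewrite scale0r addr0.
by rewrite scale0r addr0.
Qed.

(** On all complex lines through z0 in directions of norm at most 1, the entries of J are Lipschitz
    near 0 with one and the same constant. *)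
Lemma jacobian_continuous e : 0 < e -> exists2 d : R, 0 < d &
  forall v, nrm v < d -> forall k j, cabs (J (z0 + v) k j - J z0 k j) <= e.
Proof.
move=> e0; have [r r0 [A H]] := hol_line_entry ler01.
have A0 : 0 <= Num.max 0 A by rewrite le_max lexx.
set A' := Num.max 0 A in A0.
have c0 : 0 < 2 * (16 * A' / r) + 1.
  apply: ltr_wpDl => //; apply: mulr_ge0; first exact: ler0n.
  by apply: divr_ge0; [apply: mulr_ge0; [exact: ler0n|]|exact: ltW].
exists (Num.min (r / 2) (e / (2 * (16 * A' / r) + 1))); first by rewrite lt_min; apply/andP; split; exact: divr_gt0.
move=> v; rewrite lt_min => /andP[vr]; rewrite ltr_pdivlMr // => ve k j.
have [->|v0] := eqVneq v 0; first by rewrite addr0 subrr cabs0 ltW.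
have nv : 0 < nrm v.
  by rewrite lt_def nrm_ge0 andbT; apply: contra v0 => /eqP /nrm_eq0 ->.
pose u := (ofR (nrm v))^-1 *: v.
have cv : cabs (ofR (nrm v) : C) = nrm v by rewrite cabs_ofR gtr0_norm.
have u1 : nrm u <= 1 by rewrite nrmZ cabsV cv mulVf // gt_eqF.
have vE : v = ofR (nrm v) *: u.
  by rewrite scalerA divff ?scale1r // -cabs_gt0 cv.
have [/(_ k j) [h1 h2] _] := H u u1.
have := @cdiff_lip R (fun t => J (z0 + t *: u) k j) 0 (ofR (nrm v)) (16 * A' / r).
rewrite add0r -vE scale0r addr0 cv => L; apply: le_trans (L _) _; last first.
  by apply: ltW; apply: le_lt_trans ve; rewrite mulrC ler_wpM2l ?(ltW nv) // lerDl.
move=> t /andP[t0 t1]; have tr : cabs (ofR t * ofR (nrm v) : C) < r / 2.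
  rewrite cabsM cv cabs_ofR ger0_norm //; apply: le_lt_trans vr.
  by rewrite -[leRHS]mul1r ler_wpM2r // ltW.
have [|l Hl] := h1 (0 + ofR t * ofR (nrm v)); first by rewrite subr0 add0r; lra.
exists l => //; apply: (cder_bound h1 _ r0 _ Hl); last by rewrite subr0 add0r.
by move=> w; rewrite subr0 => /h2 h; apply: le_trans h _; rewrite /A' le_max lexx orbT.
Qed.

End SeveralVariables.

(** * Smooth functions along real curves *)

Section SmoothReal.
Variables (R : realType) (n : nat).
Local Notation C := (Cx R).
Local Notation V := ('rV[Cx R]_n).
Implicit Types (F : V -> R) (A : set V) (z u v : V).

Definition real_coord v (p : 'I_n * bool) : R :=
  if p.2 then imC (v ord0 p.1) else reC (v ord0 p.1).

Lemma real_coordE v : v = \sum_p ofR (real_coord v p) *: real_frame R p.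
Proof.
rewrite big_pair_bool /= [LHS]row_sum_delta; apply: eq_bigr => k _.
rewrite /real_coord /real_frame /vec_e /= scalerA -scalerDl {1}[v ord0 k]CxE.
by rewrite [_ * 'i]mulrC.
Qed.

Lemma real_coord_le v p : `|real_coord v p| <= cabs (v ord0 p.1).
Proof. by rewrite /real_coord; case: p.2; rewrite ?abs_imC ?abs_reC. Qed.

Lemma sum_real_coord_le v : \sum_p `|real_coord v p| <= 2 * nrm v.
Proof.
rewrite big_pair_bool /= /nrm mulr_sumr; apply: ler_sum => k _.
by rewrite mulr_natl mulr2n lerD // real_coord_le.
Qed.

Lemma nrm_real_frame p : nrm (real_frame R p : V) = 1.
Proof. by rewrite /real_frame; case: p.2; rewrite ?nrmZ ?cabs_i ?mul1r nrm_vec_e. Qed.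

Lemma smooth_rderiv A F v : smooth_on A F -> smooth_on A (rderiv v F).
Proof. by move=> FS s z Az; have := FS (rcons s v) z Az; rewrite foldr_rcons. Qed.

Lemma smooth_line A F z v (t : R) : smooth_on A F -> A (z + ofR t *: v) ->
  has_rder (fun t => F (z + ofR t *: v)) t (rderiv v F (z + ofR t *: v)).
Proof.
move=> FS At; have [_ /(_ v) D] := FS [::] _ At.
have H : has_rder (rline F (z + ofR t *: v) v) 0 (rderiv v F (z + ofR t *: v)).
  by apply/has_rderP; rewrite /rderiv derive1E; exact: derivableP.
move=> e e0; have [d d0 Hd] := H e e0; exists d; first exact: d0.
move=> h hd; have := Hd h hd.
rewrite /rline add0r rmorph0 scale0r addr0.
rewrite (_ : z + ofR t *: v + ofR h *: v = z + ofR (t + h) *: v); first exact.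
by rewrite rmorphD scalerDl addrA.
Qed.

Lemma smooth_cont A F z : smooth_on A F -> A z -> {for z, continuous F}.
Proof. by move=> FS /(FS [::]) []. Qed.

Lemma rder_mvt0 (f g : R -> R) (c : R) :
  (forall t, `|t| <= `|c| -> has_rder f t (g t)) ->
  exists2 t, `|t| <= `|c| & f c - f 0 = g t * c.
Proof.
move=> H; case: (leP 0 c) => c0.
  have [t /andP[t0 tc] E|t /andP[t0 tc] E] := @rder_mvt R f g 0 c c0.
    by apply: H; rewrite !ger0_norm.
  by exists t; [rewrite !ger0_norm|rewrite E subr0].
have [t /andP[t0 tc] E|t /andP[t0 tc] E] := @rder_mvt R f g c 0 (ltW c0).
  by apply: H; rewrite !ler0_norm ?(ltW c0) // lerN2.
exists t; first by rewrite !ler0_norm ?(ltW c0) // lerN2.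
by rewrite -opprB E; ring.
Qed.

Definition rdiff F z v := \sum_p real_coord v p * rderiv (real_frame R p) F z.

(** Continuity of the partial derivatives gives strict differentiability, with both points moving.
    That form is what compares F on a curve with F on its tangent line with error o(t^2). *)
Lemma smooth_strict A F z : open A -> smooth_on A F -> A z ->
  forall e, 0 < e -> exists2 d : R, 0 < d & forall x y, nrm (x - z) < d -> nrm (y - z) < d ->
  `|F x - F y - rdiff F z (x - y)| <= e * nrm (x - y).
Proof.
move=> Ao FS Az e e0; have e20 : 0 < e / 2 by rewrite divr_gt0.
have /nbhs_nrmP [d0 d00 dA] : nbhs z A by exact: open_nbhs_nbhs.
have dp p : {d : R | 0 < d /\ forall v, nrm v < d ->
    `|rderiv (real_frame R p) F (z + v) - rderiv (real_frame R p) F z| < e / 2}.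
  apply: cid; have := smooth_cont (smooth_rderiv (real_frame R p) FS) Az.
  by move=> /rcontinuous_nrm /(_ _ e20) [d]; exists d.
pose d := \big[Num.min/d0]_p sval (dp p).
have d0' : 0 < d by apply: lt_bigmin => // p _; case: (svalP (dp p)).
have dd0 : d <= d0 by rewrite bigmin_le_id.
have dpp p : d <= sval (dp p) by apply: bigmin_le_cond.
(* From y to x one coordinate at a time, with the mean value theorem at each step. *)
have tele (c : 'I_n * bool -> R) (r : seq ('I_n * bool)) y :
    nrm (y - z) + \sum_(p <- r) `|c p| < d ->
    `|F (y + \sum_(p <- r) ofR (c p) *: real_frame R p) - F y
       - \sum_(p <- r) c p * rderiv (real_frame R p) F z| <= e / 2 * \sum_(p <- r) `|c p|.
  elim: r y => [|p r IH] y; first by rewrite !big_nil mulr0 (addr0 y) subr0 (subrr (F y)) normr0.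
  rewrite !big_cons => yd; set b := real_frame R p.
  have S0 : 0 <= \sum_(p <- r) `|c p| by apply: sumr_ge0.
  have nb t : nrm (y + ofR t *: b - z) <= nrm (y - z) + `|t|.
    by rewrite addrAC (le_trans (nrmD _ _)) // nrmZ cabs_ofR nrm_real_frame mulr1.
  have IHy := IH (y + ofR (c p) *: b).
  have ind : nrm (y + ofR (c p) *: b - z) + \sum_(p <- r) `|c p| < d.
    by apply: le_lt_trans yd; rewrite addrA lerD2r nb.
  have ptd t : `|t| <= `|c p| -> nrm (y + ofR t *: b - z) < d.
    move=> tc; apply: le_lt_trans (nb t) _; apply: le_lt_trans yd.
    by rewrite lerD2l; apply: le_trans tc _; rewrite lerDl.
  have [t|t tc E] := @rder_mvt0 (fun t => F (y + ofR t *: b)) (fun t => rderiv b F (y + ofR t *: b)) (c p).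
    move=> tc; apply: smooth_line FS _.
    rewrite -(subrK z (y + _)) addrC; apply: dA; apply: lt_le_trans dd0; exact: ptd.
  have [_ /(_ (y + ofR t *: b - z)) Hp] := svalP (dp p).
  have {}Hp := Hp (lt_le_trans (ptd t tc) (dpp p)).
  rewrite [z + _]addrC subrK -/b in Hp.
  rewrite rmorph0 scale0r addr0 in E.
  rewrite (_ : _ - _ = (F (y + ofR (c p) *: b + \sum_(j <- r) ofR (c j) *: real_frame R j)
      - F (y + ofR (c p) *: b) - \sum_(p <- r) c p * rderiv (real_frame R p) F z)
    + (rderiv b F (y + ofR t *: b) - rderiv b F z) * c p); last first.
    by rewrite mulrBl -E addrA; ring.
  apply: le_trans (ler_normD _ _) _; rewrite mulrDr addrC; apply: lerD; last exact: IHy.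
  by rewrite normrM ler_wpM2r // ltW.
(* The path starts within d / 5 of z, and its length is at most 2 nrm (x - y) < 4 d / 5. *)
exists (d / 5); first by rewrite divr_gt0.
move=> x y xd yd; have xy : nrm (x - y) < 2 * (d / 5).
  rewrite (_ : x - y = x - z - (y - z)); last by rewrite opprB addrA subrK.
  by apply: le_lt_trans (nrmB _ _) _; rewrite mulr_natl mulr2n ltrD.
have := tele (real_coord (x - y)) (index_enum ('I_n * bool)%type) y.
rewrite -real_coordE (_ : y + (x - y) = x); last by rewrite addrC subrK.
move=> T.
have S2 := sum_real_coord_le (x - y).
apply: le_trans (T _) _; first lra.
by apply: le_trans (ler_wpM2l (ltW e20) S2) _; rewrite mulrA divfK.
Qed.

Lemma rdiff_rderiv A F z v : open A -> smooth_on A F -> A z -> rderiv v F z = rdiff F z v.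
Proof.
move=> Ao FS Az; have := @smooth_line A F z v 0 FS; rewrite rmorph0 scale0r addr0 => /(_ Az) H.
apply: has_rder_uniq H _ => e e0.
have k0 : 0 < nrm v + 1 by rewrite ltr_wpDl ?nrm_ge0.
have [d d0 Hd] := smooth_strict Ao FS Az (divr_gt0 e0 k0).
exists (d / (nrm v + 1)); first by rewrite divr_gt0.
move=> h; rewrite ltr_pdivlMr // => hd.
have hv : nrm (ofR h *: v) <= `|h| * (nrm v + 1) by rewrite nrmZ cabs_ofR ler_wpM2l // lerDl.
have := Hd (z + ofR h *: v) z; rewrite subrr nrm0 [z + _ - z]addrC addKr.
move=> /(_ (le_lt_trans hv hd) d0) {}Hd; rewrite add0r rmorph0 scale0r addr0.
rewrite (_ : rdiff F z v * h = rdiff F z (ofR h *: v)); last first.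
  rewrite /rdiff mulr_suml; apply: eq_bigr => p _; rewrite mulrAC; congr (_ * _).
  by rewrite /real_coord; case: p.2; rewrite mxE ?imCZ ?reCZ mulrC.
apply: le_trans Hd _; apply: le_trans (ler_wpM2l (ltW (divr_gt0 e0 k0)) hv) _.
by rewrite mulrCA divfK ?gt_eqF // mulrC.
Qed.

Lemma rdiffD F z u v : rdiff F z (u + v) = rdiff F z u + rdiff F z v.
Proof.
rewrite /rdiff -big_split; apply: eq_bigr => p _ /=; rewrite -mulrDl; congr (_ * _).
by rewrite /real_coord; case: p.2; rewrite mxE ?imCD ?reCD.
Qed.

Lemma rdiffZ F z (a : R) v : rdiff F z (ofR a *: v) = a * rdiff F z v.
Proof.
rewrite /rdiff mulr_sumr; apply: eq_bigr => p _ /=; rewrite mulrA; congr (_ * _).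
by rewrite /real_coord; case: p.2; rewrite mxE ?imCZ ?reCZ.
Qed.

Lemma rdiff_bound F z : exists2 k : R, 0 <= k & forall v, `|rdiff F z v| <= k * nrm v.
Proof.
exists (\sum_(p : 'I_n * bool) `|rderiv (real_frame R p) F z|); first exact: sumr_ge0.
move=> v; apply: le_trans (ler_norm_sum _ _ _) _; rewrite mulr_suml; apply: ler_sum => p _.
rewrite normrM mulrC ler_wpM2l //; apply: le_trans (real_coord_le v p) _; exact: coord_nrm.
Qed.

(** The mean value theorem for F minus its quadratic polynomial, whose derivative is o(s). *)
Lemma smooth_peano A F z v : open A -> smooth_on A F -> A z ->
  forall e, 0 < e -> exists2 d : R, 0 < d & forall t : R, `|t| < d ->
  `|F (z + ofR t *: v) - F z - rderiv v F z * t - rderiv v (rderiv v F) z / 2 * t ^+ 2| <= e * t ^+ 2.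
Proof.
move=> Ao FS Az e e0.
have /nbhs_nrmP [d0 d00 dA] : nbhs z A by exact: open_nbhs_nbhs.
have H2 := @smooth_line A (rderiv v F) z v 0 (smooth_rderiv v FS).
rewrite rmorph0 scale0r addr0 in H2; have [d1 d10 Hd1] := H2 Az e e0.
have k0 : 0 < nrm v + 1 by rewrite ltr_wpDl ?nrm_ge0.
exists (Num.min d1 (d0 / (nrm v + 1))); first by rewrite lt_min d10 divr_gt0.
move=> t; rewrite lt_min => /andP[td1]; rewrite ltr_pdivlMr // => td0.
have inA s : `|s| <= `|t| -> A (z + ofR s *: v).
  move=> st; apply: dA; apply: le_lt_trans td0; rewrite nrmZ cabs_ofR.
  by apply: ler_pM; rewrite ?nrm_ge0 // lerDl.
set a := rderiv v F z; set b := rderiv v (rderiv v F) z.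
have dpoly s : has_rder (fun s => a * s + b / 2 * s ^+ 2) s (a + b * s).
  move=> e' e0'; exists (e' / (`|b| + 1)); first by rewrite divr_gt0 // ltr_wpDl.
  move=> h; rewrite ltr_pdivlMr ?ltr_wpDl // => he.
  rewrite (_ : _ - _ = b / 2 * h * h); last by field.
  rewrite normrM ler_wpM2r // normrM; apply: le_trans (ltW he); rewrite mulrC ler_wpM2l //.
  by rewrite normrM normfV [`|2|]ger0_norm // ler_pdivrMr //; have := normr_ge0 b; lra.
have [s|s st] := @rder_mvt0 (fun s => F (z + ofR s *: v) - (a * s + b / 2 * s ^+ 2))
   (fun s => rderiv v F (z + ofR s *: v) - (a + b * s)) t.
  by move=> st; apply: has_rderB => //; apply: smooth_line FS _; exact: inA.
rewrite rmorph0 scale0r addr0 expr0n mulr0 mulr0 addr0 subr0 => E.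
rewrite (_ : _ - _ = F (z + ofR t *: v) - (a * t + b / 2 * t ^+ 2) - F z); last by ring.
rewrite E normrM -[t ^+ 2]ger0_norm ?sqr_ge0 // normrX expr2 mulrA ler_wpM2r //.
have h := Hd1 s (le_lt_trans st td1); rewrite add0r rmorph0 scale0r addr0 -/a -/b in h.
move: (rderiv v F (z + ofR s *: v)) h => D h.
by rewrite opprD addrA; apply: le_trans h _; rewrite ler_pM2l.
Qed.

(** Passes through the point z + t u: the Peano expansion along the line, then strict
    differentiability across a gap of size O(t^2). *)
Lemma smooth_curve_jet A F z u q (w : R -> V) : open A -> smooth_on A F -> A z ->
  (forall e, 0 < e -> exists2 d : R, 0 < d & forall t : R, `|t| < d ->
     nrm (w t - z - ofR t *: u - ofR (t ^+ 2) *: q) <= e * t ^+ 2) ->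
  forall e, 0 < e -> exists2 d : R, 0 < d & forall t : R, `|t| < d ->
  `|F (w t) - F z - rderiv u F z * t - (rderiv u (rderiv u F) z / 2 + rdiff F z q) * t ^+ 2| <= e * t ^+ 2.
Proof.
move=> Ao FS Az wq e e0.
have e20 : 0 < e / 2 by rewrite divr_gt0.
have [d1 d10 H1] := smooth_peano u Ao FS Az e20.
have [k k0 Hk] := rdiff_bound F z.
(* The curve stays within [t ^+ 2 * Q] of its tangent line, the 1 covering the remainder. Half of
   [e] pays for the Peano term and a quarter for each of the other two. *)
pose Q := nrm q + 1; have Q0 : 0 < Q by rewrite ltr_wpDl ?nrm_ge0.
have e3 : 0 < e / (4 * Q) by rewrite divr_gt0 // mulr_gt0.
have [d2 d20 H2] := smooth_strict Ao FS Az e3.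
have k1 : 0 < 4 * (k + 1) by rewrite mulr_gt0 // ltr_wpDl.
have e4 : 0 < Num.min 1 (e / (4 * (k + 1))) by rewrite lt_min ltr01 divr_gt0.
have [d3 d30 H3] := wq _ e4.
have n1 : 0 < nrm u + Q by rewrite ltr_wpDl ?nrm_ge0.
exists (Num.min (Num.min d1 d3) (Num.min 1 (d2 / (nrm u + Q)))).
  by rewrite !lt_min d10 d30 ltr01 divr_gt0.
move=> t; rewrite !lt_min => /andP[/andP[/H1 h1 /H3 h3] /andP[t1]]; rewrite ltr_pdivlMr // => t2.
set r := w t - z - ofR t *: u - ofR (t ^+ 2) *: q in h3.
have t20 : 0 <= t ^+ 2 := sqr_ge0 t.
have tt : t ^+ 2 <= `|t|.
  by rewrite -[t ^+ 2]ger0_norm // normrX expr2 -[leRHS]mul1r ler_wpM2r // ltW.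
have r1 : nrm r <= t ^+ 2.
  by apply: le_trans h3 _; rewrite -[leRHS]mul1r ler_wpM2r // ge_min lexx.
have r2 : nrm r <= e / (4 * (k + 1)) * t ^+ 2.
  by apply: le_trans h3 _; rewrite ler_wpM2r // ge_min lexx orbT.
have wE : w t - (z + ofR t *: u) = ofR (t ^+ 2) *: q + r.
  by rewrite /r [RHS]addrC subrK opprD addrA.
have wn : nrm (w t - (z + ofR t *: u)) <= t ^+ 2 * Q.
  rewrite wE; apply: le_trans (nrmD _ _) _; rewrite nrmZ cabs_ofR ger0_norm // /Q mulrDr mulr1.
  by apply: lerD.
have xu : nrm (z + ofR t *: u - z) <= `|t| * nrm u.
  by rewrite addrAC subrr add0r nrmZ cabs_ofR.
have xw : nrm (w t - z) <= `|t| * (nrm u + Q).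
  rewrite (_ : w t - z = (z + ofR t *: u - z) + (w t - (z + ofR t *: u))); last first.
    by rewrite [RHS]addrC addrA subrK.
  rewrite mulrDr; apply: le_trans (nrmD _ _) _; apply: lerD => //.
  by apply: le_trans wn _; rewrite ler_wpM2r // ltW.
have uu : `|t| * nrm u < d2.
  by apply: le_lt_trans t2; rewrite ler_wpM2l // lerDl ltW.
have h2 := H2 _ _ (le_lt_trans xw t2) (le_lt_trans xu uu).
rewrite wE rdiffD rdiffZ -wE in h2.
have hr := Hk r.
rewrite (_ : _ - _ = (F (z + ofR t *: u) - F z - rderiv u F z * t - rderiv u (rderiv u F) z / 2 * t ^+ 2)
   + ((F (w t) - F (z + ofR t *: u) - (t ^+ 2 * rdiff F z q + rdiff F z r)) + rdiff F z r)); last by ring.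
apply: le_trans (ler_normD _ _) _; rewrite (splitr e) mulrDl; apply: lerD => //.
apply: le_trans (ler_normD _ _) _; rewrite (_ : e / 2 = e / 4 + e / 4); last by field.
rewrite mulrDl; apply: lerD.
  apply: le_trans h2 _; apply: le_trans (ler_wpM2l (ltW e3) wn) _.
  rewrite (_ : e / (4 * Q) * (t ^+ 2 * Q) = e / 4 * t ^+ 2) //.
  by field; rewrite gt_eqF.
apply: le_trans hr _; apply: le_trans (ler_wpM2l k0 r2) _; rewrite mulrA ler_wpM2r //.
apply: le_trans (_ : (k + 1) * (e / (4 * (k + 1))) <= _).
  by rewrite ler_wpM2r ?lerDl // ltW // divr_gt0.
by rewrite le_eqVlt; apply/orP; left; apply/eqP; field; rewrite gt_eqF // ltr_wpDl.
Qed.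

End SmoothReal.

(** * Wirtinger derivatives in terms of real directional derivatives *)

Section ComplexLineDerivative.
Variables (R : realType) (n : nat).
Local Notation C := (Cx R).
Local Notation V := ('rV[Cx R]_n).
Implicit Types (F G : V -> C) (A : set V) (z u v : V).

Definition has_cder F z v (l : C) := forall e : R, 0 < e -> exists2 d : R, 0 < d &
  forall h : R, `|h| < d -> cabs (F (z + ofR h *: v) - F z - l * ofR h) <= e * `|h|.

Lemma has_cder_cderiv F z v l : has_cder F z v l -> cderiv v F z = l.
Proof.
move=> H.
have key (f : C -> R) : (forall x y, f (x - y) = f x - f y) -> (forall x y, f (x * ofR y) = f x * y) ->
   (forall x, `|f x| <= cabs x) -> rderiv v (fun y => f (F y)) z = f l.
  move=> fB fZ fc; have D : has_rder (rline (fun y => f (F y)) z v) 0 (f l).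
    move=> e e0; have [d d0 Hd] := H e e0; exists d; first exact: d0.
    move=> h hd; have := Hd h hd; rewrite /rline add0r rmorph0 scale0r addr0 -fB -fZ -fB.
    by apply: le_trans; exact: fc.
  by move: D => /has_rderP [_ <-]; rewrite /rderiv derive1E.
rewrite /cderiv [in RHS](CxE l); congr (ofR _ + 'i * ofR _); apply: key.
- exact: reCB.
- by move=> x y; rewrite mulrC reCZ mulrC.
- exact: abs_reC.
- exact: imCB.
- by move=> x y; rewrite mulrC imCZ mulrC.
exact: abs_imC.
Qed.

Lemma csmooth_has_cder A F z v : csmooth_on A F -> A z -> has_cder F z v (cderiv v F z).
Proof.
move=> [FR FI] Az e e0; have e20 : 0 < e / 2 by rewrite divr_gt0.
have HR := @smooth_line R n A _ z v 0 FR; rewrite rmorph0 scale0r addr0 in HR.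
have HI := @smooth_line R n A _ z v 0 FI; rewrite rmorph0 scale0r addr0 in HI.
have [d d0 H] := HR Az _ e20; have [d' d0' H'] := HI Az _ e20.
exists (Num.min d d'); first by rewrite lt_min d0.
move=> h; rewrite lt_min => /andP[/H h1 /H' h2].
rewrite add0r rmorph0 scale0r addr0 /= in h1; rewrite add0r rmorph0 scale0r addr0 /= in h2.
have -> : e * `|h| = e / 2 * `|h| + e / 2 * `|h| by rewrite -mulrDl -splitr.
apply: le_trans (cabs_le _) _.
have reE : reC (cderiv v F z) = rderiv v (fun y => reC (F y)) z.
  by rewrite /cderiv reCD reCM reC_i imC_i !reC_ofR !imC_ofR mul0r mulr0 subr0 addr0.
have imE : imC (cderiv v F z) = rderiv v (fun y => imC (F y)) z.
  by rewrite /cderiv imCD imCM reC_i imC_i !reC_ofR !imC_ofR mulr0 mul1r !add0r.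
move: (cderiv v F z) reE imE => D reE imE; rewrite [D * _]mulrC.
rewrite reCB imCB reCB imCB reCZ imCZ reE imE ![h * _]mulrC.
exact: lerD.
Qed.

Lemma reC_cderiv v F : (fun y => reC (cderiv v F y)) = rderiv v (fun y => reC (F y)).
Proof.
apply/funext => z; rewrite /cderiv reCD reCM reC_i imC_i !reC_ofR !imC_ofR.
by rewrite mul0r mulr0 subr0 addr0.
Qed.

Lemma imC_cderiv v F : (fun y => imC (cderiv v F y)) = rderiv v (fun y => imC (F y)).
Proof.
apply/funext => z; rewrite /cderiv imCD imCM reC_i imC_i !reC_ofR !imC_ofR.
by rewrite mulr0 mul1r !add0r.
Qed.

Lemma csmooth_cderiv A F v : csmooth_on A F -> csmooth_on A (cderiv v F).
Proof.
move=> [FR FI]; split.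
  by have := smooth_rderiv v FR; rewrite -reC_cderiv.
by have := smooth_rderiv v FI; rewrite -imC_cderiv.
Qed.

Lemma has_cderD F G z v a b : has_cder F z v a -> has_cder G z v b ->
  has_cder (fun y => F y + G y) z v (a + b).
Proof.
move=> HF HG e e0; have e2 : 0 < e / 2 by rewrite divr_gt0.
have [d d0 Hd] := HF _ e2; have [d' d0' Hd'] := HG _ e2.
exists (Num.min d d'); first by rewrite lt_min d0.
move=> h; rewrite lt_min => /andP[/Hd h1 /Hd' h2].
rewrite (_ : _ - _ = F (z + ofR h *: v) - F z - a * ofR h + (G (z + ofR h *: v) - G z - b * ofR h)); last by ring.
by apply: le_trans (cabsD _ _) _; rewrite (splitr e) mulrDl lerD.
Qed.

Lemma has_cderZ F z v a (k : C) : has_cder F z v a -> has_cder (fun y => k * F y) z v (k * a).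
Proof.
move=> HF e e0; have k0 : 0 < cabs k + 1 by rewrite ltr_wpDl ?cabs_ge0.
have [d d0 Hd] := HF _ (divr_gt0 e0 k0); exists d; first exact: d0.
move=> h /Hd H.
rewrite (_ : _ - _ = k * (F (z + ofR h *: v) - F z - a * ofR h)); last by ring.
rewrite cabsM; apply: le_trans (ler_wpM2l (cabs_ge0 _) H) _; rewrite mulrA ler_wpM2r //.
apply: le_trans (_ : (cabs k + 1) * (e / (cabs k + 1)) <= _).
  by rewrite ler_wpM2r ?lerDl // ltW // divr_gt0.
by rewrite mulrC divfK ?gt_eqF.
Qed.

Lemma has_cder_sum (I : finType) (G : I -> V -> C) (k a : I -> C) z v :
  (forall i, has_cder (G i) z v (a i)) ->
  has_cder (fun y => \sum_i k i * G i y) z v (\sum_i k i * a i).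
Proof.
move=> H; elim: (index_enum I) => [|i r IH].
  under eq_fun do rewrite big_nil; rewrite big_nil => e e0; exists 1 => // h _.
  by rewrite subrr mul0r subrr cabs0 mulr_ge0 // ltW.
under eq_fun do rewrite big_cons; rewrite big_cons.
exact: (has_cderD (has_cderZ (k i) (H i)) IH).
Qed.

Lemma has_cderJ F z v a : has_cder F z v a -> has_cder (fun y => (F y)^*) z v a^*.
Proof.
move=> HF e /HF [d d0 Hd]; exists d; first exact: d0.
by move=> h /Hd; rewrite -cabsJ !rmorphB rmorphM /= conj_ofR.
Qed.

Lemma has_cder_near A F G z v a : open A -> A z -> (forall y, A y -> F y = G y) ->
  has_cder F z v a -> has_cder G z v a.
Proof.
move=> Ao Az FG HF e e0; have [d d0 Hd] := HF e e0.
have /nbhs_nrmP [d' d'0 dA] : nbhs z A by exact: open_nbhs_nbhs.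
have k0 : 0 < nrm v + 1 by rewrite ltr_wpDl ?nrm_ge0.
exists (Num.min d (d' / (nrm v + 1))); first by rewrite lt_min d0 divr_gt0.
move=> h; rewrite lt_min => /andP[/Hd H]; rewrite ltr_pdivlMr // => hd.
rewrite -!FG //; apply: dA; apply: le_lt_trans hd.
by rewrite nrmZ cabs_ofR ler_wpM2l // lerDl.
Qed.

Lemma cderiv_near A F G z v : open A -> csmooth_on A F -> A z -> (forall y, A y -> F y = G y) ->
  cderiv v G z = cderiv v F z.
Proof.
move=> Ao FS Az FG; apply: has_cder_cderiv.
exact: (has_cder_near Ao Az FG (csmooth_has_cder v FS Az)).
Qed.

Lemma cderiv_frame A F z v : open A -> csmooth_on A F -> A z ->
  cderiv v F z = \sum_p ofR (real_coord v p) * cderiv (real_frame R p) F z.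
Proof.
move=> Ao [FR FI] Az; rewrite /cderiv (rdiff_rderiv v Ao FR Az) (rdiff_rderiv v Ao FI Az).
rewrite /rdiff !rmorph_sum mulr_sumr -big_split; apply: eq_bigr => p _.
by rewrite !rmorphM /= mulrDr mulrCA.
Qed.

Lemma cderiv_sum A (I : finType) (G : I -> V -> C) (k : I -> C) z v :
  (forall i, csmooth_on A (G i)) -> A z ->
  cderiv v (fun y => \sum_i k i * G i y) z = \sum_i k i * cderiv v (G i) z.
Proof.
move=> GS Az; apply: has_cder_cderiv; apply: has_cder_sum => i.
exact: csmooth_has_cder (GS i) Az.
Qed.

(** The coefficient of the real frame vector p in the complex field sum_c u_c d/dz^c. Twice its real
    part is the coordinate of u along p. *)
Definition dz_coef u (p : 'I_n * bool) : C :=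
  2^-1 * u ord0 p.1 * (if p.2 then - 'i else 1).

Lemma real_coord_dz u p : ofR (real_coord u p) = dz_coef u p + (dz_coef u p)^*.
Proof.
rewrite /dz_coef /real_coord; move: (u ord0 p.1) => x.
have h2 : (2^-1 : C) = ofR 2^-1 by rewrite fmorphV rmorph_nat.
rewrite h2; apply: complex_ext; case: p.2;
by rewrite ?rmorphM /= ?conj_ofR ?rmorph1 ?rmorphN ?(reCD, imCD, reCN, imCN, reCM, imCM, reCJ, imCJ, reC_i, imC_i, reC_ofR, imC_ofR) /=; field.
Qed.

Lemma dz_coefZ (a : C) u p : dz_coef (a *: u) p = a * dz_coef u p.
Proof. by rewrite /dz_coef mxE; ring. Qed.

Lemma dz_coefJ u p : (dz_coef u p)^* = 2^-1 * (u ord0 p.1)^* * (if p.2 then 'i else 1).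
Proof.
rewrite /dz_coef !rmorphM /= fmorphV rmorph_nat; case: p.2; last by rewrite rmorph1.
by rewrite rmorphN /= conjCi opprK.
Qed.

Lemma dz_sum F z u : \sum_c u ord0 c * ddz c F z
  = \sum_p dz_coef u p * cderiv (real_frame R p) F z.
Proof.
rewrite big_pair_bool; apply: eq_bigr => c _.
rewrite /ddz /dz_coef /real_frame /=; move: (cderiv (vec_e R c) F z) (cderiv ('i *: vec_e R c) F z) => X Y; ring.
Qed.

Lemma dzbar_sum F z u : \sum_c (u ord0 c)^* * ddzbar c F z
  = \sum_p (dz_coef u p)^* * cderiv (real_frame R p) F z.
Proof.
rewrite big_pair_bool; apply: eq_bigr => c _.
rewrite !dz_coefJ /ddzbar /real_frame /=.
move: (cderiv (vec_e R c) F z) (cderiv ('i *: vec_e R c) F z) => X Y; ring.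
Qed.

Lemma dz_dzbar_sum A F z u : csmooth_on A F -> A z ->
  \sum_c \sum_d u ord0 c * (u ord0 d)^* * ddz c (ddzbar d F) z
  = \sum_p \sum_q dz_coef u p * (dz_coef u q)^* * cderiv (real_frame R p) (cderiv (real_frame R q) F) z.
Proof.
move=> FS Az.
have D v d : cderiv v (ddzbar d F) z =
    2^-1 * (cderiv v (cderiv (real_frame R (d, false)) F) z + 'i * cderiv v (cderiv (real_frame R (d, true)) F) z).
  apply: has_cder_cderiv; apply: has_cderZ; apply: has_cderD.
    exact: csmooth_has_cder (csmooth_cderiv _ FS) Az.
  by apply: has_cderZ; exact: csmooth_has_cder (csmooth_cderiv _ FS) Az.
(* The second derivatives become opaque scalars, so that what remains is ring algebra. *)
have [DD DDE] : {DD | forall p q, DD p q = cderiv (real_frame R p) (cderiv (real_frame R q) F) z}.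
  by eexists => p q.
have E c d : ddz c (ddzbar d F) z = 2^-1 * (2^-1 * (DD (c, false) (d, false) + 'i * DD (c, false) (d, true))
    - 'i * (2^-1 * (DD (c, true) (d, false) + 'i * DD (c, true) (d, true)))).
  rewrite !DDE /ddz -['i *: vec_e R c]/(real_frame R (c, true)) -[vec_e R c]/(real_frame R (c, false)).
  by rewrite (D (real_frame R (c, true)) d) (D (real_frame R (c, false)) d).
under [RHS]eq_bigr do under eq_bigr do rewrite -DDE.
rewrite [LHS](_ : _ = \sum_c \sum_d u ord0 c * (u ord0 d)^* *
    (2^-1 * (2^-1 * (DD (c, false) (d, false) + 'i * DD (c, false) (d, true))
    - 'i * (2^-1 * (DD (c, true) (d, false) + 'i * DD (c, true) (d, true)))))); last first.
  by apply: eq_bigr => c _; apply: eq_bigr => d _; congr (_ * _); exact: E.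
move: DD {DDE E D} => DD.
rewrite [RHS]big_pair_bool; apply: eq_bigr => c _.
rewrite !(big_pair_bool _ (fun q => _ * _ * _)) -big_split; apply: eq_bigr => d _.
rewrite !dz_coefJ /dz_coef [(c, false).1]/= [(c, true).1]/= [(d, false).1]/= [(d, true).1]/=.
rewrite [(c, false).2]/= [(c, true).2]/= [(d, false).2]/= [(d, true).2]/=.
set u1 := u _ _; set u2 := (u _ _)^*.
move: (DD _ _) (DD _ _) (DD _ _) (DD _ _) => X1 X2 X3 X4.
by rewrite /=; ring.
Qed.

Lemma cderiv2_frame A F z v : open A -> csmooth_on A F -> A z ->
  cderiv v (cderiv v F) z = \sum_p \sum_q ofR (real_coord v p) * ofR (real_coord v q)
     * cderiv (real_frame R p) (cderiv (real_frame R q) F) z.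
Proof.
move=> Ao FS Az; rewrite (cderiv_frame v Ao (csmooth_cderiv v FS) Az).
apply: eq_bigr => p _.
have E1 := @cderiv_near A (cderiv v F) (fun y => \sum_q ofR (real_coord v q) * cderiv (real_frame R q) F y)
  z (real_frame R p) Ao (csmooth_cderiv v FS) Az (fun y Ay => cderiv_frame v Ao FS Ay).
have E2 := @cderiv_sum A _ (fun q => cderiv (real_frame R q) F) (fun q => ofR (real_coord v q)) z
  (real_frame R p) (fun q => csmooth_cderiv _ FS) Az.
rewrite -E1 E2 mulr_sumr; apply: eq_bigr => q _; exact: mulrA.
Qed.

End ComplexLineDerivative.

(** * Second-order expansions *)

Section DetExpansion.

(** In the Leibniz sum the identity contributes the product of the 1 + e N_ii, and every other
    permutation contains two off-diagonal factors e. *)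
Lemma det_1pe (A : comNzRingType) n (e : A) (N : 'M[A]_n) :
  exists r, \det (1%:M + e *: N) = 1 + e * \tr N + e ^+ 2 * r.
Proof.
pose P (x y : A) := exists r, x = y + e ^+ 2 * r.
have PD x y x' y' : P x y -> P x' y' -> P (x + x') (y + y').
  by move=> [r ->] [s ->]; exists (r + s); ring.
suff [r H] : P (\det (1%:M + e *: N)) (1 + e * \tr N) by exists r.
rewrite /determinant (bigD1 1%g) //= -[1 + _]addr0; apply: (PD).
  rewrite odd_perm1 expr0 mul1r /mxtrace.
  elim: (index_enum _) => [|i r [s IH]]; first by exists 0; rewrite !big_nil; ring.
  rewrite !big_cons {}IH perm1 !mxE eqxx /=; set S := \sum_(j <- r) _.
  by exists (N i i * S + (1 + e * N i i) * s); ring.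
apply: (big_ind (fun x => P x 0)) => [|x y Px Py|s s1].
- by exists 0; ring.
- by rewrite -[0]addr0; apply: (PD).
(* A permutation that moves i also moves s i, which supplies the second factor e. *)
have [i si] : exists i, s i != i.
  apply/existsP; apply: contraNT s1; rewrite negb_exists => /forallP h.
  by apply/eqP/permP => i; rewrite perm1; apply/eqP; have := h i; rewrite negbK.
rewrite (bigD1 i) //= (bigD1 (s i)) ?si //= !mxE eq_sym (negPf si).
rewrite [s i == _]eq_sym (inj_eq perm_inj) (negPf si) /= !add0r.
set S := \prod_(j < n | _) _; exists ((-1) ^+ s * (N i (s i) * N (s i) (s (s i)) * S)).
move: ((-1) ^+ s : A) (N i (s i)) (N (s i) (s (s i))) S => x1 x2 x3 x4; ring.
Qed.

Variables (K : numFieldType) (n : nat).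

Definition quad (a b c : K) : {poly K} := a%:P + b%:P * 'X + c%:P * 'X^2.

Lemma horner_quad a b c t : (quad a b c).[t] = a + b * t + c * t ^+ 2.
Proof. by rewrite /quad !(hornerD, hornerM, hornerC, hornerX, hornerXn). Qed.

Lemma coef_quad a b c (r : {poly K}) :
  [/\ (quad a b c + 'X^3 * r)`_0 = a, (quad a b c + 'X^3 * r)`_1 = b
    & (quad a b c + 'X^3 * r)`_2 = c].
Proof. by rewrite /quad !(coefD, coefCM, coefC, coefX, coefXn, coefXnM) /=; split; ring. Qed.

Lemma quad_inj a b c r a' b' c' r' : quad a b c + 'X^3 * r = quad a' b' c' + 'X^3 * r' ->
  [/\ a = a', b = b' & c = c'].
Proof.
move=> E; have [h0 h1 h2] := coef_quad a b c r; have [k0 k1 k2] := coef_quad a' b' c' r'.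
rewrite E in h0 h1 h2.
by split; [exact: etrans (esym h0) k0|exact: etrans (esym h1) k1|exact: etrans (esym h2) k2].
Qed.

Lemma quadM a b c a' b' c' : exists r,
  quad a b c * quad a' b' c' = quad (a * a') (a * b' + b * a') (a * c' + b * b' + c * a') + 'X^3 * r.
Proof.
exists ((b * c' + c * b')%:P + (c * c')%:P * 'X); rewrite /quad !(rmorphD, rmorphM) /=; ring.
Qed.

Lemma poly_quad (p : {poly K}) : exists r, p = quad p`_0 p`_1 p`_2 + 'X^3 * r.
Proof.
exists (drop_poly 3 p); rewrite -[LHS](poly_take_drop 3) mulrC; congr (_ + _).
apply/polyP => i; rewrite coef_take_poly /quad !(coefD, coefCM, coefC, coefX, coefXn).
by case: i => [|[|[|i]]] /=; ring.
Qed.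

Let cm (X : 'M[K]_n) : 'M[{poly K}]_n := map_mx polyC X.

Let cmM (X Y : 'M[K]_n) : cm X *m cm Y = cm (X *m Y).
Proof. by rewrite /cm map_mxM. Qed.

Let trcm (X : 'M[K]_n) : \tr (cm X) = (\tr X)%:P.
Proof. by rewrite /cm trace_map_mx. Qed.

(** Only first-order expansions of determinants are used. Write s for the T^2 coefficient of det(1 +
    T X). The product with det(1 - T X) is det(1 - T^2 X^2), which gives 2 s - (tr X)^2 = - tr X^2.
    Multiplying det(1 + T X + T^2 Y) by det(1 - T X) leaves 1 + T^2 tr(Y - X^2) modulo T^3, and this
    determines the remaining coefficient. *)
Lemma det_quad (X Y : 'M[K]_n) : exists r,
  \det (1%:M + 'X *: cm X + 'X^2 *: cm Y)
  = quad 1 (\tr X) (\tr Y - \tr (X *m X) / 2 + (\tr X) ^+ 2 / 2) + 'X^3 * r.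
Proof.
set t := \tr X.
have [p pE] := det_1pe 'X (cm X); rewrite trcm -/t in pE.
have [s [u pE']] : exists s u, p = s%:P + 'X * u.
  exists p`_0, (drop_poly 1 p); rewrite -[LHS](poly_take_drop 1) expr1 mulrC addrC mulrC addrC.
  congr (_ + _); apply/polyP => i; rewrite coef_take_poly coefC; by case: i.
(* Substituting - T for T shows that both determinants share the coefficient [s]. *)
have qE : \det (1%:M - 'X *: cm X) = quad 1 (- t) s + 'X^3 * (- (u \Po (- 'X))).
  have -> : 1%:M - 'X *: cm X = map_mx (comp_poly (- 'X)) (1%:M + 'X *: cm X).
    apply/matrixP => i j; rewrite !mxE comp_polyD comp_polyM comp_polyX comp_polyC.
    by rewrite mulNr rmorph_nat.
  rewrite det_map_mx pE pE' /quad /= !(comp_polyD, comp_polyM, comp_polyC, comp_polyX).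
  rewrite ?rmorph1 ?rmorphN /=; ring.
have pq : \det (1%:M + 'X *: cm X) = quad 1 t s + 'X^3 * u.
  by rewrite pE pE' /quad polyC1; ring.
have prod1 : \det (1%:M + 'X *: cm X) * \det (1%:M - 'X *: cm X) = \det (1%:M + 'X^2 *: cm (- (X *m X))).
  rewrite -det_mulmx; congr (\det _).
  rewrite mulmxBr mulmx1 mulmxDl mul1mx -scalemxAl -scalemxAr cmM scalerA -expr2.
  by rewrite /cm map_mxN scalerN opprD addrA addrK.
have prod2 : \det (1%:M + 'X *: cm X + 'X^2 *: cm Y) * \det (1%:M - 'X *: cm X)
   = \det (1%:M + 'X^2 *: (cm (Y - X *m X) - 'X *: cm (Y *m X))).
  rewrite -det_mulmx; congr (\det _).
  rewrite mulmxBr mulmx1 !mulmxDl mul1mx -!scalemxAl -!scalemxAr !cmM !scalerA -expr2 -exprSr.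
  rewrite scalerBr scalerA -exprSr /cm map_mxB scalerBr.
  apply/matrixP => i j; rewrite !mxE; ring.
have [r1 e1] := det_1pe ('X^2 : {poly K}) (cm (- (X *m X))); rewrite trcm in e1.
have [r2 e2] := det_1pe ('X^2 : {poly K}) (cm (Y - X *m X) - 'X *: cm (Y *m X)).
have trE (U V : 'M[{poly K}]_n) : \tr (U - 'X *: V) = \tr U - 'X * \tr V by rewrite raddfB /= linearZ.
rewrite trE !trcm in e2.
rewrite e1 pq qE in prod1; rewrite e2 qE in prod2.
have expand (A B D r v w : {poly K}) : A * B = D + 'X^3 * r ->
    (A + 'X^3 * v) * (B + 'X^3 * w) = D + 'X^3 * (r + A * w + v * B + v * ('X^3 * w)).
  move=> E; transitivity (A * B + 'X^3 * (A * w + v * B + v * ('X^3 * w))); first by ring.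
  by rewrite E; ring.
have [r3 e3] := quadM 1 t s 1 (- t) s.
have : quad (1 * 1) (1 * - t + t * 1) (1 * s + t * - t + s * 1)
     + 'X^3 * (r3 + quad 1 t s * (- (u \Po - 'X)) + u * quad 1 (- t) s + u * ('X^3 * (- (u \Po - 'X))))
   = quad 1 0 (\tr (- (X *m X))) + 'X^3 * ('X * r1).
  transitivity ((quad 1 t s + 'X^3 * u) * (quad 1 (- t) s + 'X^3 * (- (u \Po - 'X)))).
    exact: esym (expand _ _ _ _ _ _ e3).
  by rewrite prod1 /quad polyC1 polyC0; ring.
move=> /quad_inj [_ _ s2]; rewrite raddfN /= in s2.
set D := \det (1%:M + 'X *: cm X + 'X^2 *: cm Y) in prod2 *.
have [r4 e4] := poly_quad D; exists r4.
set d0 := D`_0 in e4; set d1 := D`_1 in e4; set d2 := D`_2 in e4.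
have [r5 e5] := quadM d0 d1 d2 1 (- t) s.
have : quad (d0 * 1) (d0 * - t + d1 * 1) (d0 * s + d1 * - t + d2 * 1)
     + 'X^3 * (r5 + quad d0 d1 d2 * (- (u \Po - 'X)) + r4 * quad 1 (- t) s + r4 * ('X^3 * (- (u \Po - 'X))))
   = quad 1 0 (\tr (Y - X *m X)) + 'X^3 * ('X * r2 - (\tr (Y *m X))%:P).
  transitivity (D * (quad 1 (- t) s + 'X^3 * (- (u \Po - 'X)))).
    by rewrite e4; exact: esym (expand _ _ _ _ _ _ e5).
  by rewrite prod2 /quad polyC1 polyC0; ring.
move=> /quad_inj [E0 E1 E2]; rewrite mulr1 in E0; rewrite E0 in E1 E2 e4.
have {}E1 : d1 = t by apply/eqP; rewrite -subr_eq0 -E1; apply/eqP; ring.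
rewrite E1 raddfB /= in E2 e4; rewrite e4; congr (quad _ _ _ + _).
have ss : s = (t ^+ 2 - \tr (X *m X)) / 2.
  have -> : s = (1 * s + t * - t + s * 1 + t ^+ 2) / 2 by field.
  by rewrite s2; field.
have -> : d2 = 1 * s + t * - t + d2 * 1 - s + t ^+ 2 by ring.
by rewrite E2 ss; field.
Qed.

End DetExpansion.

(** * Expansions up to o(t^2) along the real line *)

Section Jets.
Variable R : realType.
Local Notation C := (Cx R).
Implicit Types (phi psi : R -> C) (p q : {poly C}).

(** Any polynomial with the right low coefficients is accepted, so sums, products and determinants
    of jets are formed in the polynomial ring and truncated afterwards by [jet_mod]. *)
Definition jet phi p := forall e : R, 0 < e -> exists2 d : R, 0 < d & forall t : R, `|t| < d ->
  cabs (phi t - p.[ofR t]) <= e * t ^+ 2.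

Lemma poly_bounded p : exists2 B : R, 0 <= B & forall t : R, `|t| <= 1 -> cabs p.[ofR t] <= B.
Proof.
exists (\sum_(i < size p) cabs p`_i); first by apply: sumr_ge0 => i _; exact: cabs_ge0.
move=> t t1; rewrite horner_coef; apply: le_trans (cabs_sum _ _ _) _; apply: ler_sum => i _.
by rewrite cabsM cabsX cabs_ofR -[leRHS]mulr1 ler_wpM2l ?cabs_ge0 // exprn_ile1.
Qed.

Lemma jet_cst (c : C) : jet (fun=> c) c%:P.
Proof. by move=> e e0; exists 1 => // t _; rewrite hornerC subrr cabs0 mulr_ge0 ?sqr_ge0 // ltW. Qed.

Lemma jetD phi psi p q : jet phi p -> jet psi q -> jet (fun t => phi t + psi t) (p + q).
Proof.
move=> H1 H2 e e0; have e2 : 0 < e / 2 by rewrite divr_gt0.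
have [d d0 Hd] := H1 _ e2; have [d' d0' Hd'] := H2 _ e2.
exists (Num.min d d'); first by rewrite lt_min d0.
move=> t; rewrite lt_min => /andP[/Hd h1 /Hd' h2]; rewrite hornerD.
rewrite opprD addrACA; apply: le_trans (cabsD _ _) _.
by rewrite [e in leRHS]splitr mulrDl lerD.
Qed.

Lemma jetM phi psi p q : jet phi p -> jet psi q -> jet (fun t => phi t * psi t) (p * q).
Proof.
move=> H1 H2 e e0.
have [A A0 HA] := poly_bounded p; have [B B0 HB] := poly_bounded q.
pose k := A + B + 1; have k0 : 0 < k by rewrite ltr_wpDl ?addr_ge0.
have e2 : 0 < Num.min 1 (e / (2 * k)) by rewrite lt_min ltr01 divr_gt0 // mulr_gt0.
have [d d0 Hd] := H1 _ e2; have [d' d0' Hd'] := H2 _ e2.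
exists (Num.min 1 (Num.min d d')); first by rewrite !lt_min d0 d0' ltr01.
move=> t; rewrite !lt_min => /and3P[t1 /Hd h1 /Hd' h2]; rewrite hornerM.
move: h1 h2; set x := p.[_]; set y := q.[_]; set e' := Num.min _ _ => h1 h2.
have xA : cabs x <= A by apply: HA; exact: ltW.
have yB : cabs y <= B by apply: HB; exact: ltW.
have t20 : 0 <= t ^+ 2 := sqr_ge0 t.
have t21 : t ^+ 2 <= 1 by rewrite -[t ^+ 2]ger0_norm // normrX exprn_ile1 // ltW.
have e'1 : e' <= 1 by rewrite ge_min lexx.
have e'k : e' * k <= e / 2.
  apply: le_trans (ler_wpM2r (ltW k0) (_ : e' <= e / (2 * k))) _; first by rewrite ge_min lexx orbT.
  by rewrite invfM mulrA divfK // gt_eqF.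
have psik : cabs (psi t) <= k.
  rewrite -(subrK y (psi t)); apply: le_trans (cabsD _ _) _.
  rewrite /k addrC -addrA [A + _]addrC -addrA [1 + A]addrC; apply: lerD => //.
  apply: le_trans h2 _; apply: le_trans (_ : 1 <= _); last by rewrite lerDr.
  by rewrite -[leRHS]mulr1 ler_pM // ltW.
rewrite (_ : _ - _ = (phi t - x) * psi t + x * (psi t - y)); last by ring.
apply: le_trans (cabsD _ _) _; rewrite !cabsM [e in leRHS]splitr mulrDl; apply: lerD.
  apply: le_trans (ler_pM (cabs_ge0 _) (cabs_ge0 _) h1 psik) _.
  by rewrite mulrAC ler_wpM2r.
apply: le_trans (ler_pM (cabs_ge0 _) (cabs_ge0 _) xA h2) _.
rewrite mulrA ler_wpM2r //; apply: le_trans e'k; rewrite mulrC ler_wpM2l ?(ltW e2) //.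
by rewrite /k -addrA lerDl addr_ge0.
Qed.

Lemma jet_sum (I : Type) (r : seq I) (phi : I -> R -> C) (p : I -> {poly C}) :
  (forall i, jet (phi i) (p i)) -> jet (fun t => \sum_(i <- r) phi i t) (\sum_(i <- r) p i).
Proof.
move=> H; elim: r => [|i r IH].
  by rewrite big_nil; under eq_fun do rewrite big_nil; exact: jet_cst.
by rewrite big_cons; under eq_fun do rewrite big_cons; exact: (jetD (H i) IH).
Qed.

Lemma jet_prod (I : Type) (r : seq I) (phi : I -> R -> C) (p : I -> {poly C}) :
  (forall i, jet (phi i) (p i)) -> jet (fun t => \prod_(i <- r) phi i t) (\prod_(i <- r) p i).
Proof.
move=> H; elim: r => [|i r IH].
  by rewrite big_nil; under eq_fun do rewrite big_nil; exact: jet_cst.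
by rewrite big_cons; under eq_fun do rewrite big_cons; exact: (jetM (H i) IH).
Qed.

Lemma jet_mod p r phi : jet phi (p + 'X^3 * r) -> jet phi p.
Proof.
move=> H e e0; have e2 : 0 < e / 2 by rewrite divr_gt0.
have [d d0 Hd] := H _ e2; have [B B0 HB] := poly_bounded r.
have B1 : 0 < 2 * (B + 1) by rewrite mulr_gt0 // ltr_wpDl.
exists (Num.min (Num.min 1 d) (e / (2 * (B + 1)))); first by rewrite !lt_min ltr01 d0 divr_gt0.
move=> t; rewrite !lt_min => /andP[/andP[t1 /Hd h]]; rewrite ltr_pdivlMr // => tB.
rewrite -(subrK (ofR t ^+ 3 * r.[ofR t]) (phi t)) [_ + _ - p.[_]]addrAC.
rewrite hornerD hornerM hornerXn opprD in h.
apply: le_trans (cabsD _ _) _; rewrite [e in leRHS]splitr mulrDl; apply: lerD.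
  by move: h; rewrite -addrA [- _ - _]addrC addrA.
rewrite cabsM cabsX cabs_ofR.
have -> : `|t| ^+ 3 * cabs r.[ofR t] = `|t| * cabs r.[ofR t] * t ^+ 2.
  by rewrite -(real_normK (num_real t)); ring.
rewrite ler_wpM2r ?sqr_ge0 //.
apply: le_trans (_ : `|t| * (B + 1) <= _); last first.
  by rewrite ler_pdivlMr // -mulrA [(B + 1) * 2]mulrC ltW.
by rewrite ler_wpM2l // (le_trans (HB _ (ltW t1))) // lerDl.
Qed.

Lemma jetJ phi (a b c : C) : jet phi (quad a b c) -> jet (fun t => (phi t)^*) (quad a^* b^* c^*).
Proof.
move=> H e /H [d d0 Hd]; exists d => // t /Hd; rewrite !horner_quad -cabsJ.
by rewrite rmorphB !rmorphD !rmorphM /= !conj_ofR.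
Qed.

(** The two functions agree at 0 and are ordered for both signs of t: this forces equal linear
    terms, and then orders the quadratic ones. *)
Lemma jet_le phi psi (a b a' b' : C) : jet phi (quad 1 a b) -> jet psi (quad 1 a' b') ->
  (exists2 d : R, 0 < d & forall t, `|t| < d -> reC (phi t) <= reC (psi t)) ->
  reC a = reC a' /\ reC b <= reC b'.
Proof.
move=> H1 H2 [d0 d00 le].
set al := reC a' - reC a; set be := reC b' - reC b.
have key e : 0 < e -> exists2 d : R, 0 < d & forall t, `|t| < d -> 0 <= al * t + (be + e) * t ^+ 2.
  move=> e0; have e2 : 0 < e / 2 by rewrite divr_gt0.
  have [d1 d10 h1] := H1 _ e2; have [d2 d20 h2] := H2 _ e2.
  exists (Num.min d0 (Num.min d1 d2)); first by rewrite !lt_min d00 d10.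
  move=> t; rewrite !lt_min => /and3P[/le h /h1 {}h1 /h2 {}h2].
  have r1 := le_trans (abs_reC _) h1; have r2 := le_trans (abs_reC _) h2.
  have ev (x y : C) : reC (quad 1 x y).[ofR t] = 1 + reC x * t + reC y * t ^+ 2.
    rewrite horner_quad -rmorphXn /= !reCD ![_ * ofR _]mulrC !reCZ.
    by rewrite [t * _]mulrC [t ^+ 2 * _]mulrC.
  rewrite reCB ev in r1; rewrite reCB ev in r2.
  move: r1 r2; rewrite !ler_norml => /andP[r1 r1'] /andP[r2 r2'].
  rewrite /al /be; lra.
have al0 : al = 0.
  apply/eqP; rewrite -normr_eq0 eq_le normr_ge0 andbT leNgt; apply/negP => alp.
  have [d dp Hd] := key 1 ltr01.
  pose k := `|be + 1| + 1; have k0 : 0 < k by rewrite ltr_wpDl.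
  (* At t = - sg(al) s the linear term is - |al| s, while s k <= |al| / 2 keeps the quadratic term
     at most half of that size. *)
  pose s := Num.min (d / 2) (`|al| / (2 * k)).
  have s0 : 0 < s by rewrite lt_min !divr_gt0 // mulr_gt0.
  have sd : s < d by apply: le_lt_trans (_ : d / 2 < d); [rewrite ge_min lexx|lra].
  have sk : s * k <= `|al| / 2.
    apply: le_trans (ler_wpM2r (ltW k0) (_ : s <= `|al| / (2 * k))) _; first by rewrite ge_min lexx orbT.
    by rewrite invfM mulrA divfK // gt_eqF.
  have := Hd (- Num.sg al * s); rewrite normrM normrN normr_sg -normr_eq0 gt_eqF // mul1r gtr0_norm //.
  move=> /(_ sd); rewrite mulrA mulrN [al * _]mulrC -normrEsg exprMn sqrrN sqr_sg -normr_eq0 gt_eqF // mul1r.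
  have bk : (be + 1) * s ^+ 2 <= `|al| / 2 * s.
    rewrite expr2 mulrA ler_pM2r //; apply: le_trans sk; rewrite mulrC ler_pM2l //.
    by apply: le_trans (ler_norm _) _; rewrite lerDl.
  have := mulr_gt0 alp s0; lra.
split; first by apply/eqP; rewrite eq_sym -subr_eq0 -/al al0.
rewrite -subr_ge0 -/be; apply/ler_addgt0Pr => e /key [d dp Hd].
have := Hd (d / 2); rewrite gtr0_norm ?divr_gt0 // => /(_ _)/[!al0].
rewrite mul0r add0r pmulr_lge0 ?exprn_gt0 ?divr_gt0 //; apply; lra.
Qed.

Section MatrixJets.

Definition mjet (m n : nat) (Phi : R -> 'M[C]_(m, n)) (X0 X1 X2 : 'M[C]_(m, n)) :=
  forall i j, jet (fun t => Phi t i j) (quad (X0 i j) (X1 i j) (X2 i j)).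

Lemma mjet_cst m n (A : 'M[C]_(m, n)) : mjet (fun=> A) A 0 0.
Proof.
move=> i j; rewrite !mxE /quad !polyC0 !mul0r !addr0; exact: jet_cst.
Qed.

Lemma mjetM (m n l : nat) (Phi : R -> 'M[C]_(m, n)) (Psi : R -> 'M[C]_(n, l)) X0 X1 X2 Y0 Y1 Y2 :
  mjet Phi X0 X1 X2 -> mjet Psi Y0 Y1 Y2 ->
  mjet (fun t => Phi t *m Psi t) (X0 *m Y0) (X0 *m Y1 + X1 *m Y0)
    (X0 *m Y2 + X1 *m Y1 + X2 *m Y0).
Proof.
move=> HX HY i j; under eq_fun do rewrite mxE.
have key k : jet (fun t => Phi t i k * Psi t k j)
   (quad (X0 i k * Y0 k j) (X0 i k * Y1 k j + X1 i k * Y0 k j)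
      (X0 i k * Y2 k j + X1 i k * Y1 k j + X2 i k * Y0 k j)).
  have := jetM (HX i k) (HY k j); have [r ->] := quadM (X0 i k) (X1 i k) (X2 i k) (Y0 k j) (Y1 k j) (Y2 k j).
  exact: jet_mod.
have := jet_sum (index_enum 'I_n) key; congr jet.
rewrite /quad !big_split /= -!mulr_suml -!rmorph_sum /= !big_split /=.
by rewrite !mxE.
Qed.

Lemma mjet_adj m n (Phi : R -> 'M[C]_(m, n)) X0 X1 X2 : mjet Phi X0 X1 X2 ->
  mjet (fun t => map_mx Num.conj (Phi t)^T) (map_mx Num.conj X0^T) (map_mx Num.conj X1^T) (map_mx Num.conj X2^T).
Proof. by move=> H i j; under eq_fun do rewrite !mxE; rewrite !mxE; exact: jetJ. Qed.

Lemma jet_det n (Phi : R -> 'M[C]_n) (X Y : 'M[C]_n) : mjet Phi 1%:M X Y ->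
  jet (fun t => \det (Phi t)) (quad 1 (\tr X) (\tr Y - \tr (X *m X) / 2 + (\tr X) ^+ 2 / 2)).
Proof.
move=> H; have [r E] := det_quad X Y; apply: (@jet_mod _ r); rewrite -E /determinant.
apply: jet_sum => s; apply: jetM.
  by rewrite -(polyC1 C) -polyCN -rmorphXn; exact: jet_cst.
apply: jet_prod => i; have := H i (s i); congr jet.
by rewrite !mxE /quad rmorph_nat; ring.
Qed.

End MatrixJets.

End Jets.

(** * Expansion of a Hermitian metric along v and i v *)

Section HermitianJets.
Variables (R : realType) (n : nat).
Local Notation C := (Cx R).
Local Notation V := ('rV[Cx R]_n).
Implicit Types (F G : V -> C) (A : set V) (z u v q : V).

Definition adjmx (m p : nat) (X : 'M[C]_(m, p)) : 'M[C]_(p, m) := map_mx Num.conj X^T.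

Lemma adjmxE (m p : nat) (X : 'M[C]_(m, p)) i j : adjmx X i j = (X j i)^*.
Proof. by rewrite !mxE. Qed.

Definition curve_jet (w : R -> V) z u q := forall e : R, 0 < e -> exists2 d : R, 0 < d &
  forall t : R, `|t| < d -> nrm (w t - z - ofR t *: u - ofR (t ^+ 2) *: q) <= e * t ^+ 2.

Definition cdiff_real F z q : C :=
  ofR (rdiff (fun y => reC (F y)) z q) + 'i * ofR (rdiff (fun y => imC (F y)) z q).

Lemma cdiff_realN F z q : cdiff_real F z (- q) = - cdiff_real F z q.
Proof.
have -> : - q = ofR (- 1) *: q by rewrite rmorphN1 scaleN1r.
by rewrite /cdiff_real !rdiffZ !mulN1r !rmorphN /= mulrN opprD.
Qed.

Lemma csmooth_curve_jet A F z u q (w : R -> V) : open A -> csmooth_on A F -> A z ->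
  curve_jet w z u q ->
  jet (fun t => F (w t)) (quad (F z) (cderiv u F z) (2^-1 * cderiv u (cderiv u F) z + cdiff_real F z q)).
Proof.
move=> Ao [FR FI] Az wj e e0; have e2 : 0 < e / 2 by rewrite divr_gt0.
have [d d0 H] := smooth_curve_jet Ao FR Az wj e2.
have [d' d'0 H'] := smooth_curve_jet Ao FI Az wj e2.
exists (Num.min d d'); first by rewrite lt_min d0.
move=> t; rewrite lt_min => /andP[/H h1 /H' h2].
have half : (2^-1 : C) = ofR 2^-1 by rewrite fmorphV rmorph_nat.
have reE v (G : V -> C) y : reC (cderiv v G y) = rderiv v (fun y => reC (G y)) y.
  by rewrite -reC_cderiv.
have imE v (G : V -> C) y : imC (cderiv v G y) = rderiv v (fun y => imC (G y)) y.
  by rewrite -imC_cderiv.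
set D := cderiv u F z; set D2 := cderiv u (cderiv u F) z.
have D1r : reC D = rderiv u (fun y => reC (F y)) z by rewrite reE.
have D1i : imC D = rderiv u (fun y => imC (F y)) z by rewrite imE.
have D2r : reC D2 = rderiv u (rderiv u (fun y => reC (F y))) z.
  by rewrite -(reC_cderiv u F) -(reE u (cderiv u F) z).
have D2i : imC D2 = rderiv u (rderiv u (fun y => imC (F y))) z.
  by rewrite -(imC_cderiv u F) -(imE u (cderiv u F) z).
have Qr : reC (cdiff_real F z q) = rdiff (fun y => reC (F y)) z q.
  by rewrite /cdiff_real reCD reCM reC_i imC_i !reC_ofR !imC_ofR mul0r mulr0 subr0 addr0.
have Qi : imC (cdiff_real F z q) = rdiff (fun y => imC (F y)) z q.
  by rewrite /cdiff_real imCD imCM reC_i imC_i !reC_ofR !imC_ofR mulr0 mul1r !add0r.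
rewrite /= -D1r -D2r -Qr in h1; rewrite /= -D1i -D2i -Qi in h2.
move: D D2 (cdiff_real F z q) h1 h2 {D1r D1i D2r D2i Qr Qi} => D D2 Q h1 h2.
have -> : e * t ^+ 2 = e / 2 * t ^+ 2 + e / 2 * t ^+ 2 by rewrite -mulrDl -splitr.
apply: le_trans (cabs_le _) _; rewrite horner_quad half -rmorphXn /=.
rewrite reCB imCB !(reCD, imCD) ![_ * ofR _]mulrC !(reCZ, imCZ) !(reCD, imCD) !(reCZ, imCZ).
apply: lerD.
  by apply: le_trans h1; rewrite le_eqVlt; apply/orP; left; apply/eqP; congr (`|_|); ring.
by apply: le_trans h2; rewrite le_eqVlt; apply/orP; left; apply/eqP; congr (`|_|); ring.
Qed.

Lemma cderivJ A F G v : open A -> csmooth_on A F -> (forall y, A y -> G y = (F y)^*) ->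
  forall y, A y -> cderiv v G y = (cderiv v F y)^*.
Proof.
move=> Ao FS FG y Ay; apply: has_cder_cderiv.
exact: (has_cder_near Ao Ay (fun y Ay => esym (FG y Ay)) (has_cderJ (csmooth_has_cder v FS Ay))).
Qed.

Variables (A : set V) (h : V -> 'M[C]_n).
Hypothesis Ao : open A.
Hypothesis hS : forall a b, csmooth_on A (fun y => h y a b).
Hypothesis hH : forall y, A y -> forall a b, h y b a = (h y a b)^*.
Variables (z u : V).
Hypothesis Az : A z.

Definition dz_mx : 'M[C]_n := \matrix_(a, b) \sum_c u ord0 c * ddz c (fun y => h y a b) z.
Definition dzdzbar_mx : 'M[C]_n := \matrix_(a, b)
  \sum_c \sum_d u ord0 c * (u ord0 d)^* * ddz c (ddzbar d (fun y => h y a b)) z.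

Lemma dzbar_mxE a b : \sum_d (u ord0 d)^* * ddzbar d (fun y => h y a b) z = adjmx dz_mx a b.
Proof.
rewrite adjmxE mxE dzbar_sum dz_sum rmorph_sum; apply: eq_bigr => p _; rewrite rmorphM; congr (_ * _).
exact: (cderivJ _ Ao (hS b a) (fun y Ay => hH Ay b a)).
Qed.

Lemma cderiv_dz (c : C) a b : cderiv (c *: u) (fun y => h y a b) z
  = c * dz_mx a b + c^* * adjmx dz_mx a b.
Proof.
rewrite (cderiv_frame _ Ao (hS a b) Az) -dzbar_mxE mxE dz_sum dzbar_sum !mulr_sumr -big_split.
apply: eq_bigr => p _; rewrite real_coord_dz dz_coefZ; move: (dz_coef u p) (cderiv _ _ z) => x D.
by rewrite rmorphM /=; ring.
Qed.

(** Each ordered pair of frame vectors, with coefficients x and y, contributes (x + x')(y + y') - (x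
    - x')(y - y') = 2 (x y' + x' y), a prime denoting conjugation. The pure terms cancel pair by
    pair, with no interchange of derivatives. *)
Lemma cderiv2_dz a b :
  2^-1 * cderiv u (cderiv u (fun y => h y a b)) z
  + 2^-1 * cderiv ('i *: u) (cderiv ('i *: u) (fun y => h y a b)) z
  = dzdzbar_mx a b + adjmx dzdzbar_mx a b.
Proof.
have DJ p p' : (cderiv (real_frame R p) (cderiv (real_frame R p') (fun y => h y b a)) z)^*
    = cderiv (real_frame R p) (cderiv (real_frame R p') (fun y => h y a b)) z.
  have E1 y (Ay : A y) := cderivJ (real_frame R p') Ao (hS b a) (fun y Ay => hH Ay b a) Ay.
  by rewrite (cderivJ (real_frame R p) Ao (csmooth_cderiv (real_frame R p') (hS b a)) E1 Az).
rewrite (cderiv2_frame u Ao (hS a b) Az) (cderiv2_frame ('i *: u) Ao (hS a b) Az).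
have kE i j : dzdzbar_mx i j = \sum_p \sum_p' dz_coef u p * (dz_coef u p')^*
    * cderiv (real_frame R p) (cderiv (real_frame R p') (fun y => h y i j)) z.
  by rewrite mxE; exact: dz_dzbar_sum (hS i j) Az.
rewrite adjmxE (kE a b) (kE b a) {kE}.
rewrite rmorph_sum !mulr_sumr -!big_split; apply: eq_bigr => p _.
rewrite rmorph_sum !mulr_sumr -!big_split; apply: eq_bigr => p' _.
rewrite !real_coord_dz !dz_coefZ; move: (dz_coef u p) (dz_coef u p') => x y.
rewrite !rmorphM /= DJ conjCi conjCK.
have ii : ('i : C) * 'i = -1 by rewrite -expr2 sqrCi.
move: (cderiv _ _ z) => D.
transitivity (2^-1 * ((x + x^*) * (y + y^*) + ('i * 'i) * (x - x^*) * (y - y^*)) * D); first by ring.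
by rewrite ii; field.
Qed.

(** The curves are the restrictions of one holomorphic curve to t and to i t, so their accelerations
    are opposite and drop out of the sum of the second-order coefficients. *)
Lemma hermitian_curve_jets q (w1 wi : R -> V) :
  curve_jet w1 z u q -> curve_jet wi z ('i *: u) (- q) ->
  exists S1 Si : 'M[C]_n, [/\ mjet (fun t => h (w1 t)) (h z) (dz_mx + adjmx dz_mx) S1,
    mjet (fun t => h (wi t)) (h z) ('i *: dz_mx - 'i *: adjmx dz_mx) Si
    & S1 + Si = dzdzbar_mx + adjmx dzdzbar_mx].
Proof.
move=> j1 ji.
pose S (v x : V) : 'M[C]_n := \matrix_(a, b) (2^-1 * cderiv v (cderiv v (fun y => h y a b)) z
  + cdiff_real (fun y => h y a b) z x).
exists (S u q), (S ('i *: u) (- q)); split.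
- move=> a b; have := csmooth_curve_jet Ao (hS a b) Az j1.
  have := cderiv_dz 1 a b; rewrite scale1r mul1r rmorph1 mul1r => ->.
  by rewrite [S u q a b]mxE [(dz_mx + _) a b]mxE.
- move=> a b; have := csmooth_curve_jet Ao (hS a b) Az ji.
  have := cderiv_dz 'i a b; rewrite conjCi mulNr => ->.
  have mE (X Y : 'M[C]_n) : ('i *: X - 'i *: Y) a b = 'i * X a b - 'i * Y a b by rewrite !mxE.
  by rewrite [S ('i *: u) (- q) a b]mxE mE.
apply/matrixP => a b; have E := cderiv2_dz a b.
rewrite [LHS]mxE [S u q a b]mxE [S ('i *: u) (- q) a b]mxE [RHS]mxE -E cdiff_realN.
by rewrite addrACA subrr addr0.
Qed.

End HermitianJets.

(** * Log determinants and curvature *)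

Section Adjoint.
Variable R : realType.
Local Notation C := (Cx R).

Lemma adjmxM (m n p : nat) (X : 'M[C]_(m, n)) (Y : 'M[C]_(n, p)) :
  adjmx (X *m Y) = adjmx Y *m adjmx X.
Proof. by rewrite /adjmx trmx_mul map_mxM. Qed.
Lemma adjmxD (m n : nat) (X Y : 'M[C]_(m, n)) : adjmx (X + Y) = adjmx X + adjmx Y.
Proof. by apply/matrixP => i j; rewrite !mxE rmorphD. Qed.
Lemma adjmxN (m n : nat) (X : 'M[C]_(m, n)) : adjmx (- X) = - adjmx X.
Proof. by apply/matrixP => i j; rewrite !mxE rmorphN. Qed.
Lemma adjmxB (m n : nat) (X Y : 'M[C]_(m, n)) : adjmx (X - Y) = adjmx X - adjmx Y.
Proof. by rewrite adjmxD adjmxN. Qed.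
Lemma adjmxZ (m n : nat) (c : C) (X : 'M[C]_(m, n)) : adjmx (c *: X) = c^* *: adjmx X.
Proof. by apply/matrixP => i j; rewrite !mxE rmorphM. Qed.
Lemma adjmxK (m n : nat) (X : 'M[C]_(m, n)) : adjmx (adjmx X) = X.
Proof. by apply/matrixP => i j; rewrite !mxE conjCK. Qed.
Lemma adjmx1 (n : nat) : adjmx (1%:M : 'M[C]_n) = 1%:M.
Proof. by apply/matrixP => i j; rewrite !mxE rmorph_nat eq_sym. Qed.
Lemma mxtrace_adj (n : nat) (X : 'M[C]_n) : \tr (adjmx X) = (\tr X)^*.
Proof. by rewrite /mxtrace rmorph_sum; apply: eq_bigr => i _; rewrite adjmxE. Qed.
Lemma det_adjmx (n : nat) (X : 'M[C]_n) : \det (adjmx X) = (\det X)^*.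
Proof. by rewrite /adjmx det_map_mx det_tr. Qed.

Lemma adjmx_inv (n : nat) (h : 'M[C]_n) : h \in unitmx -> adjmx h = h -> adjmx (invmx h) = invmx h.
Proof.
move=> hu hh; apply: (can_inj (mulmxK hu)); rewrite mulVmx // -{2}hh -adjmxM mulmxV ?adjmx1 //.
Qed.

Lemma herm_mulmx (n : nat) (G : 'M[C]_n) (u v : 'rV[C]_n) :
  herm G u v = (u *m G *m adjmx v) ord0 ord0.
Proof.
rewrite /herm mxE exchange_big; apply: eq_bigr => b _ /=.
rewrite adjmxE mxE mulr_suml; apply: eq_bigr => a _; ring.
Qed.

Lemma gram_entry (m n : nat) (X : 'M[C]_(m, n)) (h : 'M[C]_n) i j :
  (X *m h *m adjmx X) i j = herm h (row i X) (row j X).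
Proof.
rewrite herm_mulmx -row_mul; rewrite !mxE; apply: eq_bigr => k _.
by rewrite !mxE.
Qed.

Lemma herm_ge0 (n : nat) (h : 'M[C]_n) u : (forall u, u != 0 -> 0 < herm h u u) -> 0 <= herm h u u.
Proof.
move=> hp; have [->|u0] := eqVneq u 0; last by rewrite ltW ?hp.
by rewrite herm_mulmx !mul0mx mxE.
Qed.

Lemma trace_gram_ge0 (m n : nat) (X : 'M[C]_(m, n)) (h : 'M[C]_n) :
  (forall u, u != 0 -> 0 < herm h u u) -> 0 <= \tr (X *m h *m adjmx X).
Proof.
move=> hp; apply: sumr_ge0 => i _; rewrite gram_entry; exact: herm_ge0.
Qed.

Lemma herm_pos_unit (n : nat) (h : 'M[C]_n) : (forall u, u != 0 -> 0 < herm h u u) -> h \in unitmx.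
Proof.
move=> hp; rewrite -row_free_unit; apply/row_freeP.
have /eqP k0 : kermx h == 0.
  apply/eqP/row_matrixP => i; rewrite row0; apply/eqP/negPn/negP => /hp.
  by rewrite herm_mulmx -row_mul mulmx_ker row0 mul0mx mxE ltxx.
by apply/row_freeP; rewrite -kermx_eq0 k0.
Qed.

End Adjoint.

(** * Completing the square in the second-order coefficient *)

Section TraceIdentity.
Variables (R : realType) (m n : nat).
Local Notation C := (Cx R).
Variables (a0 a1 a2 : 'M[C]_(m, n)) (h0 g k S1 Si : 'M[C]_n).
Hypothesis hh : adjmx h0 = h0.
Hypothesis hp : forall u, u != 0 -> 0 < herm h0 u u.
Hypothesis SS : S1 + Si = k + adjmx k.

Let ii : ('i : C) * 'i = -1. Proof. by rewrite -expr2 sqrCi. Qed.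
Let hu : h0 \in unitmx := herm_pos_unit hp.

(** [pull1] and [pull2] are the coefficients of t and t^2 in a h a^*, for a = a0 + w a1 t + w^2 a2
    t^2 and h = h0 + h1 t + h2 t^2. The number w is 1 along v and i along i v. *)
Definition pull1 (w : C) (h1 : 'M[C]_n) : 'M[C]_m :=
  a0 *m h0 *m adjmx (w *: a1) + (a0 *m h1 + (w *: a1) *m h0) *m adjmx a0.
Definition pull2 (w : C) (h1 h2 : 'M[C]_n) : 'M[C]_m :=
  a0 *m h0 *m adjmx (w ^+ 2 *: a2) + (a0 *m h1 + (w *: a1) *m h0) *m adjmx (w *: a1)
  + (a0 *m h2 + (w *: a1) *m h1 + (w ^+ 2 *: a2) *m h0) *m adjmx a0.

(** The holomorphic derivative of the product a h. *)
Let B := a1 *m h0 + a0 *m g.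

Let pull1E (w : C) : pull1 w (w *: g + w^* *: adjmx g)
  = w *: (B *m adjmx a0) + w^* *: adjmx (B *m adjmx a0).
Proof.
rewrite /pull1 /B adjmxM adjmxK adjmxD !adjmxM hh adjmxZ.
move: (adjmx a0) (adjmx a1) (adjmx g) => b0 b1 gs.
rewrite !(mulmxDr a0) -(scalemxAr w a0 g) -(scalemxAl w a1 h0) -(scalemxAr (w^*) _ b1) -(scalemxAr (w^*) a0 gs).
rewrite !mulmxA; move: (a0 *m g) (a0 *m gs) (a1 *m h0) (a0 *m h0 *m b1) => M1 M2 M3 M4.
rewrite !mulmxDl -!scalemxAl; move: (M1 *m b0) (M2 *m b0) (M3 *m b0) => N1 N2 N3.
by apply/matrixP => i j; rewrite !mxE; ring.
Qed.

Let Z := B *m adjmx a0.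

Let trace_sq (w c : C) (U V : 'M[C]_m) : \tr ((w *: U + c *: V) *m (w *: U + c *: V))
  = w ^+ 2 * \tr (U *m U) + 2 * w * c * \tr (U *m V) + c ^+ 2 * \tr (V *m V).
Proof.
rewrite (mulmxDl (w *: U) (c *: V)) -(scalemxAl w U) -(scalemxAl c V) (mulmxDr U) (mulmxDr V).
rewrite -(scalemxAr w U U) -(scalemxAr c U V) -(scalemxAr w V U) -(scalemxAr c V V).
have := mxtrace_mulC U V; move: (U *m U) (U *m V) (V *m U) (V *m V) => M1 M2 M3 M4 E.
by rewrite !scalerDr !mxtraceD !mxtraceZ -E; ring.
Qed.

Let trace_pull1 (w : C) :
  \tr (pull1 w (w *: g + w^* *: adjmx g) *m pull1 w (w *: g + w^* *: adjmx g))
  = w ^+ 2 * \tr (Z *m Z) + 2 * w * w^* * \tr (Z *m adjmx Z) + w^* ^+ 2 * \tr (adjmx Z *m adjmx Z).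
Proof. by rewrite pull1E -/Z; exact: trace_sq. Qed.

Let trace_pull2 (w : C) (S : 'M[C]_n) : \tr (pull2 w (w *: g + w^* *: adjmx g) S)
  = w ^+ 2 * (\tr (a2 *m h0 *m adjmx a0) + \tr (a1 *m g *m adjmx a0))
    + w^* ^+ 2 * (\tr (a0 *m h0 *m adjmx a2) + \tr (a0 *m adjmx g *m adjmx a1))
    + w * w^* * (\tr (a0 *m g *m adjmx a1) + \tr (a1 *m h0 *m adjmx a1) + \tr (a1 *m adjmx g *m adjmx a0))
    + \tr (a0 *m S *m adjmx a0).
Proof.
rewrite /pull2 !adjmxZ rmorphXn /=; move: (w^*) => c; set w2 := w ^+ 2; set c2 := c ^+ 2.
move: (adjmx a0) (adjmx a1) (adjmx a2) (adjmx g) => b0 b1 b2 gs.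
rewrite -(scalemxAl w a1 h0) -(scalemxAl w2 a2 h0) -(scalemxAl w a1 _) -(scalemxAr c _ b1) -(scalemxAr c2 _ b2).
rewrite (mulmxDr a0) (mulmxDr a1) -(scalemxAr w a0 g) -(scalemxAr c a0 gs) -(scalemxAr w a1 g) -(scalemxAr c a1 gs).
move: (a0 *m g) (a0 *m gs) (a1 *m h0) (a2 *m h0) (a1 *m g) (a1 *m gs) (a0 *m S) (a0 *m h0)
  => M1 M2 M3 M4 M5 M6 M7 M8.
rewrite !scalerDr !mulmxDl -!scalemxAl !scalerDr !scalerA !mxtraceD !mxtraceZ.
by rewrite /w2 /c2; ring.
Qed.

(** Adding the cases w = 1 and w = i kills the terms in w^2 and in its conjugate, since 1 + i^2 = 0,
    and doubles those in |w|^2. *)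
Let scalars (x1 x2 x3 y1 y2 y3 y4 y5 y6 y7 s1 s2 gg : C) :
  1 ^+ 2 * (y1 + y2) + 1 ^+ 2 * (y3 + y4) + 1 * 1 * (y5 + y6 + y7) + s1
  + ('i ^+ 2 * (y1 + y2) + (- 'i) ^+ 2 * (y3 + y4) + 'i * (- 'i) * (y5 + y6 + y7) + s2)
  - (1 ^+ 2 * x1 + 2 * 1 * 1 * x2 + 1 ^+ 2 * x3
     + ('i ^+ 2 * x1 + 2 * 'i * (- 'i) * x2 + (- 'i) ^+ 2 * x3)) / 2
  = 2 * (y6 + y7 + y5 + gg - x2) - 2 * gg + (s1 + s2).
Proof. by field: ii. Qed.

(* Twice the coefficient of |t|^2 in log det (a h a^* ), where B N B^* is the
   contribution of the second fundamental form. *)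
Lemma trace_identity (N := invmx h0 - adjmx a0 *m a0) :
  \tr (pull2 1 (g + adjmx g) S1) + \tr (pull2 'i ('i *: g - 'i *: adjmx g) Si)
  - (\tr (pull1 1 (g + adjmx g) *m pull1 1 (g + adjmx g))
     + \tr (pull1 'i ('i *: g - 'i *: adjmx g) *m pull1 'i ('i *: g - 'i *: adjmx g))) / 2
  = 2 * \tr ((a1 *m h0 + a0 *m g) *m N *m adjmx (a1 *m h0 + a0 *m g))
    - 2 * \tr (a0 *m (g *m invmx h0 *m adjmx g) *m adjmx a0)
    + \tr (a0 *m (k + adjmx k) *m adjmx a0).
Proof.
have sS : \tr (a0 *m S1 *m adjmx a0) + \tr (a0 *m Si *m adjmx a0)
    = \tr (a0 *m (k + adjmx k) *m adjmx a0).
  by rewrite -SS mulmxDr mulmxDl mxtraceD.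
have e1 : g + adjmx g = 1 *: g + 1^* *: adjmx g by rewrite rmorph1 !scale1r.
have ei : 'i *: g - 'i *: adjmx g = 'i *: g + 'i^* *: adjmx g by rewrite conjCi scaleNr.
have t1 := trace_pull1 1; rewrite -e1 rmorph1 in t1.
have ti := trace_pull1 'i; rewrite -ei conjCi in ti.
have s1 := trace_pull2 1 S1; rewrite -e1 rmorph1 in s1.
have si := trace_pull2 'i Si; rewrite -ei conjCi in si.
apply: etrans (congr2 (fun a b => a - b / 2) (congr2 +%R s1 si) (congr2 +%R t1 ti)) _.
have NE : \tr (B *m N *m adjmx B) = \tr (a1 *m h0 *m adjmx a1) + \tr (a1 *m adjmx g *m adjmx a0)
    + \tr (a0 *m g *m adjmx a1) + \tr (a0 *m (g *m invmx h0 *m adjmx g) *m adjmx a0)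
    - \tr (Z *m adjmx Z).
  rewrite /N mulmxBr mulmxBl raddfB /= /Z adjmxM adjmxK !mulmxA; congr (_ - _).
  rewrite /B adjmxD !adjmxM hh; have := mulmxV hu; have := mulVmx hu.
  move: (invmx h0) (adjmx a0) (adjmx a1) (adjmx g) => V b0 b1 gs V1 V2.
  rewrite (mulmxDl (a1 *m h0)) -[a1 *m h0 *m V]mulmxA V2 mulmx1.
  rewrite (mulmxDl a1) !(mulmxDr _ (h0 *m b1)) -!(mulmxA a0) !(mulmxA (g *m V)) -(mulmxA g V h0) V1 mulmx1.
  rewrite !mxtraceD !mulmxA.
  by move: (\tr _) (\tr _) (\tr _) (\tr _) => *; ring.
apply: etrans (scalars _ _ _ _ _ _ _ _ _ _ _ _ _) _.
by apply: congr2; [apply: congr2; [congr (2 * _); exact: esym NE|]|exact: sS].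
Qed.

(** When the rows of a0 are h0-unitary, N h0 is the projection that kills their span. Hence N = N h0
    N^*, and the trace is that of a Gram matrix. *)
Lemma normal_part_ge0 (N := invmx h0 - adjmx a0 *m a0) : a0 *m h0 *m adjmx a0 = 1%:M ->
  0 <= \tr ((a1 *m h0 + a0 *m g) *m N *m adjmx (a1 *m h0 + a0 *m g)).
Proof.
move=> norm; have NN : N *m h0 *m adjmx N = N.
  have -> : adjmx N = N by rewrite /N adjmxB adjmxM adjmxK (adjmx_inv hu hh).
  have -> : N *m h0 = 1%:M - adjmx a0 *m a0 *m h0 by rewrite /N mulmxBl (mulVmx hu).
  rewrite mulmxBl mul1mx {2}/N mulmxBr (mulmxK hu) -!mulmxA [h0 *m _]mulmxA.
  by rewrite [a0 *m (h0 *m _ *m _)]mulmxA [a0 *m (h0 *m _)]mulmxA norm mul1mx subrr subr0.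
rewrite -NN; set Q := _ + _.
rewrite (_ : Q *m _ *m _ = (Q *m N) *m h0 *m adjmx (Q *m N)); first exact: trace_gram_ge0.
by rewrite adjmxM !mulmxA.
Qed.

Lemma pull1_real (w : C) : (\tr (pull1 w (w *: g + w^* *: adjmx g)))^* = \tr (pull1 w (w *: g + w^* *: adjmx g)).
Proof.
by rewrite -mxtrace_adj pull1E adjmxD !adjmxZ adjmxK conjCK addrC.
Qed.

End TraceIdentity.

(** * Second-order coefficients of the log determinant *)

Section DetJets.
Variable R : realType.
Local Notation C := (Cx R).

(** The Hermitian form R(., ., v, vbar), with [g] for the derivative of h along v and [k] for its
    mixed second derivative; see [curvature_termE]. *)
Definition curvature_term n (h0 g k : 'M[C]_n) : 'M[C]_n := g *m invmx h0 *m adjmx g - k.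

Lemma reC_trace_curvature m n (a0 : 'M[C]_(m, n)) (h0 g k : 'M[C]_n) :
  reC (2 * \tr (a0 *m (g *m invmx h0 *m adjmx g) *m adjmx a0)
    - \tr (a0 *m (k + adjmx k) *m adjmx a0))
  = 2 * reC (\tr (a0 *m curvature_term h0 g k *m adjmx a0)).
Proof.
rewrite /curvature_term mulmxBr mulmxBl raddfB /= mulmxDr mulmxDl mxtraceD.
have -> : \tr (a0 *m adjmx k *m adjmx a0) = (\tr (a0 *m k *m adjmx a0))^*.
  by rewrite -mxtrace_adj !adjmxM adjmxK mulmxA.
move: (\tr _) (\tr _) => x y; have h2 : (2 : C) = ofR 2 by rewrite rmorph_nat.
by rewrite reCB h2 reCZ reCD reCJ reCB; ring.
Qed.

(** One format for both sides of the comparison: a normalized Jacobian for f^*h, a constant matrix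
    for g. The suffixes 1 and i refer to the lines t v and t (i v). *)
Record metric_jets (m n : nat) (a1f aif : R -> 'M[C]_(m, n)) (h1f hif : R -> 'M[C]_n)
    (a0 : 'M[C]_(m, n)) (h0 g k : 'M[C]_n) : Prop := MetricJets {
  mj_herm : adjmx h0 = h0;
  mj_pos : forall u, u != 0 -> 0 < herm h0 u u;
  mj_norm : a0 *m h0 *m adjmx a0 = 1%:M;
  mj_a : exists a1 a2, mjet a1f a0 a1 a2 /\ mjet aif a0 ('i *: a1) (- a2);
  mj_h : exists S1 Si, [/\ mjet h1f h0 (g + adjmx g) S1,
    mjet hif h0 ('i *: g - 'i *: adjmx g) Si & S1 + Si = k + adjmx k] }.

(** log(1 + x t + (y + x^2 / 2) t^2) = x t + y t^2 + o(t^2), so x and y are the coefficients of the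
    log determinant. *)
Lemma metric_det_jets m n a1f aif h1f hif (a0 : 'M[C]_(m, n)) (h0 g k : 'M[C]_n) :
  metric_jets a1f aif h1f hif a0 h0 g k ->
  exists (x1 y1 xi yi : C) (B : 'M[C]_(m, n)),
  let N := \tr (B *m (invmx h0 - adjmx a0 *m a0) *m adjmx B) in
  [/\ jet (fun t => \det (a1f t *m h1f t *m adjmx (a1f t))) (quad 1 x1 (y1 + x1 ^+ 2 / 2)),
     jet (fun t => \det (aif t *m hif t *m adjmx (aif t))) (quad 1 xi (yi + xi ^+ 2 / 2)),
     x1^* = x1 /\ xi^* = xi, 0 <= N
   & y1 + yi = 2 * N - (2 * \tr (a0 *m (g *m invmx h0 *m adjmx g) *m adjmx a0)
                         - \tr (a0 *m (k + adjmx k) *m adjmx a0)) ].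
Proof.
move=> [hh hp norm [a1 [a2 [j1 ji]]] [S1 [Si [J1 Ji SS]]]].
have e1 : g + adjmx g = 1 *: g + 1^* *: adjmx g by rewrite rmorph1 !scale1r.
have ei : 'i *: g - 'i *: adjmx g = 'i *: g + 'i^* *: adjmx g by rewrite conjCi scaleNr.
pose X1 := pull1 a0 a1 h0 1 (g + adjmx g); pose Xi := pull1 a0 a1 h0 'i ('i *: g - 'i *: adjmx g).
pose Y1 := pull2 a0 a1 a2 h0 1 (g + adjmx g) S1.
pose Yi := pull2 a0 a1 a2 h0 'i ('i *: g - 'i *: adjmx g) Si.
exists (\tr X1), (\tr Y1 - \tr (X1 *m X1) / 2), (\tr Xi), (\tr Yi - \tr (Xi *m Xi) / 2), (a1 *m h0 + a0 *m g) => N.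
have D1 : mjet (fun t => a1f t *m h1f t *m adjmx (a1f t)) 1%:M X1 Y1.
  have := mjetM (mjetM j1 J1) (mjet_adj j1); rewrite -!/(adjmx _) norm.
  by rewrite /X1 /Y1 /pull1 /pull2 expr1n !scale1r.
have Di : mjet (fun t => aif t *m hif t *m adjmx (aif t)) 1%:M Xi Yi.
  have := mjetM (mjetM ji Ji) (mjet_adj ji); rewrite -!/(adjmx _) norm.
  by rewrite /Xi /Yi /pull1 /pull2 sqrCi !scaleN1r.
split.
- exact: jet_det D1.
- exact: jet_det Di.
- have r1 := @pull1_real _ _ _ a0 a1 h0 g hh 1; rewrite -e1 in r1.
  have ri := @pull1_real _ _ _ a0 a1 h0 g hh 'i; rewrite -ei in ri.
  exact: (conj r1 ri).
- exact: normal_part_ge0.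
have E := trace_identity a0 a1 a2 g hh hp SS.
have comb (x y u v : C) : (x - u / 2) + (y - v / 2) = x + y - (u + v) / 2 by field.
have regroup (x y u : C) : x - y + u = x - (y - u) by ring.
exact: etrans (comb _ _ _ _) (etrans E (regroup _ _ _)).
Qed.

End DetJets.

(** * Determinants of positive Hermitian matrices *)

Section HermitianDeterminant.
Variable R : realType.
Local Notation C := (Cx R).

Lemma hermitian_diagonalization (n : nat) (P : 'M[C]_n) : adjmx P = P ->
  exists (S : 'M[C]_n) (d : 'rV[C]_n), S *m adjmx S = 1%:M /\ S *m P *m adjmx S = diag_mx d.
Proof.
move=> PH; have Pn : P \is normalmx by apply/normalmxP; rewrite -[map_mx _ _]/(adjmx P) PH.
have SU := spectral_unitarymx P; have /orthomx_spectralP E := Pn.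
have SS : spectralmx P *m adjmx (spectralmx P) = 1%:M by apply/unitarymxP.
exists (spectralmx P), (spectral_diag P); split => //.
rewrite [X in _ *m X *m _]E !mulmxA mulmxV ?unitarymx_unit // mul1mx.
by rewrite -mulmxA SS mulmx1.
Qed.

Lemma diag_entry (n : nat) (S P : 'M[C]_n) d : S *m P *m adjmx S = diag_mx d ->
  forall i, d ord0 i = herm P (row i S) (row i S).
Proof. by move=> E i; rewrite -gram_entry E mxE eqxx. Qed.

Lemma unitary_row_neq0 (n : nat) (S : 'M[C]_n) i : S *m adjmx S = 1%:M -> row i S != 0.
Proof.
move=> SS; apply/eqP => r0; have := congr1 (fun X : 'M[C]_n => X i i) SS.
have := gram_entry S 1%:M i i; rewrite mulmx1 => ->.
by rewrite r0 herm_mulmx !mul0mx !mxE eqxx => /esym/eqP; rewrite oner_eq0.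
Qed.

Lemma det_diag_unitary (n : nat) (S P : 'M[C]_n) d : S *m adjmx S = 1%:M ->
  S *m P *m adjmx S = diag_mx d -> \det P = \prod_i d ord0 i.
Proof.
move=> SS E; rewrite -det_diag -E !det_mulmx mulrAC -det_mulmx SS det1 mul1r //.
Qed.

Lemma hermitian_normalization (n : nat) (P : 'M[C]_n) : adjmx P = P ->
  (forall u, u != 0 -> 0 < herm P u u) -> exists L : 'M[C]_n, L *m P *m adjmx L = 1%:M.
Proof.
move=> PH Pp; have [S [d [SS E]]] := hermitian_diagonalization PH.
have dp i : 0 < d ord0 i by rewrite (diag_entry E); apply: Pp; exact: unitary_row_neq0.
pose D : 'M[C]_n := diag_mx (\row_i (sqrtC (d ord0 i))^-1).
have DJ : adjmx D = D.
  apply/matrixP => i j; rewrite adjmxE !mxE eq_sym; case: eqP => [->|_]; last by rewrite rmorph0.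
  rewrite !mulr1n; apply/CrealP; rewrite realV; apply: ger0_real; rewrite sqrtC_ge0; exact: ltW.
exists (D *m S); rewrite adjmxM DJ !mulmxA -[D *m S *m P]mulmxA -[D *m (S *m P) *m adjmx S]mulmxA E.
apply/matrixP => i j; rewrite mul_mx_diag mxE mul_diag_mx !mxE.
case: eqP => [->|_]; last by rewrite !mulr0 mul0r.
rewrite !mulr1n -{2}[d ord0 j]sqrtCK expr2.
by rewrite mulKf ?mulfV // sqrtC_eq0 gt_eqF.
Qed.

(** Each eigenvalue is the value of P on a unit eigenvector, hence at least c. *)
Lemma psd_det_ge (n : nat) (P : 'M[C]_n) (c : R) : adjmx P = P -> 0 <= c ->
  (forall u, ofR c * herm 1%:M u u <= herm P u u) -> ofR c ^+ n <= \det P.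
Proof.
move=> PH c0 Pp; have [S [d [SS E]]] := hermitian_diagonalization PH.
rewrite (det_diag_unitary SS E) -[n in X in X <= _]card_ord -prodr_const.
have c0' : 0 <= ofR c by rewrite -(rmorph0 (@ofR R)) ler_ofR.
apply: ler_prod => i _; rewrite c0' (diag_entry E) (le_trans _ (Pp _)) //.
have -> : herm 1%:M (row i S) (row i S) = 1 by rewrite -gram_entry mulmx1 SS mxE eqxx.
by rewrite mulr1.
Qed.

Lemma psd_det_ge0 (n : nat) (P : 'M[C]_n) : adjmx P = P ->
  (forall u, 0 <= herm P u u) -> 0 <= \det P.
Proof.
move=> PH Pp; have [S [d [SS E]]] := hermitian_diagonalization PH.
by rewrite (det_diag_unitary SS E) prodr_ge0 // => i _; rewrite (diag_entry E).
Qed.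

Lemma pd_det_gt0 (n : nat) (P : 'M[C]_n) : adjmx P = P ->
  (forall u, u != 0 -> 0 < herm P u u) -> 0 < \det P.
Proof.
move=> PH Pp; rewrite lt_def psd_det_ge0 // ?andbT; last by move=> u; exact: herm_ge0.
by have := herm_pos_unit Pp; rewrite unitmxE unitfE.
Qed.

Lemma herm_conj (m n : nat) (X : 'M[C]_(m, n)) (P : 'M[C]_n) u v :
  herm (X *m P *m adjmx X) u v = herm P (u *m X) (v *m X).
Proof. by rewrite !herm_mulmx adjmxM !mulmxA. Qed.

Lemma adjmx_gram (m n : nat) (X : 'M[C]_(m, n)) (P : 'M[C]_n) : adjmx P = P ->
  adjmx (X *m P *m adjmx X) = X *m P *m adjmx X.
Proof. by move=> PH; rewrite !adjmxM adjmxK PH mulmxA. Qed.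

Lemma det_gram (n : nat) (X P : 'M[C]_n) : \det (X *m P *m adjmx X) = `|\det X| ^+ 2 * \det P.
Proof. by rewrite !det_mulmx det_adjmx mulrAC normCK. Qed.

(** A change of basis by L reduces G to the identity and multiplies both determinants by |det
    L|^2. *)
Lemma relative_det_ge (n : nat) (G P : 'M[C]_n) (c : R) : adjmx G = G -> adjmx P = P -> 0 <= c ->
  (forall u, u != 0 -> 0 < herm G u u) -> (forall u, ofR c * herm G u u <= herm P u u) ->
  ofR c ^+ n * \det G <= \det P.
Proof.
move=> GH PH c0 Gp GP; have [L LG] := hermitian_normalization GH Gp.
have := psd_det_ge (adjmx_gram L PH) c0; rewrite det_gram => H.
have e1 : `|\det L| ^+ 2 * \det G = 1 by rewrite -det_gram LG det1.
have l0 : 0 < `|\det L| ^+ 2.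
  rewrite exprn_gt0 // normr_gt0; apply/eqP => L0.
  by move: e1; rewrite L0 normr0 expr0n mul0r => /esym/eqP; rewrite oner_eq0.
rewrite -(ler_pM2l l0) mulrCA e1 mulr1; apply: H => u.
by rewrite -LG !herm_conj.
Qed.

Lemma unitary_frame_free (k n : nat) (G : 'M[C]_n) (E : k.-tuple 'rV[C]_n) :
  unitary_frame G E -> free E.
Proof.
move=> EU; apply/freeP => c c0 i.
have h0 v : herm G 0 v = 0 by rewrite herm_mulmx !mul0mx mxE.
have := h0 (tnth E i); rewrite -c0 herm_mulmx !mulmx_suml summxE (bigD1 i) //= big1 ?addr0.
  by rewrite -!scalemxAl mxE -(tnth_nth 0) -herm_mulmx EU eqxx mulr1.
by move=> j ji; rewrite -!scalemxAl mxE -(tnth_nth 0) -herm_mulmx EU (negPf ji) mulr0.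
Qed.

End HermitianDeterminant.

(** * Ricci traces as matrix traces, and their comparison *)

Section RicciTrace.
Variable R : realType.
Local Notation C := (Cx R).

(** Equal linear terms let the x^2 / 2 cancel, so the log coefficients themselves are ordered.
    Curvature enters them with a minus sign, which reverses the inequality, and the nonnegative
    normal part of the first family is then dropped. *)
Lemma compare_metric_jets m n a1f aif h1f hif (a0 : 'M[C]_(m, n)) (h0 g k : 'M[C]_n)
   b1f bif l1f lif (b0 l0 gl kl : 'M[C]_m) :
  metric_jets a1f aif h1f hif a0 h0 g k -> metric_jets b1f bif l1f lif b0 l0 gl kl ->
  (exists2 d : R, 0 < d & forall t, `|t| < d ->
    reC (\det (a1f t *m h1f t *m adjmx (a1f t))) <= reC (\det (b1f t *m l1f t *m adjmx (b1f t)))) ->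
  (exists2 d : R, 0 < d & forall t, `|t| < d ->
    reC (\det (aif t *m hif t *m adjmx (aif t))) <= reC (\det (bif t *m lif t *m adjmx (bif t)))) ->
  reC (\tr (b0 *m curvature_term l0 gl kl *m adjmx b0))
  <= reC (\tr (a0 *m curvature_term h0 g k *m adjmx a0)).
Proof.
move=> ja jb le1 lei.
have [x1 [y1 [xi [yi [B [J1 Ji [r1 ri] N0 E]]]]]] := metric_det_jets ja.
have [x1' [y1' [xi' [yi' [B' [J1' Ji' [r1' ri'] _ E']]]]]] := metric_det_jets jb.
have realP (x : C) : x^* = x -> imC x = 0 by move=> /(congr1 (@imC R)); rewrite imCJ; lra.
have [p1 q1] := jet_le J1 J1' le1; have [pi qi] := jet_le Ji Ji' lei.
(* [jet_le] gives equality of real parts only; the coefficients are real. *)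
have e1 : x1 = x1' by apply: complex_ext => //; rewrite !realP.
have ei : xi = xi' by apply: complex_ext => //; rewrite !realP.
rewrite e1 !reCD lerD2r in q1; rewrite ei !reCD lerD2r in qi.
have := lerD q1 qi; rewrite -!reCD E E'.
(* In the second family the frame matrix is square, so its rows span everything and there is no
   normal part. *)
have -> : invmx l0 - adjmx b0 *m b0 = 0.
  have bu : b0 *m (l0 *m adjmx b0) = 1%:M by rewrite mulmxA (mj_norm jb).
  have lu := herm_pos_unit (mj_pos jb).
  apply/eqP; rewrite subr_eq0 eq_sym; apply/eqP; apply: (can_inj (mulKmx lu)).
  by rewrite mulmxV // mulmxA (mulmx1C bu).
rewrite mulmx0 mul0mx mxtrace0 mulr0 sub0r reCN reCB !reC_trace_curvature.
have : 0 <= reC (\tr (B *m _ *m adjmx B)) := reC_le N0.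
have h2 : (2 : C) = ofR 2 by rewrite rmorph_nat.
by rewrite {1}h2 reCZ; move: (reC _) (reC _) (reC _) => x y z; lra.
Qed.

Definition frame_mx (k n : nat) (E : k.-tuple 'rV[C]_n) : 'M[C]_(k, n) := \matrix_i tnth E i.

Lemma unitary_frame_mx (k n : nat) (X : 'M[C]_(k, n)) (G : 'M[C]_n) :
  X *m G *m adjmx X = 1%:M -> unitary_frame G [tuple row i X | i < k].
Proof. by move=> E i j; rewrite !tnth_mktuple -gram_entry E mxE. Qed.

Lemma frame_mx_rows (k n : nat) (X : 'M[C]_(k, n)) : frame_mx [tuple row i X | i < k] = X.
Proof. by apply/row_matrixP => i; rewrite rowK tnth_mktuple. Qed.

Let sum_factor (I J : finType) (u v : J -> C) (X Y : J -> I -> C) (Z : I -> I -> C) :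
  \sum_c \sum_d (\sum_p \sum_q X c q * Z q p * Y d p) * u c * v d
  = \sum_p (\sum_q (\sum_c u c * X c q) * Z q p) * (\sum_d v d * Y d p).
Proof.
transitivity (\sum_c \sum_d \sum_p \sum_q X c q * Z q p * Y d p * u c * v d).
  by apply: eq_bigr => c _; apply: eq_bigr => d _; rewrite !mulr_suml; apply: eq_bigr => p _; rewrite !mulr_suml.
under eq_bigr do rewrite exchange_big.
rewrite exchange_big; apply: eq_bigr => p _ /=.
rewrite mulr_suml; under eq_bigr do rewrite exchange_big.
rewrite exchange_big; apply: eq_bigr => q _ /=.
rewrite mulrAC mulr_suml mulr_suml; apply: eq_bigr => c _.
rewrite mulr_sumr mulr_suml; apply: eq_bigr => d _; ring.
Qed.

Variables (n : nat) (A : set 'rV[C]_n) (h : 'rV[C]_n -> 'M[C]_n).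
Hypothesis Ao : open A.
Hypothesis hS : forall a b, csmooth_on A (fun y => h y a b).
Hypothesis hH : forall y, A y -> forall a b, h y b a = (h y a b)^*.
Variables (z u : 'rV[C]_n).
Hypothesis Az : A z.

Lemma curvature_termE a b : curvature_term (h z) (dz_mx h z u) (dzdzbar_mx h z u) a b
  = \sum_c \sum_d curv_coef h z a b c d * u ord0 c * (u ord0 d)^*.
Proof.
have E : \sum_c \sum_d curv_coef h z a b c d * u ord0 c * (u ord0 d)^*
  = \sum_c \sum_d (\sum_p \sum_q ddz c (fun y => h y a q) z * invmx (h z) q p
                  * ddzbar d (fun y => h y p b) z) * u ord0 c * (u ord0 d)^*
  - \sum_c \sum_d u ord0 c * (u ord0 d)^* * ddz c (ddzbar d (fun y => h y a b)) z.
  rewrite -sumrB; apply: eq_bigr => c _; rewrite -sumrB; apply: eq_bigr => d _.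
  rewrite /curv_coef; set s := \sum_p _; set t := ddz _ _ _; rewrite !mulrDl addrC; congr (_ + _).
  by rewrite !mulNr -mulrA mulrC.
rewrite E sum_factor /curvature_term.
have mB (X Y : 'M[C]_n) : (X - Y) a b = X a b - Y a b by rewrite !mxE.
rewrite mB; congr (_ - _); last by rewrite mxE.
rewrite mxE; apply: eq_bigr => p _; rewrite -(dzbar_mxE Ao hS hH u Az); congr (_ * _).
by rewrite mxE; apply: eq_bigr => q _; congr (_ * _); rewrite mxE.
Qed.

Lemma ricci_trace_mx (k : nat) (E : k.-tuple 'rV[C]_n) : ricci_trace h z E u
  = \tr (frame_mx E *m curvature_term (h z) (dz_mx h z u) (dzdzbar_mx h z u) *m adjmx (frame_mx E)).
Proof.
rewrite /ricci_trace /mxtrace; apply: eq_bigr => i _; rewrite gram_entry rowK /curv /herm.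
apply: eq_bigr => a _; apply: eq_bigr => b _; rewrite curvature_termE !mulr_suml.
apply: eq_bigr => c _; rewrite !mulr_suml; apply: eq_bigr => d _.
move: (curv_coef _ _ _ _ _ _) (tnth E i ord0 a) ((tnth E i ord0 b)^*) (u ord0 c) ((u ord0 d)^*) => *; ring.
Qed.

End RicciTrace.

(** * The inequality at a maximum point, in coordinates *)

Section LocalEstimate.
Variable R : realType.
Local Notation C := (Cx R).

Lemma fin_near (I : finType) (P : I -> R -> Prop) :
  (forall i, exists2 d : R, 0 < d & forall t : R, `|t| < d -> P i t) ->
  exists2 d : R, 0 < d & forall t : R, `|t| < d -> forall i, P i t.
Proof.
move=> H; have D i : {d : R | 0 < d /\ forall t : R, `|t| < d -> P i t}.
  by apply: cid; have [d d0 Hd] := H i; exists d.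
exists (\big[Num.min/1]_i sval (D i)); first by apply: lt_bigmin => // i _; case: (svalP (D i)).
move=> t td i; apply: (svalP (D i)).2; apply: lt_le_trans td _; exact: bigmin_le_cond.
Qed.

(** Evaluating a complex expansion at i t multiplies its coefficients by 1, i and -1. *)
Lemma jet_quad_complex (phi : C -> C) (a b c : C) :
  (forall e, 0 < e -> exists2 d : R, 0 < d & forall t : C, cabs t < d ->
     cabs (phi t - a - b * t - c * t ^+ 2) <= e * cabs t ^+ 2) ->
  jet (fun t => phi (ofR t)) (quad a b c) /\
  jet (fun t => phi (ofR t * 'i)) (quad a ('i * b) (- c)).
Proof.
move=> H; split=> e /H [d d0 Hd]; exists d => // t td.
  have := Hd (ofR t); rewrite cabs_ofR => /(_ td); rewrite real_normK ?num_real // horner_quad.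
  by rewrite -!addrA -!opprD !addrA.
have ct : cabs (ofR t * 'i : C) = `|t| by rewrite cabsM cabs_i mulr1 cabs_ofR.
have := Hd (ofR t * 'i); rewrite ct => /(_ td); rewrite real_normK ?num_real // horner_quad.
rewrite (_ : phi _ - a - _ - _ = phi (ofR t * 'i) - (a + 'i * b * ofR t + - c * ofR t ^+ 2)) //.
rewrite exprMn sqrCi; ring.
Qed.

Lemma line_curve_jet n (z v : 'rV[C]_n) : curve_jet (fun t => z + ofR t *: v) z v 0.
Proof.
move=> e e0; exists 1 => // t _; rewrite scaler0 subr0 addrAC addrK subrr nrm0.
by rewrite mulr_ge0 ?sqr_ge0 // ltW.
Qed.

Lemma mjet_scale (m n : nat) (L : 'M[C]_m) (Phi : R -> 'M[C]_(m, n)) X0 X1 X2 : mjet Phi X0 X1 X2 ->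
  mjet (fun t => L *m Phi t) (L *m X0) (L *m X1) (L *m X2).
Proof. by move=> H; have := mjetM (mjet_cst L) H; rewrite !mul0mx !addr0. Qed.

Section HolomorphicJets.
Variables (m n : nat) (F : 'rV[C]_m -> 'rV[C]_n) (J : 'rV[C]_m -> 'M[C]_(m, n)).
Variables (z0 : 'rV[C]_m) (rho : R).
Hypothesis rho0 : 0 < rho.
Hypothesis FJ : forall v, nrm v < rho -> mdiff F (z0 + v) (J (z0 + v)).

Lemma jacobian_mjets v : exists a1 a2, mjet (fun t => J (z0 + ofR t *: v)) (J z0) a1 a2 /\
  mjet (fun t => J (z0 + ofR t *: ('i *: v))) (J z0) ('i *: a1) (- a2).
Proof.
have [f Hf] : {f : 'I_m * 'I_n -> C * C & forall p,
   jet (fun t => J (z0 + ofR t *: v) p.1 p.2) (quad (J z0 p.1 p.2) (f p).1 (f p).2) /\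
   jet (fun t => J (z0 + ofR t *: ('i *: v)) p.1 p.2) (quad (J z0 p.1 p.2) ('i * (f p).1) (- (f p).2))}.
  apply: (@choice _ _ (fun p (a : C * C) =>
    jet (fun t => J (z0 + ofR t *: v) p.1 p.2) (quad (J z0 p.1 p.2) a.1 a.2) /\
    jet (fun t => J (z0 + ofR t *: ('i *: v)) p.1 p.2) (quad (J z0 p.1 p.2) ('i * a.1) (- a.2)))) => p.
  have [a1 [a2 H]] := hol_line_jacobian_jet rho0 FJ v p.1 p.2.
  have [h1 h2] := jet_quad_complex (phi := fun t => J (z0 + t *: v) p.1 p.2) H.
  exists (a1, a2); split=> //.
  by under eq_fun do rewrite scalerA.
exists (\matrix_(i, j) (f (i, j)).1), (\matrix_(i, j) (f (i, j)).2); split=> i j; rewrite !mxE.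
  exact: (Hf (i, j)).1.
exact: (Hf (i, j)).2.
Qed.

Lemma map_curve_jets v : exists q, curve_jet (fun t => F (z0 + ofR t *: v)) (F z0) (v *m J z0) q /\
  curve_jet (fun t => F (z0 + ofR t *: ('i *: v))) (F z0) ('i *: (v *m J z0)) (- q).
Proof.
pose u := v *m J z0.
have [q Hq] : {q : 'I_n -> C & forall j,
   jet (fun t => F (z0 + ofR t *: v) ord0 j) (quad (F z0 ord0 j) (u ord0 j) (q j)) /\
   jet (fun t => F (z0 + ofR t *: ('i *: v)) ord0 j) (quad (F z0 ord0 j) ('i * u ord0 j) (- q j))}.
  apply: (@choice _ _ (fun j (a : C) =>
   jet (fun t => F (z0 + ofR t *: v) ord0 j) (quad (F z0 ord0 j) (u ord0 j) a) /\
   jet (fun t => F (z0 + ofR t *: ('i *: v)) ord0 j) (quad (F z0 ord0 j) ('i * u ord0 j) (- a)))) => j.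
  have [a2 H] := hol_line_jet rho0 FJ v j; exists a2.
  have [h1 h2] := jet_quad_complex (phi := fun t => F (z0 + t *: v) ord0 j) H.
  split=> //; by under eq_fun do rewrite scalerA.
have conv (w : R -> 'rV[C]_n) (x y : 'rV[C]_n) :
    (forall j, jet (fun t => w t ord0 j) (quad (F z0 ord0 j) (x ord0 j) (y ord0 j))) ->
    curve_jet w (F z0) x y.
  move=> H e e0; have e1 : 0 < e / n.+1%:R by rewrite divr_gt0.
  have [d d0 Hd] := @fin_near _ (fun j t => cabs (w t ord0 j - (quad (F z0 ord0 j) (x ord0 j) (y ord0 j)).[ofR t]) <= e / n.+1%:R * t ^+ 2) (fun j => H j _ e1).
  exists d => // t /Hd {}Hd; rewrite /nrm.
  apply: le_trans (_ : \sum_(j < n) e / n.+1%:R * t ^+ 2 <= _).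
    apply: ler_sum => j _; apply: le_trans (Hd j); rewrite horner_quad !mxE -rmorphXn /=.
    by rewrite le_eqVlt; apply/orP; left; apply/eqP; congr cabs; ring.
  rewrite sumr_const card_ord -[_ *+ _]mulr_natr mulrAC ler_wpM2r ?sqr_ge0 //.
  by rewrite mulrAC ler_pdivrMr // ler_wpM2l ?(ltW e0) // ler_nat.
have qE j : (\row_j q j) ord0 j = q j by rewrite mxE.
exists (\row_j q j); split; apply: conv => j; first by rewrite qE; exact: (Hq j).1.
have scE : ('i *: u) ord0 j = 'i * u ord0 j by rewrite mxE.
have opE (x : 'rV[C]_n) : (- x) ord0 j = - x ord0 j by rewrite mxE.
by rewrite -/u scE opE qE; exact: (Hq j).2.
Qed.

End HolomorphicJets.

Section MetricJets.
Variables (n : nat) (A : set 'rV[C]_n) (h : 'rV[C]_n -> 'M[C]_n).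
Hypothesis Ao : open A.
Hypothesis hS : forall a b, csmooth_on A (fun y => h y a b).
Hypothesis hH : forall y, A y -> forall a b, h y b a = (h y a b)^*.
Hypothesis hp : forall y, A y -> forall u, u != 0 -> 0 < herm (h y) u u.

Lemma adjmx_metric y : A y -> adjmx (h y) = h y.
Proof. by move=> Ay; apply/matrixP => a b; rewrite adjmxE -(hH Ay). Qed.

Lemma metric_jetsP m z u q (w1 wi : R -> 'rV[C]_n) (a1f aif : R -> 'M[C]_(m, n)) a0 a1 a2 :
  A z -> curve_jet w1 z u q -> curve_jet wi z ('i *: u) (- q) ->
  mjet a1f a0 a1 a2 -> mjet aif a0 ('i *: a1) (- a2) -> a0 *m h z *m adjmx a0 = 1%:M ->
  metric_jets a1f aif (fun t => h (w1 t)) (fun t => h (wi t)) a0 (h z) (dz_mx h z u) (dzdzbar_mx h z u).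
Proof.
move=> Az j1 ji J1 Ji norm; split=> //.
- exact: adjmx_metric.
- exact: hp.
- by exists a1, a2.
exact: (hermitian_curve_jets Ao hS hH Az j1 ji).
Qed.

End MetricJets.

Let normalized_le (a b x y x0 y0 : C) : a * x0 = 1 -> b * y0 = 1 -> 0 <= a * b ->
  x * y0 <= x0 * y -> a * x <= b * y.
Proof.
move=> ax by0 ab le; have := ler_wpM2l ab le.
have -> : a * b * (x * y0) = a * x * (b * y0) by ring.
have -> : a * b * (x0 * y) = a * x0 * (b * y) by ring.
by rewrite ax by0 mulr1 mul1r.
Qed.

(** [P] is the matrix of f^*h, and maximality of det P / det G is stated with denominators cleared.
    The Ricci curvature of M in the direction v is at most the curvature of N traced over the image
    of df in the direction df v; the two curvature hypotheses bound the ends of this chain. *)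
Lemma local_estimate (m n : nat) (U : set 'rV[C]_m) (W : set 'rV[C]_n)
    (G : 'rV[C]_m -> 'M[C]_m) (H : 'rV[C]_n -> 'M[C]_n)
    (F : 'rV[C]_m -> 'rV[C]_n) (J : 'rV[C]_m -> 'M[C]_(m, n)) z0 (rho K kappa : R)
    (P := fun z => J z *m H (F z) *m adjmx (J z)) :
  open U -> open W -> U z0 -> W (F z0) ->
  (forall a b, csmooth_on U (fun y => G y a b)) ->
  (forall y, U y -> forall a b, G y b a = (G y a b)^*) ->
  (forall y, U y -> forall u, u != 0 -> 0 < herm (G y) u u) ->
  (forall a b, csmooth_on W (fun y => H y a b)) ->
  (forall y, W y -> forall a b, H y b a = (H y a b)^*) ->
  (forall y, W y -> forall u, u != 0 -> 0 < herm (H y) u u) ->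
  0 < rho -> (forall v, nrm v < rho -> mdiff F (z0 + v) (J (z0 + v))) ->
  0 < \det (P z0) ->
  (exists2 d : R, 0 < d & forall v, nrm v < d ->
    \det (P (z0 + v)) * \det (G z0) <= \det (P z0) * \det (G (z0 + v))) ->
  (forall E : m.-tuple 'rV[C]_m, basis_of fullv E -> unitary_frame (G z0) E ->
    forall X, ofR K * herm (G z0) X X <= ricci_trace G z0 E X) ->
  (forall S : {vspace 'rV[C]_n}, \dim S = m -> forall E : m.-tuple 'rV[C]_n,
    basis_of S E -> unitary_frame (H (F z0)) E -> forall v, v \in S ->
    ricci_trace H (F z0) E v <= ofR kappa * herm (H (F z0)) v v) ->
  forall v, ofR K * herm (G z0) v v <= ofR kappa * herm (P z0) v v.
Proof.
move=> Uo Wo Uz Wz GS GH Gp HS HH Hp rho0 FJ detP Hmax ricM ricN v.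
have PH : adjmx (P z0) = P z0 by apply: adjmx_gram; exact: adjmx_metric HH _ Wz.
(* A vector killed by the Jacobian is killed by [P z0], which is invertible by [detP]. *)
have Pp u : u != 0 -> 0 < herm (P z0) u u.
  move=> u0; rewrite herm_conj; apply: (Hp _ Wz); apply/eqP => uJ.
  have Pu : P z0 \in unitmx by rewrite unitmxE unitfE gt_eqF.
  move/eqP: u0; apply; apply: (can_inj (mulmxK Pu)).
  by rewrite mul0mx /P !mulmxA uJ !mul0mx.
(* Multiplying by the constants |det L|^2 and |det M|^2 makes both determinants equal to 1 at z0, so
   that [jet_le] applies. *)
have [L LP] := hermitian_normalization PH Pp.
have [M MG] := hermitian_normalization (adjmx_metric GH Uz) (Gp _ Uz).
have [a1 [a2 [A1 Ai]]] := jacobian_mjets rho0 FJ v.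
have [q [c1 ci]] := map_curve_jets rho0 FJ v.
have nL : L *m J z0 *m H (F z0) *m adjmx (L *m J z0) = 1%:M.
  by rewrite -LP /P adjmxM !mulmxA.
have A1' := mjet_scale L A1; have Ai' := mjet_scale L Ai.
rewrite -scalemxAr mulmxN in Ai'.
have jP := metric_jetsP Wo HS HH Hp Wz c1 ci A1' Ai' nL.
(* g is handled as its own pull-back by the identity map: a straight line with zero acceleration,
   and the constant matrix [M]. The rewrites give the zeros the shapes expected by
   [metric_jetsP]. *)
have l1 := line_curve_jet z0 v; have li := line_curve_jet z0 ('i *: v); rewrite -[X in curve_jet _ _ _ X]oppr0 in li.
have B1 := mjet_cst M; have Bi := B1; rewrite -{1}(scaler0 _ 'i) -[X in mjet _ _ _ X]oppr0 in Bi.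
have jG := metric_jetsP Uo GS GH Gp Uz l1 li B1 Bi MG.
have detn : `|\det L| ^+ 2 * \det (P z0) = 1 by rewrite -det_gram LP det1.
have detm : `|\det M| ^+ 2 * \det (G z0) = 1 by rewrite -det_gram MG det1.
have cmp u : exists2 d : R, 0 < d & forall t : R, `|t| < d ->
    reC (\det (L *m J (z0 + ofR t *: u) *m H (F (z0 + ofR t *: u)) *m adjmx (L *m J (z0 + ofR t *: u))))
    <= reC (\det (M *m G (z0 + ofR t *: u) *m adjmx M)).
  have [d d0 Hd] := Hmax; have k0 : 0 < nrm u + 1 by rewrite ltr_wpDl ?nrm_ge0.
  exists (d / (nrm u + 1)); first by rewrite divr_gt0.
  move=> t; rewrite ltr_pdivlMr // => td.
  have /Hd le : nrm (ofR t *: u) < d.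
    by apply: le_lt_trans td; rewrite nrmZ cabs_ofR ler_wpM2l // lerDl.
  set y := z0 + ofR t *: u in le *.
  have -> : L *m J y *m H (F y) *m adjmx (L *m J y) = L *m P y *m adjmx L.
    by rewrite /P adjmxM !mulmxA.
  rewrite !det_gram.
  suff : `|\det L| ^+ 2 * \det (P y) <= `|\det M| ^+ 2 * \det (G y) by exact: reC_le.
  have w0 : 0 <= `|\det L| ^+ 2 * `|\det M| ^+ 2 by rewrite mulr_ge0 // exprn_ge0.
  exact: normalized_le detn detm w0 le.
have ricci_le := compare_metric_jets jP jG (cmp v) (cmp ('i *: v)).
pose EM := [tuple row i M | i < m]; pose EN := [tuple row i (L *m J z0) | i < m].
have UM : unitary_frame (G z0) EM := unitary_frame_mx MG.
have UN : unitary_frame (H (F z0)) EN := unitary_frame_mx nL.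
have fM := unitary_frame_free UM; have fN := unitary_frame_free UN.
have bM : basis_of fullv EM.
  by rewrite basisEfree fM subvf dimvf dim_matrix size_tuple /= mul1r leqnn.
have rM := ricM EM bM UM v.
have bN : basis_of <<EN>>%VS EN by rewrite /basis_of fN eqxx.
have dN : \dim <<EN>> = m by move: fN; rewrite /free => /eqP ->; rewrite size_tuple.
have Lu : L \in unitmx.
  by have [] : L \in unitmx /\ P z0 *m adjmx L \in unitmx by apply/andP; rewrite -unitmx_mul mulmxA LP unitmx1.
(* The rows of L J form a unitary frame of the image of df, because [L] is invertible; this image is
   the m-dimensional subspace to which the m-Ricci bound is applied. *)
have vS : v *m J z0 \in <<EN>>%VS.
  have -> : v *m J z0 = (v *m invmx L) *m (L *m J z0) by rewrite mulmxA mulmxKV.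
  rewrite mulmx_sum_row; apply: memv_suml => i _; apply: memvZ; apply: memv_span.
  by apply/tnthP; exists i; rewrite tnth_mktuple.
have rN := ricN <<EN>>%VS dN EN bN UN _ vS.
rewrite (ricci_trace_mx Uo GS GH v Uz) frame_mx_rows in rM.
rewrite (ricci_trace_mx Wo HS HH (v *m J z0) Wz) frame_mx_rows in rN.
have rM' := reC_le rM; have rN' := reC_le rN.
have := le_trans rM' (le_trans ricci_le rN'); rewrite -herm_conj -/(P z0).
have real_herm (Q : 'M[C]_m) : (forall u, u != 0 -> 0 < herm Q u u) -> herm Q v v = ofR (reC (herm Q v v)).
  move=> Qp; have := herm_ge0 v Qp; rewrite lecE => /andP[/eqP im0 _].
  by apply: complex_ext; rewrite ?reC_ofR ?imC_ofR //.
rewrite (real_herm _ (Gp _ Uz)) (real_herm _ Pp) -!rmorphM !reC_ofR => le.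
by rewrite ler_ofR.
Qed.

End LocalEstimate.

(** * Charts and the volume ratio *)

Section PointContinuity.
Variables (R : realType) (n : nat).
Local Notation C := (Cx R).
Local Notation V := ('rV[Cx R]_n).
Implicit Types (phi psi : V -> C) (z : V).

Definition ccont phi z := forall e : R, 0 < e -> exists2 d : R, 0 < d &
  forall v, nrm v < d -> cabs (phi (z + v) - phi z) <= e.

Lemma ccont_cst (c : C) z : ccont (fun=> c) z.
Proof. by move=> e e0; exists 1 => // v _; rewrite subrr cabs0 ltW. Qed.

Lemma ccontD phi psi z : ccont phi z -> ccont psi z -> ccont (fun y => phi y + psi y) z.
Proof.
move=> H1 H2 e e0; have e2 : 0 < e / 2 by rewrite divr_gt0.
have [d d0 Hd] := H1 _ e2; have [d' d'0 Hd'] := H2 _ e2.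
exists (Num.min d d'); first by rewrite lt_min d0.
move=> v; rewrite lt_min => /andP[/Hd h1 /Hd' h2]; rewrite opprD addrACA.
by apply: le_trans (cabsD _ _) _; rewrite (splitr e) lerD.
Qed.

Lemma ccontM phi psi z : ccont phi z -> ccont psi z -> ccont (fun y => phi y * psi y) z.
Proof.
move=> H1 H2 e e0; pose k := cabs (phi z) + cabs (psi z) + 1.
have k0 : 0 < k by rewrite ltr_wpDl ?addr_ge0 ?cabs_ge0.
have e2 : 0 < Num.min 1 (e / (2 * k)) by rewrite lt_min ltr01 divr_gt0 // mulr_gt0.
have [d d0 Hd] := H1 _ e2; have [d' d'0 Hd'] := H2 _ e2.
exists (Num.min d d'); first by rewrite lt_min d0.
move=> v; rewrite lt_min => /andP[/Hd h1 /Hd' h2].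
move: h1 h2; set e' := Num.min _ _ => h1 h2.
have e'1 : e' <= 1 by rewrite ge_min lexx.
have e'k : e' * k <= e / 2.
  apply: le_trans (ler_wpM2r (ltW k0) (_ : e' <= e / (2 * k))) _; first by rewrite ge_min lexx orbT.
  by rewrite invfM mulrA divfK // gt_eqF.
have pk : cabs (phi z) <= k by rewrite /k -addrA lerDl addr_ge0 ?cabs_ge0.
have qk : cabs (psi (z + v)) <= k.
  rewrite -(subrK (psi z) (psi (z + v))); apply: le_trans (cabsD _ _) _.
  have := le_trans h2 e'1; have := cabs_ge0 (phi z); rewrite /k; lra.
rewrite (_ : _ - _ = (phi (z + v) - phi z) * psi (z + v) + phi z * (psi (z + v) - psi z)); last by ring.
apply: le_trans (cabsD _ _) _; rewrite !cabsM (splitr e); apply: lerD.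
  by apply: le_trans (ler_pM (cabs_ge0 _) (cabs_ge0 _) h1 qk) _.
by apply: le_trans (ler_pM (cabs_ge0 _) (cabs_ge0 _) pk h2) _; rewrite mulrC.
Qed.

Lemma ccontJ phi z : ccont phi z -> ccont (fun y => (phi y)^*) z.
Proof. by move=> H e /H [d d0 Hd]; exists d => // v /Hd; rewrite -rmorphB cabsJ. Qed.

Lemma ccontV phi z : phi z != 0 -> ccont phi z -> ccont (fun y => (phi y)^-1) z.
Proof.
rewrite -cabs_gt0 => p0 H e e0; set p := cabs (phi z) in p0.
have e1 : 0 < Num.min (p / 2) (e * (p / 2) * p) by rewrite lt_min !(divr_gt0, mulr_gt0).
have [d d0 Hd] := H _ e1; exists d => // v /Hd; rewrite le_min => /andP[h1 h2].
have pv : p / 2 <= cabs (phi (z + v)).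
  have := cabsD (phi (z + v)) (phi z - phi (z + v)); rewrite [X in cabs X <= _]addrC subrK cabsC -/p; lra.
have pv0 : 0 < cabs (phi (z + v)) by apply: lt_le_trans pv; rewrite divr_gt0.
have n1 : phi (z + v) != 0 by rewrite -cabs_gt0.
have n2 : phi z != 0 by rewrite -cabs_gt0.
rewrite (_ : _ - _ = (phi z - phi (z + v)) * ((phi (z + v))^-1 * (phi z)^-1)); last by field; rewrite n1 n2.
rewrite cabsM cabsC cabsM !cabsV -/p -invfM ler_pdivrMr ?mulr_gt0 //.
apply: le_trans h2 _; rewrite -mulrA; apply: ler_wpM2l; first exact: ltW.
by apply: ler_wpM2r => //; exact: ltW.
Qed.

Lemma ccont_sum (I : Type) (r : seq I) (phi : I -> V -> C) z :
  (forall i, ccont (phi i) z) -> ccont (fun y => \sum_(i <- r) phi i y) z.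
Proof.
move=> H; elim: r => [|i r IH]; first by under eq_fun do rewrite big_nil; exact: ccont_cst.
by under eq_fun do rewrite big_cons; exact: (ccontD (H i) IH).
Qed.

Lemma ccont_prod (I : Type) (r : seq I) (phi : I -> V -> C) z :
  (forall i, ccont (phi i) z) -> ccont (fun y => \prod_(i <- r) phi i y) z.
Proof.
move=> H; elim: r => [|i r IH]; first by under eq_fun do rewrite big_nil; exact: ccont_cst.
by under eq_fun do rewrite big_cons; exact: (ccontM (H i) IH).
Qed.

Definition mxcont m p (Phi : V -> 'M[C]_(m, p)) z := forall i j, ccont (fun y => Phi y i j) z.

Lemma mxcontM m p q (Phi : V -> 'M[C]_(m, p)) (Psi : V -> 'M[C]_(p, q)) z :
  mxcont Phi z -> mxcont Psi z -> mxcont (fun y => Phi y *m Psi y) z.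
Proof.
move=> H1 H2 i j; under eq_fun do rewrite mxE.
apply: (ccont_sum _ (phi := fun k y => Phi y i k * Psi y k j)) => k.
exact: (ccontM (H1 i k) (H2 k j)).
Qed.

Lemma mxcont_adj m p (Phi : V -> 'M[C]_(m, p)) z : mxcont Phi z -> mxcont (fun y => adjmx (Phi y)) z.
Proof. by move=> H i j; under eq_fun do rewrite adjmxE; exact: (ccontJ (H j i)). Qed.

Lemma ccont_det m (Phi : V -> 'M[C]_m) z : mxcont Phi z -> ccont (fun y => \det (Phi y)) z.
Proof.
move=> H; rewrite /determinant; apply: (ccont_sum _ (phi := fun (s : 'S_m) y => (-1) ^+ s * \prod_i Phi y i (s i))) => s.
apply: (ccontM (phi := fun=> (-1) ^+ s) (psi := fun y => \prod_i Phi y i (s i))); first exact: ccont_cst.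
by apply: (ccont_prod _ (phi := fun i y => Phi y i (s i))) => i; exact: H.
Qed.

Lemma csmooth_ccont A phi z : csmooth_on A phi -> A z -> ccont phi z.
Proof.
move=> [hr hi] Az e e0; have e2 : 0 < e / 2 by rewrite divr_gt0.
have /rcontinuous_nrm /(_ _ e2) [d d0 Hd] := smooth_cont hr Az.
have /rcontinuous_nrm /(_ _ e2) [d' d'0 Hd'] := smooth_cont hi Az.
exists (Num.min d d'); first by rewrite lt_min d0.
move=> v; rewrite lt_min => /andP[/Hd /= h1 /Hd' /= h2].
apply: le_trans (cabs_le _) _; rewrite reCB imCB (splitr e).
by apply: lerD; exact: ltW.
Qed.

End PointContinuity.

Lemma ccont_comp (R : realType) m n (F : 'rV[Cx R]_m -> 'rV[Cx R]_n) (phi : 'rV[Cx R]_n -> Cx R) z J :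
  mdiff F z J -> ccont phi (F z) -> ccont (fun y => phi (F y)) z.
Proof.
move=> HF H e /H [d d0 Hd]; have d20 : 0 < d / 2 by rewrite divr_gt0.
have [d' d'0 Hd'] := mdiff_continuous HF d20; exists d' => // v /Hd' h.
have := Hd (F (z + v) - F z); rewrite [F z + _]addrC subrK; apply.
by apply: le_lt_trans h _; lra.
Qed.

Section Charts.
Variable R : realType.
Local Notation C := (Cx R).

Lemma param_near n (M : complex_manifold R n) (i : chart_index M) x (A : set M) :
  chart_dom i x -> nbhs x A -> exists2 d : R, 0 < d & forall v, nrm v < d ->
  [/\ chart_dom i (param i (chart i x + v)), A (param i (chart i x + v)) &
      chart i (param i (chart i x + v)) = chart i x + v].
Proof.
move=> ix xA; have zi : (chart i @` chart_dom i) (chart i x) by exists x.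
have pc := param_continuous zi; rewrite /prop_for /continuous_at coordK // in pc.
have /nbhs_nrmP [d d0 Hd] := pc _ xA.
have /nbhs_nrmP [d' d'0 Hd'] : nbhs (chart i x) (chart i @` chart_dom i).
  by apply: open_nbhs_nbhs; split=> //; exact: image_open.
exists (Num.min d d'); first by rewrite lt_min d0.
move=> v; rewrite lt_min => /andP[/Hd Av /Hd' [y iy E]].
by rewrite -E coordK //; split=> //; move: Av; rewrite /= -E coordK.
Qed.

Lemma nbhs_chart_dom n (M : complex_manifold R n) (i : chart_index M) x :
  chart_dom i x -> nbhs x (chart_dom i).
Proof. by move=> ix; apply: open_nbhs_nbhs; split=> //; exact: dom_open. Qed.

Lemma coord_near n (M : complex_manifold R n) (i : chart_index M) x (d : R) :
  chart_dom i x -> 0 < d -> nbhs x [set y | nrm (chart i y - chart i x) < d].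
Proof.
move=> ix d0; have cc := Defs.coord_continuous ix; rewrite /prop_for /continuous_at in cc.
apply: (cc [set w | nrm (w - chart i x) < d]); apply/nbhs_nrmP; exists d => // v vd.
by rewrite /= addrAC subrr add0r.
Qed.

Definition transition_jac n (M : complex_manifold R n) (i i' : chart_index M) z :=
  jacobian (chart i' \o param i) z.

Lemma transition_mdiff n (M : complex_manifold R n) (i i' : chart_index M) x :
  chart_dom i x -> chart_dom i' x ->
  mdiff (fun z => chart i' (param i z)) (chart i x) (transition_jac i i' (chart i x)).
Proof. by move=> ix i'x; exact: differentiable_mdiff (transition_holomorphic ix i'x). Qed.

Section Maps.
Variables (m n : nat) (M : complex_manifold R m) (N : complex_manifold R n) (f : M -> N).
Hypothesis fH : holomorphic_map f.

Definition local_map (i : chart_index M) (j : chart_index N) : 'rV[C]_m -> 'rV[C]_n :=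
  fun z => chart j (f (param i z)).

Definition local_jac (i : chart_index M) (j : chart_index N) z :=
  jacobian (chart j \o f \o param i) z.

Lemma local_mdiff i j x : chart_dom i x -> chart_dom j (f x) ->
  mdiff (local_map i j) (chart i x) (local_jac i j (chart i x)).
Proof. by move=> ix jx; exact: differentiable_mdiff (fH.2 _ _ _ ix jx). Qed.

Lemma local_map_near i j x (A : set M) : chart_dom i x -> chart_dom j (f x) -> nbhs x A ->
  exists2 d : R, 0 < d & forall v, nrm v < d -> exists2 y,
  [/\ chart_dom i y, chart_dom j (f y) & A y] & chart i y = chart i x + v /\ y = param i (chart i x + v).
Proof.
move=> ix jx xA; have xj : nbhs x (A `&` f @^-1` chart_dom j).
  by apply: filterI => //; apply: fH.1; exact: nbhs_chart_dom.
have [d d0 Hd] := param_near ix xj; exists d => // v /Hd [iv [Av jv] E].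
by exists (param i (chart i x + v)).
Qed.

Lemma local_map_image i j x : chart_dom i x -> chart_dom j (f x) ->
  chart_image j (local_map i j (chart i x)).
Proof. by move=> ix jx; exists (f x); rewrite // /local_map coordK. Qed.

Lemma local_mdiff_near i j x : chart_dom i x -> chart_dom j (f x) ->
  exists2 d : R, 0 < d & forall v, nrm v < d ->
  mdiff (local_map i j) (chart i x + v) (local_jac i j (chart i x + v)).
Proof.
move=> ix jx; have [d d0 Hd] := local_map_near ix jx filterT.
exists d => // v /Hd [y [iy jy _] [<- _]]; exact: local_mdiff.
Qed.

(** The chain rule and uniqueness of the derivative, for the factorization through the second pair
    of charts that is valid near x. *)
Lemma local_jac_change i i' j j' x : chart_dom i x -> chart_dom i' x ->
  chart_dom j (f x) -> chart_dom j' (f x) ->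
  local_jac i j (chart i x) = transition_jac i i' (chart i x) *m local_jac i' j' (chart i' x)
    *m transition_jac j' j (chart j' (f x)).
Proof.
move=> ix i'x jx j'x; apply: mdiff_uniq (local_mdiff ix jx) _.
have T1 := transition_mdiff ix i'x; have T3 := transition_mdiff j'x jx.
have T2 : mdiff (local_map i' j') (chart i' (param i (chart i x))) (local_jac i' j' (chart i' x)).
  by rewrite coordK //; exact: local_mdiff.
have T12 := mdiff_comp T1 T2.
have E : local_map i' j' (chart i' (param i (chart i x))) = chart j' (f x).
  by rewrite /local_map !coordK.
have T4 : mdiff (fun z => chart j (param j' z)) (local_map i' j' (chart i' (param i (chart i x))))
    (transition_jac j' j (chart j' (f x))) by rewrite E.
have T := mdiff_comp T12 T4; apply: mdiff_near T _.
have xn : nbhs x (chart_dom i' `&` f @^-1` chart_dom j').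
  by apply: filterI; [exact: nbhs_chart_dom|apply: fH.1; exact: nbhs_chart_dom].
have [d d0 Hd] := local_map_near ix jx xn; exists d => // v /Hd [y [iy jy [i'y j'y]] [_ yE]].
by rewrite /local_map -yE (coordK i'y) (coordK j'y).
Qed.

End Maps.
End Charts.

Lemma herm_inj (R : realType) n (G G' : 'M[Cx R]_n) : (forall u v, herm G u v = herm G' u v) -> G = G'.
Proof.
move=> E; apply/matrixP => i j.
have e (X : 'M[Cx R]_n) : X i j = herm X (row i 1%:M) (row j 1%:M).
  by rewrite -gram_entry adjmx1 mul1mx mulmx1.
by rewrite (e G) (e G').
Qed.

(** * The volume ratio as a quotient of determinants *)

Section VolumeRatio.
Variables (R : realType) (m n : nat).
Local Notation C := (Cx R).

Variables (M : kahler_manifold R m) (N : kahler_manifold R n) (f : M -> N).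
Hypothesis fH : holomorphic_map f.

Definition pullback_mx (i : chart_index M) (j : chart_index N) (z : 'rV[C]_m) : 'M[C]_m :=
  local_jac f i j z *m metric_mx j (local_map f i j z) *m adjmx (local_jac f i j z).

Lemma metric_mx_change p (X : kahler_manifold R p) (i i' : chart_index X) x :
  chart_dom i x -> chart_dom i' x ->
  metric_mx i (chart i x) = transition_jac i i' (chart i x) *m metric_mx i' (chart i' x)
    *m adjmx (transition_jac i i' (chart i x)).
Proof.
by move=> ix i'x; apply: herm_inj => u v; rewrite herm_conj; exact: metric_change.
Qed.

Lemma pullback_mx_change i i' j j' x : chart_dom i x -> chart_dom i' x ->
  chart_dom j (f x) -> chart_dom j' (f x) ->
  pullback_mx i j (chart i x) = transition_jac i i' (chart i x) *m pullback_mx i' j' (chart i' x)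
    *m adjmx (transition_jac i i' (chart i x)).
Proof.
move=> ix i'x jx j'x; have E1 := local_jac_change fH ix i'x jx j'x.
have E2 := metric_mx_change j'x jx.
have E3 : local_map f i j (chart i x) = chart j (f x) by rewrite /local_map coordK.
have E4 : local_map f i' j' (chart i' x) = chart j' (f x) by rewrite /local_map coordK.
rewrite /pullback_mx E3 E4 E2 E1.
move: (transition_jac i i' _) (local_jac f i' j' _) (transition_jac j' j _) (metric_mx j _) => T A S H.
by rewrite !adjmxM !mulmxA.
Qed.

Lemma adjmx_metric_mx p (X : kahler_manifold R p) (i : chart_index X) z : chart_image i z ->
  adjmx (metric_mx i z) = metric_mx i z.
Proof. by move=> iz; apply/matrixP => a b; rewrite adjmxE -(metric_hermitian iz). Qed.

Lemma det_metric_gt0 p (X : kahler_manifold R p) (i : chart_index X) z : chart_image i z ->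
  0 < \det (metric_mx i z).
Proof.
by move=> iz; apply: pd_det_gt0; [exact: adjmx_metric_mx|exact: metric_positive].
Qed.

Lemma adjmx_pullback_mx i j x : chart_dom i x -> chart_dom j (f x) ->
  adjmx (pullback_mx i j (chart i x)) = pullback_mx i j (chart i x).
Proof.
move=> ix jx; apply: adjmx_gram; apply: adjmx_metric_mx; exact: local_map_image.
Qed.

Lemma vol_ratio_center x : let i := chart_at x in let j := chart_at (f x) in
  ofR (vol_ratio f x) = \det (pullback_mx i j (chart i x)) / \det (metric_mx i (chart i x)).
Proof.
move=> i j; have ix : chart_dom i x := dom_chart_at x.
have jx : chart_dom j (f x) := dom_chart_at (f x).
have [c c0 Hc] := wedge_pow_kform R m.
have Pw : ofR (wedge_pow (pullback_kform f x) (@real_frame R m))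
    = c * \det (pullback_mx i j (chart i x)).
  rewrite -Hc; last first.
    by move=> a b; rewrite -{1}(adjmx_pullback_mx ix jx) adjmxE.
  congr (ofR (wedge_pow _ _)); apply/funext => u; apply/funext => v.
  rewrite /pullback_kform /kform herm_conj /local_map coordK //.
have Gw : ofR (wedge_pow (kform (metric_at x)) (@real_frame R m)) = c * \det (metric_mx i (chart i x)).
  by rewrite Hc // => a b; apply: metric_hermitian; exists x.
have -> : ofR (vol_ratio f x) = ofR (wedge_pow (pullback_kform f x) (@real_frame R m))
    / ofR (wedge_pow (kform (metric_at x)) (@real_frame R m)) by exact: fmorph_div.
by rewrite Pw Gw -mulf_div divff // mul1r.
Qed.

(** [vol_ratio] uses the distinguished charts of each point, which may change abruptly from point to
    point. A change of source chart multiplies both determinants by the same |det T|^2 and a change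
    of target chart leaves [pullback_mx] alone, so any fixed pair of charts serves near x. *)
Lemma vol_ratio_chart i j x : chart_dom i x -> chart_dom j (f x) ->
  ofR (vol_ratio f x) = \det (pullback_mx i j (chart i x)) / \det (metric_mx i (chart i x)).
Proof.
move=> ix jx; have ix' := dom_chart_at x; have jx' := dom_chart_at (f x).
rewrite vol_ratio_center (pullback_mx_change ix ix' jx jx') (metric_mx_change ix ix').
have G0 : \det (metric_mx i (chart i x)) != 0 by rewrite gt_eqF // det_metric_gt0 //; exists x.
move: G0; rewrite (metric_mx_change ix ix') !det_gram mulf_eq0 negb_or => /andP[t0 _].
by rewrite -mulf_div divff // mul1r.
Qed.

End VolumeRatio.

(** * Continuity of D and the estimate at its maximum *)

Section MaximumPoint.
Variables (R : realType) (m n : nat).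
Local Notation C := (Cx R).
Variables (M : kahler_manifold R m) (N : kahler_manifold R n) (f : M -> N).
Hypothesis fH : holomorphic_map f.

Lemma pullback_mx_cont i j x : chart_dom i x -> chart_dom j (f x) ->
  mxcont (pullback_mx f i j) (chart i x).
Proof.
move=> ix jx; have [d d0 Hd] := local_mdiff_near fH ix jx.
have Jc : mxcont (local_jac f i j) (chart i x).
  move=> a b e e0; have [r r0 Hr] := jacobian_continuous d0 Hd e0.
  by exists r => // v /Hr; exact.
have Hc : mxcont (fun z => metric_mx j (local_map f i j z)) (chart i x).
  move=> a b; apply: (ccont_comp (phi := fun y => metric_mx j y a b) (local_mdiff fH ix jx)).
  by apply: csmooth_ccont (metric_smooth j a b) _; exact: local_map_image.
exact: mxcontM (mxcontM Jc Hc) (mxcont_adj Jc).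
Qed.

Lemma vol_ratio_continuous : continuous (vol_ratio f).
Proof.
move=> x; have ix := dom_chart_at x; have jx := dom_chart_at (f x).
(* The charts at x are kept fixed while the point varies. *)
move: (chart_at x) (chart_at (f x)) ix jx => i j ix jx.
have iz : chart_image i (chart i x) by exists x.
have Gc : mxcont (metric_mx i) (chart i x).
  by move=> a b; exact: csmooth_ccont (metric_smooth i a b) iz.
have G0 : \det (metric_mx i (chart i x)) != 0 by rewrite gt_eqF // det_metric_gt0.
have := ccontM (ccont_det (pullback_mx_cont ix jx)) (ccontV G0 (ccont_det Gc)).
pose D z := \det (pullback_mx f i j z) / \det (metric_mx i z).
have DE y : chart_dom i y -> chart_dom j (f y) -> ofR (vol_ratio f y) = D (chart i y).
  exact: vol_ratio_chart.
rewrite -[X in ccont X]/D; move: D DE => D DE Dc.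
move=> A /nbhs_ballP [e /= e0 eA]; have e2 : 0 < e / 2 by rewrite divr_gt0.
have [d d0 Hd] := Dc _ e2; have xn := coord_near ix d0.
have jn : nbhs x (f @^-1` chart_dom j) by apply: fH.1; exact: nbhs_chart_dom.
have vA : nbhs x (vol_ratio f @^-1` A); last exact: vA.
apply: filterS (filterI (filterI xn jn) (nbhs_chart_dom ix)) => y [[/Hd h jy] iy].
have E : chart i x + (chart i y - chart i x) = chart i y by rewrite addrC subrK.
move: h; rewrite E -(DE x ix jx) -(DE y iy jy) -rmorphB cabs_ofR => h.
by apply: eA; rewrite /ball /= distrC; apply: le_lt_trans h _; lra.
Qed.

Lemma herm_pullback_ge0 i j x u : chart_dom i x -> chart_dom j (f x) ->
  0 <= herm (pullback_mx f i j (chart i x)) u u.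
Proof.
move=> ix jx; rewrite herm_conj; apply: herm_ge0 => w w0; apply: metric_positive => //.
exact: local_map_image.
Qed.

Lemma vol_ratio_ge0 x : 0 <= vol_ratio f x.
Proof.
have ix := dom_chart_at x; have jx := dom_chart_at (f x).
rewrite -ler_ofR rmorph0 (vol_ratio_chart fH ix jx) divr_ge0 //.
  by apply: psd_det_ge0 => [|u]; [exact: adjmx_pullback_mx|exact: herm_pullback_ge0].
by apply: ltW; apply: det_metric_gt0; exists x.
Qed.

Lemma vol_ratio_gt0 x : \rank (dmap f x) = m -> 0 < vol_ratio f x.
Proof.
move=> rk; have ix := dom_chart_at x; have jx := dom_chart_at (f x).
rewrite -ltr_ofR rmorph0 (vol_ratio_chart fH ix jx) divr_gt0 //; last first.
  by apply: det_metric_gt0; exists x.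
have Jf : row_free (local_jac f (chart_at x) (chart_at (f x)) (chart (chart_at x) x)).
  by apply/eqP; exact: rk.
apply: pd_det_gt0 => [|u u0]; first exact: adjmx_pullback_mx.
rewrite herm_conj; apply: metric_positive; first exact: local_map_image.
by apply: contra u0 => /eqP E; apply/eqP; apply: (row_free_inj Jf); rewrite E mul0mx.
Qed.

Lemma vol_ratio_local_max x : (forall y, vol_ratio f y <= vol_ratio f x) ->
  forall i j, chart_dom i x -> chart_dom j (f x) ->
  exists2 d : R, 0 < d & forall v, nrm v < d ->
    \det (pullback_mx f i j (chart i x + v)) * \det (metric_mx i (chart i x))
    <= \det (pullback_mx f i j (chart i x)) * \det (metric_mx i (chart i x + v)).
Proof.
have cross (p q g h : C) : 0 < g -> 0 < h -> p / g <= q / h -> p * h <= q * g.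
  by move=> g0 h0; rewrite ler_pdivrMr // mulrAC ler_pdivlMr.
move=> xmax i j ix jx; have [d d0 Hd] := local_map_near fH ix jx filterT.
exists d => // v /Hd [y [iy jy _] [<- _]].
have := xmax y; rewrite -ler_ofR (vol_ratio_chart fH ix jx) (vol_ratio_chart fH iy jy).
have Gx : 0 < \det (metric_mx i (chart i x)) by apply: det_metric_gt0; exists x.
have Gy : 0 < \det (metric_mx i (chart i y)) by apply: det_metric_gt0; exists y.
exact: cross.
Qed.

Lemma vol_ratio_max_ge x (K kappa : R) : (forall y, vol_ratio f y <= vol_ratio f x) ->
  0 < vol_ratio f x -> 0 <= K -> 0 < kappa -> ricci_ge M K -> mricci_le N m kappa ->
  (K / kappa) ^+ m <= vol_ratio f x.
Proof.
move=> xmax D0 K0 k0 ricM ricN.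
have ix := dom_chart_at x; have jx := dom_chart_at (f x).
move: (chart_at x) (chart_at (f x)) ix jx => i j ix jx.
have iz : chart_image i (chart i x) by exists x.
have jF := local_map_image ix jx.
have Gx : 0 < \det (metric_mx i (chart i x)) by exact: det_metric_gt0.
have Px : 0 < \det (pullback_mx f i j (chart i x)).
  move: D0; rewrite -ltr_ofR rmorph0 (vol_ratio_chart fH ix jx) ltr_pdivlMr // mul0r //.
have [d d0 Hd] := local_mdiff_near fH ix jx.
have est := local_estimate (@image_open _ _ M i) (@image_open _ _ N j) iz jF
  (metric_smooth i) (@metric_hermitian _ _ M i) (@metric_positive _ _ M i)
  (metric_smooth j) (@metric_hermitian _ _ N j) (@metric_positive _ _ N j)
  d0 Hd Px (vol_ratio_local_max xmax ix jx) (ricM i _ iz) (ricN j _ jF).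
rewrite -ler_ofR (vol_ratio_chart fH ix jx) ler_pdivlMr // rmorphXn.
apply: relative_det_ge.
- exact: adjmx_metric_mx.
- exact: adjmx_pullback_mx.
- by rewrite divr_ge0 // ltW.
- exact: metric_positive.
move=> u; have k0' : 0 < ofR kappa by rewrite -(rmorph0 (@ofR R)) ltr_ofR.
have kE : ofR kappa * ofR (K / kappa) = ofR K by rewrite -rmorphM mulrCA divff ?gt_eqF // mulr1.
by rewrite -(ler_pM2l k0') mulrA kE; exact: est.
Qed.

End MaximumPoint.

Theorem corollary3p5 (R : realType) (m n : nat)
    (M : kahler_manifold R m) (N : kahler_manifold R n) (f : M -> N)
    (K kappa : R) :
  (0 < m)%N -> (m <= n)%N ->
  compact [set: M] ->
  holomorphic_map f ->
  0 < K -> ricci_ge M K ->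
  0 < kappa -> mricci_le N m kappa ->
  nondegenerate_map f ->
  exists x : M,
    (forall y : M, vol_ratio f y `^ m%:R^-1 <= vol_ratio f x `^ m%:R^-1) /\
    K / kappa <= vol_ratio f x `^ m%:R^-1.
Proof.
move=> m0 mn Mc fH K0 ricM k0 ricN [x1 rk].
have [x _ xmax] : exists2 x, x \in [set: M] & forall y, y \in [set: M] -> vol_ratio f y <= vol_ratio f x.
  apply: compact_EVT_max => //; first by exists x1.
  by apply: continuous_subspaceT; exact: vol_ratio_continuous.
have {}xmax y : vol_ratio f y <= vol_ratio f x by apply: xmax; rewrite inE.
(* Non-degeneracy at the single point [x1] makes D positive at its maximum, where f^*h is then
   positive definite. *)
have D0 : 0 < vol_ratio f x by apply: lt_le_trans (xmax x1); exact: vol_ratio_gt0.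
exists x; split=> [y|].
  by apply: ge0_ler_powR; rewrite ?nnegrE ?invr_ge0 ?vol_ratio_ge0.
have c0 : 0 <= K / kappa by rewrite divr_ge0 // ltW.
have -> : K / kappa = ((K / kappa) ^+ m) `^ m%:R^-1.
  by rewrite -powR_mulrn // -powRrM divff ?powRr1 // pnatr_eq0 -lt0n.
apply: ge0_ler_powR; rewrite ?nnegrE ?invr_ge0 ?exprn_ge0 ?vol_ratio_ge0 //.
by apply: vol_ratio_max_ge => //; exact: ltW.
Qed.
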